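(* For every simplicial set $S$, the canonical maps $\mathfrak{C}(S)\leftarrow\mathfrak{C}^{hoc}(S)\to\mathfrak{C}^{nec}(S)$ are weak equivalences of simplicial categories.
   Context: Simplicial categories are categories enriched over simplicial sets; they form a category $s\mathrm{Cat}$. A map $F\colon \mathcal{C}\to\mathcal{D}$ in $s\mathrm{Cat}$ is a weak equivalence (DK-equivalence) if (1) for all objects $a,b$ of $\mathcal{C}$ the map $\mathcal{C}(a,b)\to\mathcal{D}(Fa,Fb)$ is a Kan equivalence (a weak homotopy equivalence of simplicial sets), and (2) the induced functor $\pi_0\mathcal{C}\to\pi_0\mathcal{D}$ is surjective on isomorphism classes. The functor $\mathfrak{C}\colon s\mathrm{Set}\to s\mathrm{Cat}$ is the left adjoint of the coherent nerve. Explicitly, $\mathfrak{C}(\Delta^n)$ has object set $\{0,\dots,n\}$, and $\mathfrak{C}(\Delta^n)(i,j)$ is the nerve of the poset of all subsets of $\{i,\dots,j\}$ containing $i$ and $j$, ordered by inclusion (empty if $j<i$), with composition given by union; monotone maps act by taking images. For a simplicial set $S$, $\mathfrak{C}(S)=\operatorname{colim}_{\Delta^n\to S}\mathfrak{C}(\Delta^n)$ in $s\mathrm{Cat}$; its object set is $S_0$. A necklace is a simplicial set $\Delta^{n_0}\vee\cdots\vee\Delta^{n_k}$, $n_i\ge0$, where the final vertex of $\Delta^{n_i}$ is glued to the initial vertex of $\Delta^{n_{i+1}}$; $\alpha_T,\omega_T$ (or $\alpha,\omega$) denote the first and last vertices of $T$. $T\vee U$ is obtained by gluing $\omega_T$ to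 $\alpha_U$. $\mathrm{Nec}$ is the category of necklaces and simplicial maps preserving first and last vertices. $T\to S_{a,b}$ means a map $T\to S$ with $\alpha_T\mapsto a$, $\omega_T\mapsto b$. $(\mathrm{Nec}\downarrow S)_{a,b}$ is the category of pairs $[T,T\to S_{a,b}]$, with morphisms the maps of necklaces over $S$. $\mathfrak{C}^{nec}(S)$ is the simplicial category with object set $S_0$ and $\mathfrak{C}^{nec}(S)(a,b)=N(\mathrm{Nec}\downarrow S)_{a,b}$, with composition induced by $([T_2,T_2\to S_{b,c}],[T_1,T_1\to S_{a,b}])\mapsto[T_1\vee T_2,T_1\vee T_2\to S_{a,c}]$. $\mathfrak{C}^{hoc}(S)$ is the simplicial category with object set $S_0$ and $\mathfrak{C}^{hoc}(S)(a,b)=\operatorname{hocolim}_{T\in(\mathrm{Nec}\downarrow S)_{a,b}}\mathfrak{C}(T)(\alpha,\omega)$, modelled by the diagonal of the bisimplicial set whose $(k,l)$-simplices are pairs $(F\colon[k]\to(\mathrm{Nec}\downarrow S)_{a,b};\ x\in\mathfrak{C}(F(0))(\alpha,\omega)_l)$, where $F(0)$ denotes the underlying necklace of the value of the functor $F$ at $0\in[k]$. Composition is given by wedging the necklaces and using the maps $\mathfrak{C}(U)(\alpha_U,\omega_U)\times\mathfrak{C}(T)(\alpha_T,\omega_T)\to\mathfrak{C}(T\vee U)(\omega_T,\omega_U)\times\mathfrak{C}(T\vee U)(\alpha_T,\omega_T)\to\mathfrak{C}(T\vee U)(\alpha_T,\omega_U)$, the first induced by inclusions and the second composition in $\mathfrak{C}(T\vee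 U)$. The canonical maps are the identity on objects. The map $\mathfrak{C}^{hoc}(S)(a,b)\to\mathfrak{C}^{nec}(S)(a,b)$ is the map of homotopy colimits induced by the map from the diagram $T\mapsto\mathfrak{C}(T)(\alpha,\omega)$ to the constant diagram at a point (it sends $(F;x)$ to $F$). The map $\mathfrak{C}^{hoc}(S)(a,b)\to\mathfrak{C}(S)(a,b)$ is the canonical map from the homotopy colimit to $\operatorname{colim}_{T\in(\mathrm{Nec}\downarrow S)_{a,b}}\mathfrak{C}(T)(\alpha,\omega)$ followed by the map from this colimit to $\mathfrak{C}(S)(a,b)$ induced by the maps $\mathfrak{C}(T)\to\mathfrak{C}(S)$. *)

(* Defs.v *)
From Stdlib Require Import Relations.
From mathcomp Require Import all_boot.
From mathcomp Require Import boolp.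

Set Implicit Arguments.
Unset Strict Implicit.
Unset Printing Implicit Defensive.

#[local] Obligation Tactic := idtac.

Section Quotient.
Variables (A : Type) (R : A -> A -> Prop).

Record quot := Quot {
  qclass : A -> Prop;
  qclassP : exists a, qclass = clos_refl_sym_trans A R a
}.

Definition qpi (a : A) : quot := Quot (ex_intro _ a erefl).

Lemma quot_eq (u v : quot) : qclass u = qclass v -> u = v.
Proof.
by case: u v => [c cP] [d dP] /= e; subst d; rewrite (Prop_irrelevance cP dP).
Qed.

Lemma qpi_eq a b : clos_refl_sym_trans A R a b -> qpi a = qpi b.
Proof.
move=> ab; apply: quot_eq => /=; apply: funext => c; apply: propext; split=> h.
- by apply: rst_trans h; apply: rst_sym.
- exact: rst_trans ab h.
Qed.

Lemma qpi_step a b : R a b -> qpi a = qpi b.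
Proof. by move=> ab; apply/qpi_eq/rst_step. Qed.

Lemma qpi_inj a b : qpi a = qpi b -> clos_refl_sym_trans A R a b.
Proof. by case=> ->; apply: rst_refl. Qed.

Lemma qpi_surj u : exists a, qpi a = u.
Proof. by case: (qclassP u) => a e; exists a; apply: quot_eq. Qed.

Definition qrepr (u : quot) : A := sval (cid (qpi_surj u)).

Lemma qreprK u : qpi (qrepr u) = u.
Proof. exact: svalP (cid (qpi_surj u)). Qed.

Lemma quot_ind (P : quot -> Prop) : (forall a, P (qpi a)) -> forall u, P u.
Proof. by move=> h u; rewrite -(qreprK u). Qed.

Definition qlift B (f : A -> B) (u : quot) : B := f (qrepr u).

Lemma qliftE B (f : A -> B) : (forall a b, R a b -> f a = f b) ->
  forall a, qlift f (qpi a) = f a.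
Proof.
move=> h a; have gen x y : clos_refl_sym_trans A R x y -> f x = f y.
  by elim=> [{}x {}y /h|//|//|x' y' z _ -> _ ->].
exact/gen/qpi_inj/qreprK.
Qed.

End Quotient.

Record mono (m n : nat) := Mono {
  mfun :> 'I_m.+1 -> 'I_n.+1;
  mono_homo : forall i j : 'I_m.+1, i <= j -> mfun i <= mfun j
}.

Definition mid n : mono n n := @Mono n n (fun i => i) (fun i j h => h).

Definition mcomp k m n (g : mono m n) (f : mono k m) : mono k n :=
  @Mono k n (fun i => g (f i)) (fun i j h => mono_homo g (mono_homo f h)).

Definition mconst m n (i : 'I_n.+1) : mono m n :=
  @Mono m n (fun _ => i) (fun _ _ _ => leqnn i).

Lemma mono_ext m n (f g : mono m n) : f =1 g -> f = g.
Proof.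
case: f g => [f fP] [g gP] /= /funext e; subst g.
by rewrite (Prop_irrelevance fP gP).
Qed.

Record sSet := SSet {
  simp :> nat -> Type;
  act : forall m n, mono m n -> simp n -> simp m;
  act_id : forall n (x : simp n), act (mid n) x = x;
  act_comp : forall k m n (f : mono k m) (g : mono m n) (x : simp n),
    act (mcomp g f) x = act f (act g x)
}.

Definition vertex (X : sSet) n (x : X n) (i : 'I_n.+1) : X 0 :=
  act (mconst 0 i) x.

Definition degen (X : sSet) n (x : X 0) : X n := act (mconst n ord0) x.

Lemma act_degen (X : sSet) m n (f : mono m n) (x : X 0) :
  act f (degen n x) = degen m x.
Proof. by rewrite /degen -act_comp; congr act; apply: mono_ext. Qed.

Lemma degen0 (X : sSet) (x : X 0) : degen 0 x = x.
Proof.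
by rewrite -[RHS]act_id; congr act; apply: mono_ext => i; rewrite (ord1 i).
Qed.

Lemma vertex_act (X : sSet) m n (f : mono m n) (x : X n) (i : 'I_m.+1) :
  vertex (act f x) i = vertex x (f i).
Proof. by rewrite /vertex -act_comp; congr act; apply: mono_ext. Qed.

Record sMap (X Y : sSet) := SMap {
  sfun :> forall n, X n -> Y n;
  sfun_act : forall m n (f : mono m n) (x : X n),
    sfun (act f x) = act f (sfun x)
}.

Lemma sMap_ext X Y (f g : sMap X Y) :
  (forall n (x : X n), f _ x = g _ x) -> f = g.
Proof.
case: f g => [f fP] [g gP] /= e.
have {}e : f = g.
  by apply: functional_extensionality_dep => n; apply: funext => x; apply: e.
by subst g; rewrite (Prop_irrelevance fP gP).
Qed.

Definition sMap_id X : sMap X X := @SMap X X (fun _ x => x) (fun _ _ _ _ => erefl).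

Program Definition sMap_comp X Y Z (g : sMap Y Z) (f : sMap X Y) : sMap X Z :=
  @SMap X Z (fun _ x => g _ (f _ x)) _.
Next Obligation. by move=> * /=; rewrite !sfun_act. Qed.

Lemma sMap_compE X Y Z (g : sMap Y Z) (f : sMap X Y) n (x : X n) :
  sMap_comp g f n x = g n (f n x).
Proof. by []. Qed.

Lemma sfun_vertex X Y (f : sMap X Y) n (x : X n) i :
  f _ (vertex x i) = vertex (f _ x) i.
Proof. exact: sfun_act. Qed.

Lemma sfun_degen X Y (f : sMap X Y) n (x : X 0) :
  f _ (degen n x) = degen n (f _ x).
Proof. exact: sfun_act. Qed.

Program Definition Delta (n : nat) : sSet :=
  @SSet (fun m => mono m n) (fun _ _ f x => mcomp x f) _ _.
Next Obligation. by move=> n m x; apply: mono_ext. Qed.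
Next Obligation. by move=> *; apply: mono_ext. Qed.

Program Definition Delta_map m n (f : mono m n) : sMap (Delta m) (Delta n) :=
  @SMap (Delta m) (Delta n) (fun _ x => mcomp f x) _.
Next Obligation. by move=> *; apply: mono_ext. Qed.

Definition in_horn n (k : 'I_n.+1) m (x : mono m n) : Prop :=
  exists2 j, j <> k & forall i, x i <> j.

Lemma in_horn_act n (k : 'I_n.+1) m' m (f : mono m' m) (x : mono m n) :
  in_horn k x -> in_horn k (mcomp x f).
Proof. by case=> j jk h; exists j => // i; apply: h. Qed.

Program Definition horn n (k : 'I_n.+1) : sSet :=
  @SSet (fun m => {x : mono m n | in_horn k x})
        (fun _ _ f x => exist _ (mcomp (sval x) f) (in_horn_act f (svalP x))) _ _.
Next Obligation. by move=> n k m [x xP]; apply: eq_exist; apply: mono_ext. Qed.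
Next Obligation.
by move=> n k m1 m2 m3 f g [x xP]; apply: eq_exist; apply: mono_ext.
Qed.

Definition kan_complex (K : sSet) : Prop :=
  forall n (k : 'I_n.+2) (h : sMap (horn k) K),
    exists s : sMap (Delta n.+1) K,
      forall m (x : horn k m), s _ (sval x) = h _ x.

Program Definition sProd (X Y : sSet) : sSet :=
  @SSet (fun n => (X n * Y n)%type)
        (fun _ _ f x => (act f x.1, act f x.2)) _ _.
Next Obligation. by move=> X Y n [x y] /=; rewrite !act_id. Qed.
Next Obligation. by move=> * /=; rewrite !act_comp. Qed.

Program Definition sProd_map X X' Y Y' (f : sMap X X') (g : sMap Y Y') :
    sMap (sProd X Y) (sProd X' Y') :=
  @SMap (sProd X Y) (sProd X' Y') (fun _ x => (f _ x.1, g _ x.2)) _.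
Next Obligation. by move=> * /=; rewrite !sfun_act. Qed.

Program Definition sFun (X Y : sSet) : sSet :=
  @SSet (fun n => sMap (sProd X (Delta n)) Y)
        (fun _ _ f u => sMap_comp u (sProd_map (sMap_id X) (Delta_map f))) _ _.
Next Obligation.
move=> X Y n u; apply: sMap_ext => m [x y] /=; congr (u _ (_, _)).
exact: mono_ext.
Qed.
Next Obligation.
by move=> X Y k m n f g u; apply: sMap_ext => p [x y].
Qed.

Program Definition sFun_precomp X X' (f : sMap X X') Y :
    sMap (sFun X' Y) (sFun X Y) :=
  @SMap (sFun X' Y) (sFun X Y)
        (fun n u => sMap_comp u (sProd_map f (sMap_id (Delta n)))) _.
Next Obligation. by move=> *; apply: sMap_ext. Qed.

Definition edge_rel (X : sSet) (x y : X 0) : Prop :=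
  exists e : X 1, vertex e ord0 = x /\ vertex e ord_max = y.

Definition pi0 (X : sSet) : Type := quot (@edge_rel X).

Definition pi0_map X Y (f : sMap X Y) : pi0 X -> pi0 Y :=
  qlift (fun x : X 0 => qpi (@edge_rel Y) (f _ x)).

Lemma edge_rel_map X Y (f : sMap X Y) (x y : X 0) :
  edge_rel x y -> edge_rel (f _ x) (f _ y).
Proof. by case=> e [<- <-]; exists (f _ e); rewrite !sfun_vertex. Qed.

Lemma pi0_mapE X Y (f : sMap X Y) (x : X 0) :
  pi0_map f (qpi _ x) = qpi _ (f _ x).
Proof.
rewrite /pi0_map (qliftE (f := fun x : X 0 => qpi (@edge_rel Y) (f _ x))) //.
by move=> a b ab; apply/qpi_step/edge_rel_map.
Qed.

(** Weak homotopy equivalences of simplicial sets, in their purely simplicial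
    definition (no geometric realization): [f] induces a bijection
    [pi0 (Fun(X', K)) -> pi0 (Fun(X, K))] for every Kan complex [K]. *)
Definition kan_equivalence X X' (f : sMap X X') : Prop :=
  forall K, kan_complex K -> bijective (pi0_map (sFun_precomp f K)).

Record category := Category {
  ob :> Type;
  hom : ob -> ob -> Type;
  idc : forall a, hom a a;
  compc : forall a b c, hom b c -> hom a b -> hom a c;
  compcA : forall a b c d (h : hom c d) (g : hom b c) (f : hom a b),
    compc h (compc g f) = compc (compc h g) f;
  comp1c : forall a b (f : hom a b), compc (idc b) f = f;
  compc1 : forall a b (f : hom a b), compc f (idc a) = f
}.
Arguments idc {_} a.

Definition isomorphic (C : category) (a b : C) : Prop :=
  exists (f : hom a b) (g : hom b a), compc g f = idc a /\ compc f g = idc b.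

Record functor (C D : category) := Functor {
  fob :> C -> D;
  fhom : forall a b, hom a b -> hom (fob a) (fob b);
  fhom_id : forall a, fhom (idc a) = idc (fob a);
  fhom_comp : forall a b c (g : hom b c) (f : hom a b),
    fhom (compc g f) = compc (fhom g) (fhom f)
}.

Definition surjective_on_iso_classes C D (F : functor C D) : Prop :=
  forall d : D, exists c : C, isomorphic (F c) d.

Program Definition ordc (n : nat) : category :=
  @Category 'I_n.+1 (fun i j => i <= j) (fun i => leqnn i)
    (fun i j k jk ij => leq_trans ij jk) _ _ _.
Next Obligation. by move=> *; apply: bool_irrelevance. Qed.
Next Obligation. by move=> *; apply: bool_irrelevance. Qed.
Next Obligation. by move=> *; apply: bool_irrelevance. Qed.

Program Definition functor_mono C m n (F : functor (ordc n) C) (f : mono m n) :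
    functor (ordc m) C :=
  @Functor (ordc m) C (fun i => F (f i))
    (fun i j h => fhom F (mono_homo f h : @hom (ordc n) (f i) (f j))) _ _.
Next Obligation.
by move=> C m n F f i; rewrite -fhom_id; congr fhom; apply: bool_irrelevance.
Qed.
Next Obligation.
by move=> *; rewrite -fhom_comp; congr fhom; apply: bool_irrelevance.
Qed.

Lemma functor_mono_id C n (F : functor (ordc n) C) : functor_mono F (mid n) = F.
Proof.
case: F => o h p1 p2; rewrite /functor_mono /=; congr Functor; exact: Prop_irrelevance.
Qed.

Lemma functor_mono_comp C k m n (F : functor (ordc n) C)
    (f : mono k m) (g : mono m n) :
  functor_mono F (mcomp g f) = functor_mono (functor_mono F g) f.
Proof. rewrite /functor_mono /=; congr Functor; exact: Prop_irrelevance. Qed.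

Definition nerve (C : category) : sSet :=
  @SSet (fun n => functor (ordc n) C) (fun m n f F => functor_mono F f)
    (fun n F => functor_mono_id F)
    (fun k m n f g F => functor_mono_comp F f g).

Record diagram (I : category) := Diagram {
  dob :> I -> sSet;
  dmap : forall i j, hom i j -> sMap (dob i) (dob j);
  dmap_id : forall i n (x : dob i n), dmap (idc i) _ x = x;
  dmap_comp : forall i j k (g : hom j k) (f : hom i j) n (x : dob i n),
    dmap (compc g f) _ x = dmap g _ (dmap f _ x)
}.

(** The diagonal of the bisimplicial set whose [(k, l)]-simplices are the pairs
    of a functor [F : [k] -> I] and an [l]-simplex of [D (F 0)]. *)
Section Hocolim.
Variables (I : category) (D : diagram I).

Definition hocolim_simp (n : nat) : Type :=
  {F : functor (ordc n) I & D (F ord0) n}.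

Definition hocolim_act m n (f : mono m n) (u : hocolim_simp n) :
    hocolim_simp m :=
  existT (fun F : functor (ordc m) I => D (F ord0) m)
    (functor_mono (projT1 u) f)
    (dmap D (fhom (projT1 u) (leq0n (f ord0) : @hom (ordc n) ord0 (f ord0)))
       _ (act f (projT2 u))).

Lemma hocolim_ext0 n (F G : functor (ordc n) I) (e : F = G)
    (x : D (F ord0) n) (y : D (G ord0) n) :
  (forall e0 : F ord0 = G ord0, eq_rect _ (fun i => D i n) x _ e0 = y) ->
  existT (fun F : functor (ordc n) I => D (F ord0) n) F x = existT _ G y.
Proof. by case: _ / e y => y /(_ erefl) /= ->. Qed.

Lemma eq_rect_id (T : Type) (P : T -> Type) (a : T) (x : P a) (e : a = a) :
  eq_rect a P x a e = x.
Proof. by rewrite (Prop_irrelevance e erefl). Qed.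

Program Definition hocolim : sSet := @SSet hocolim_simp hocolim_act _ _.
Next Obligation.
move=> n [F x]; apply: hocolim_ext0; first exact: functor_mono_id.
move=> /= e; rewrite eq_rect_id act_id.
rewrite (_ : fhom F _ = idc (F ord0)) ?dmap_id // -fhom_id.
by congr fhom; apply: bool_irrelevance.
Qed.
Next Obligation.
move=> k m n f g [F x]; apply: hocolim_ext0; first exact: functor_mono_comp.
move=> /= e; rewrite eq_rect_id act_comp -sfun_act -dmap_comp -fhom_comp.
set h1 := leq0n _; set h2 := compc _ _.
by rewrite (bool_irrelevance (h1 : is_true _) (h2 : is_true _)).
Qed.

(** The map from the homotopy colimit to the nerve of the index category, i.e.
    to the homotopy colimit of the constant diagram at a point. *)
Definition hocolim_to_nerve : sMap hocolim (nerve I) :=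
  @SMap hocolim (nerve I) (fun n u => projT1 u) (fun _ _ _ _ => erefl).

(** The map out of the homotopy colimit induced by a cocone, i.e. the canonical
    map to the colimit followed by the map given by the universal property. *)
Program Definition hocolim_desc (X : sSet) (c : forall i, sMap (D i) X)
    (cP : forall i j (f : hom i j) n (x : D i n), c j _ (dmap D f _ x) = c i _ x) :
    sMap hocolim X :=
  @SMap hocolim X (fun n u => c (projT1 u ord0) _ (projT2 u)) _.
Next Obligation. by move=> X c cP m n f [F x] /=; rewrite cP sfun_act. Qed.

End Hocolim.

Record sCat := SCat {
  sob :> Type;
  shom : sob -> sob -> sSet;
  sid : forall a n, shom a a n;
  scomp : forall a b c n, shom b c n -> shom a b n -> shom a c n;
  sid_act : forall a m n (f : mono m n), act f (sid a n) = sid a m;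
  scomp_act : forall a b c m n (f : mono m n) (y : shom b c n) (x : shom a b n),
    act f (scomp y x) = scomp (act f y) (act f x);
  scompA : forall a b c d n (z : shom c d n) (y : shom b c n) (x : shom a b n),
    scomp z (scomp y x) = scomp (scomp z y) x;
  scomp1x : forall a b n (x : shom a b n), scomp (sid b n) x = x;
  scompx1 : forall a b n (x : shom a b n), scomp x (sid a n) = x
}.
Arguments sid {_} a n.

Record sFunctor (C D : sCat) := SFunctor {
  sfob :> C -> D;
  sfhom : forall a b, sMap (shom a b) (shom (sfob a) (sfob b));
  sfhom_id : forall a n, sfhom a a _ (sid a n) = sid (sfob a) n;
  sfhom_comp : forall a b c n (y : shom b c n) (x : shom a b n),
    sfhom a c _ (scomp y x) = scomp (sfhom b c _ y) (sfhom a b _ x)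
}.
Arguments sfhom {C D} s a b.

(** [sfhom F] with the endpoints of its values replaced by equal ones. *)
Definition sfhom_to C D (F : sFunctor C D) a b a' b'
    (p : F a = a') (q : F b = b') : sMap (shom a b) (shom a' b') :=
  match p in _ = a', q in _ = b' return sMap (shom a b) (shom a' b') with
  | erefl, erefl => sfhom F a b
  end.
Arguments sfhom_to {C D} F {a b a' b'} p q.

Section Pi0Category.
Variable C : sCat.

Definition pi0_comp (a b c : C) (u : pi0 (shom b c)) (v : pi0 (shom a b)) :
    pi0 (shom a c) :=
  qlift (fun y => qlift (fun x => qpi (@edge_rel _) (scomp y x)) v) u.

Lemma pi0_compE (a b c : C) (y : shom b c 0) (x : shom a b 0) :
  pi0_comp (qpi _ y) (qpi _ x) = qpi _ (scomp y x).
Proof.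
have right (z : shom b c 0) (x1 x2 : shom a b 0) : edge_rel x1 x2 ->
    qpi (@edge_rel _) (scomp z x1) = qpi (@edge_rel _) (scomp z x2).
  case=> e [<- <-]; apply: qpi_step; exists (scomp (degen 1 z) e).
  by rewrite /vertex !scomp_act !act_degen !degen0.
rewrite /pi0_comp qliftE ?qliftE //; first exact: right.
move=> y1 y2 [e [<- <-]]; elim/quot_ind: (qpi _ x) => {}x.
rewrite !qliftE; try exact: right.
apply: qpi_step; exists (scomp e (degen 1 x)).
by rewrite /vertex !scomp_act !act_degen !degen0.
Qed.

Program Definition pi0_cat : category :=
  @Category C (fun a b => pi0 (shom a b)) (fun a => qpi _ (sid a 0)) pi0_comp
    _ _ _.
Next Obligation.
move=> a b c d; elim/quot_ind => z; elim/quot_ind => y; elim/quot_ind => x.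
by rewrite !pi0_compE scompA.
Qed.
Next Obligation.
by move=> a b; elim/quot_ind => x; rewrite pi0_compE scomp1x.
Qed.
Next Obligation.
by move=> a b; elim/quot_ind => x; rewrite pi0_compE scompx1.
Qed.

End Pi0Category.

Program Definition pi0_functor C D (F : sFunctor C D) :
    functor (pi0_cat C) (pi0_cat D) :=
  @Functor (pi0_cat C) (pi0_cat D) F (fun a b => pi0_map (sfhom F a b)) _ _.
Next Obligation. by move=> C D F a /=; rewrite pi0_mapE sfhom_id. Qed.
Next Obligation.
move=> C D F a b c; elim/quot_ind => y; elim/quot_ind => x /=.
by rewrite pi0_compE !pi0_mapE pi0_compE sfhom_comp.
Qed.

Definition DK_equivalence C D (F : sFunctor C D) : Prop :=
  (forall a b, kan_equivalence (sfhom F a b)) /\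
  surjective_on_iso_classes (pi0_functor F).

Section CubeSimplicialCategory.
Variable n : nat.
Implicit Types (i j k : 'I_n.+1) (A B : {set 'I_n.+1}).

Definition between i j A : bool :=
  [&& i \in A, j \in A & A \subset [set k : 'I_n.+1 | i <= k <= j]].

(** The [l]-simplices of the nerve of the poset of the subsets of [{i, ..., j}]
    containing [i] and [j]. *)
Record chain i j (l : nat) := Chain {
  cset :> 'I_l.+1 -> {set 'I_n.+1};
  cset_mono : forall p q : 'I_l.+1, p <= q -> cset p \subset cset q;
  cset_between : forall p, between i j (cset p)
}.

Lemma chain_ext i j l (x y : chain i j l) : x =1 y -> x = y.
Proof.
case: x y => [x x1 x2] [y y1 y2] /= /funext e; subst y.
by rewrite (Prop_irrelevance x1 y1) (Prop_irrelevance x2 y2).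
Qed.

Definition chain_act i j l l' (f : mono l' l) (x : chain i j l) : chain i j l' :=
  @Chain i j l' (fun p => x (f p)) (fun p q h => cset_mono x (mono_homo f h))
    (fun p => cset_between x (f p)).

Program Definition chain_sSet i j : sSet :=
  @SSet (chain i j) (fun _ _ f => chain_act f) _ _.
Next Obligation. by move=> * /=; apply: chain_ext. Qed.
Next Obligation. by move=> * /=; apply: chain_ext. Qed.

Program Definition chain_id i l : chain i i l :=
  @Chain i i l (fun _ => [set i]) (fun _ _ _ => subxx _) _.
Next Obligation.
by move=> i l p; rewrite /between set11 sub1set inE leqnn.
Qed.

Lemma betweenU i j k A B : between j k B -> between i j A -> between i k (B :|: A).
Proof.
case/and3P=> jB kB /subsetP hB /and3P[iA jA /subsetP hA].
have := hA _ jA; have := hB _ jB; rewrite !inE leqnn /= andbT => jk ij.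
rewrite /between !inE iA kB orbT /=; apply/subsetP => x.
by rewrite inE => /orP[/hB|/hA]; rewrite !inE => /andP[h1 h2];
  rewrite ?h1 ?h2 ?(leq_trans ij h1) ?(leq_trans h2 jk).
Qed.

Definition chain_comp i j k l (y : chain j k l) (x : chain i j l) : chain i k l :=
  @Chain i k l (fun p => y p :|: x p)
    (fun p q h => setUSS (cset_mono y h) (cset_mono x h))
    (fun p => betweenU (cset_between y p) (cset_between x p)).

Program Definition frakC_Delta : sCat :=
  @SCat 'I_n.+1 chain_sSet chain_id chain_comp _ _ _ _ _.
Next Obligation. by move=> * /=; apply: chain_ext. Qed.
Next Obligation. by move=> * /=; apply: chain_ext. Qed.
Next Obligation. by move=> *; apply: chain_ext => p /=; rewrite setUA. Qed.
Next Obligation.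
move=> i j l x; apply: chain_ext => p /=; apply/setUidPr.
by rewrite sub1set; case/and3P: (cset_between x p).
Qed.
Next Obligation.
move=> i j l x; apply: chain_ext => p /=; apply/setUidPl.
by rewrite sub1set; case/and3P: (cset_between x p).
Qed.

End CubeSimplicialCategory.

Section CubeFunctoriality.
Variables (m n : nat) (f : mono m n).

Lemma between_imset i j A : between i j A -> between (f i) (f j) (f @: A).
Proof.
case/and3P=> iA jA /subsetP hA; rewrite /between !imset_f //=.
apply/subsetP => _ /imsetP[x /hA + ->]; rewrite !inE => /andP[h1 h2].
by rewrite !mono_homo.
Qed.

Definition chain_map i j l (x : chain i j l) : chain (f i) (f j) l :=
  @Chain n (f i) (f j) l (fun p => f @: x p)
    (fun p q h => imsetS f (cset_mono x h))
    (fun p => between_imset (cset_between x p)).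

Program Definition frakC_Delta_map : sFunctor (frakC_Delta m) (frakC_Delta n) :=
  @SFunctor (frakC_Delta m) (frakC_Delta n) f
    (fun i j => @SMap (chain_sSet i j) (chain_sSet (f i) (f j))
                  (@chain_map i j) _) _ _.
Next Obligation. by move=> * /=; apply: chain_ext. Qed.
Next Obligation. by move=> *; apply: chain_ext => p /=; rewrite imset_set1. Qed.
Next Obligation. by move=> *; apply: chain_ext => p /=; rewrite imsetU. Qed.

End CubeFunctoriality.

(** [frakC S] is the colimit of the simplicial categories [frakC_Delta n] over the
    simplices [Delta n -> S].  As the functor of objects and the functors of
    [l]-simplices of the morphisms commute with colimits, the set of objects is
    [S 0] and, for each [l], the category of [l]-simplices is presented by the
    generators [Gen s x], for [s : S n] and [x] an [l]-simplex of
    [frakC_Delta n (i, j)], and the relations making each [Gen s] a functor,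
    compatibly with the maps between simplices.  The theorem [frakC_colim] is the
    universal property of this colimit. *)

Section Words.
Variable S : sSet.

Inductive word (l : nat) : S 0 -> S 0 -> Type :=
| Gen n (s : S n) (i j : frakC_Delta n) (x : shom i j l) a b :
    vertex s i = a -> vertex s j = b -> word l a b
| Id a : word l a a
| Comp a b c : word l b c -> word l a b -> word l a c.

Inductive word_rel (l : nat) : forall a b, word l a b -> word l a b -> Prop :=
| rel_nat m n (f : mono m n) (s : S n) (i j : frakC_Delta m) (x : shom i j l) a b
    (p : vertex (act f s) i = a) (q : vertex (act f s) j = b)
    (p' : vertex s (f i) = a) (q' : vertex s (f j) = b) :
    word_rel (Gen x p q) (Gen (sfhom (frakC_Delta_map f) i j _ x) p' q')
| rel_sid n (s : S n) (i : frakC_Delta n) a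
    (p : vertex s i = a) (q : vertex s i = a) :
    word_rel (Gen (sid i l) p q) (Id l a)
| rel_scomp n (s : S n) (i j k : frakC_Delta n) (y : shom j k l) (x : shom i j l)
    a b c (p : vertex s i = a) (q : vertex s j = b) (r : vertex s k = c) :
    word_rel (Gen (scomp y x) p r) (Comp (Gen y q r) (Gen x p q))
| rel_assoc a b c d (w : word l c d) (v : word l b c) (u : word l a b) :
    word_rel (Comp w (Comp v u)) (Comp (Comp w v) u)
| rel_idl a b (u : word l a b) : word_rel (Comp (Id l b) u) u
| rel_idr a b (u : word l a b) : word_rel (Comp u (Id l a)) u
| rel_compl a b c (v v' : word l b c) (u : word l a b) :
    word_rel v v' -> word_rel (Comp v u) (Comp v' u)
| rel_compr a b c (v : word l b c) (u u' : word l a b) :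
    word_rel u u' -> word_rel (Comp v u) (Comp v u').

Fixpoint word_act l l' (f : mono l' l) a b (w : word l a b) : word l' a b :=
  match w with
  | Gen _ _ _ _ x _ _ p q => Gen (act f x) p q
  | Id a => Id l' a
  | Comp _ _ _ v u => Comp (word_act f v) (word_act f u)
  end.

Lemma word_act_rel l l' (f : mono l' l) a b (w w' : word l a b) :
  word_rel w w' -> word_rel (word_act f w) (word_act f w').
Proof.
elim=> {a b w w'}.
- move=> m n g s i j x a b p q p' q'.
  by have := rel_nat (act f x) p q p' q'; rewrite sfun_act.
- by move=> n s i a p q; have := rel_sid l' p q; rewrite -(sid_act i f).
- move=> n s i j k y x a b c p q r.
  by have := rel_scomp (act f y) (act f x) p q r; rewrite -scomp_act.
- by move=> a b c d w v u; apply: rel_assoc.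
- by move=> a b u; apply: rel_idl.
- by move=> a b u; apply: rel_idr.
- by move=> a b c v v' u _; apply: rel_compl.
- by move=> a b c v u u' _; apply: rel_compr.
Qed.

Lemma word_act_id l a b (w : word l a b) : word_act (mid l) w = w.
Proof.
elim: w => //= [n s i j x a' b' p q|*]; last by congr Comp.
by congr (Gen _ p q); exact: (@act_id (chain_sSet i j)).
Qed.

Lemma word_act_comp k l m (f : mono k l) (g : mono l m) a b (w : word m a b) :
  word_act (mcomp g f) w = word_act f (word_act g w).
Proof.
by elim: w => //= *; congr Comp.
Qed.

Definition mor l a b : Type := quot (@word_rel l a b).

Definition mor_act l l' (f : mono l' l) a b : mor l a b -> mor l' a b :=
  qlift (fun w => qpi (@word_rel l' a b) (word_act f w)).

Lemma mor_actE l l' (f : mono l' l) a b (w : word l a b) :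
  mor_act f (qpi _ w) = qpi _ (word_act f w).
Proof.
rewrite /mor_act (qliftE (f := fun w => qpi _ (word_act f w))) //.
by move=> u v uv; apply/qpi_step/word_act_rel.
Qed.

Program Definition frakC_hom a b : sSet :=
  @SSet (fun l => mor l a b) (fun _ _ f => @mor_act _ _ f a b) _ _.
Next Obligation.
by move=> a b l; elim/quot_ind => w; rewrite mor_actE word_act_id.
Qed.
Next Obligation.
by move=> a b k l m f g; elim/quot_ind => w; rewrite !mor_actE word_act_comp.
Qed.

Definition mor_comp l a b c (v : mor l b c) (u : mor l a b) : mor l a c :=
  qlift (fun y => qlift (fun x => qpi (@word_rel l a c) (Comp y x)) u) v.

Lemma mor_compE l a b c (v : word l b c) (u : word l a b) :
  mor_comp (qpi _ v) (qpi _ u) = qpi _ (Comp v u).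
Proof.
have right (z : word l b c) (x1 x2 : word l a b) : word_rel x1 x2 ->
    qpi (@word_rel _ _ _) (Comp z x1) = qpi (@word_rel _ _ _) (Comp z x2).
  by move=> h; apply/qpi_step/rel_compr.
rewrite /mor_comp qliftE ?qliftE //; first exact: right.
move=> y1 y2 h; elim/quot_ind: (qpi _ u) => {}u.
rewrite !qliftE; try exact: right.
exact/qpi_step/rel_compl.
Qed.

Program Definition frakC : sCat :=
  @SCat (S 0) frakC_hom (fun a l => qpi _ (Id l a)) (fun a b c l => @mor_comp l a b c)
    _ _ _ _ _.
Next Obligation. by move=> a m n f; rewrite /= mor_actE. Qed.
Next Obligation.
move=> a b c m n f; elim/quot_ind => y; elim/quot_ind => x /=.
by rewrite mor_compE !mor_actE mor_compE.
Qed.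
Next Obligation.
move=> a b c d n; elim/quot_ind => z; elim/quot_ind => y; elim/quot_ind => x /=.
by rewrite !mor_compE; apply/qpi_step/rel_assoc.
Qed.
Next Obligation.
by move=> a b n; elim/quot_ind => x; rewrite mor_compE; apply/qpi_step/rel_idl.
Qed.
Next Obligation.
by move=> a b n; elim/quot_ind => x; rewrite mor_compE; apply/qpi_step/rel_idr.
Qed.

End Words.

Section FrakCMap.
Variables (S S' : sSet) (f : sMap S S').

Lemma sfun_vertex_eq n (s : S n) i a : vertex s i = a -> vertex (f _ s) i = f _ a.
Proof. by move=> <-; rewrite sfun_vertex. Qed.

Fixpoint word_map l a b (w : word l a b) : word l (f _ a) (f _ b) :=
  match w with
  | Gen _ _ _ _ x _ _ p q => Gen x (sfun_vertex_eq p) (sfun_vertex_eq q)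
  | Id a => Id l (f _ a)
  | Comp _ _ _ v u => Comp (word_map v) (word_map u)
  end.

Lemma Gen_eq l n (s s' : S' n) (i j : frakC_Delta n) (x : shom i j l) a b
    (p : vertex s i = a) (q : vertex s j = b)
    (p' : vertex s' i = a) (q' : vertex s' j = b) :
  s = s' -> Gen x p q = Gen x p' q'.
Proof.
by move=> e; subst s'; rewrite (Prop_irrelevance p p') (Prop_irrelevance q q').
Qed.

Lemma word_map_rel l a b (w w' : word l a b) :
  word_rel w w' -> word_rel (word_map w) (word_map w').
Proof.
elim=> {a b w w'} /=; try by [constructor].
move=> m n g s i j x a b p q p' q'.
have e := sfun_act f g s.
have p2 : vertex (act g (f _ s)) i = f _ a by rewrite -e; apply: sfun_vertex_eq.
have q2 : vertex (act g (f _ s)) j = f _ b by rewrite -e; apply: sfun_vertex_eq.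
by rewrite (Gen_eq x (sfun_vertex_eq p) (sfun_vertex_eq q) p2 q2 e); apply: rel_nat.
Qed.

Definition mor_map l a b : mor l a b -> mor l (f _ a) (f _ b) :=
  qlift (fun w : word l a b => qpi (@word_rel S' l _ _) (word_map w)).

Lemma mor_mapE l a b (w : word l a b) :
  mor_map (qpi _ w) = qpi _ (word_map w).
Proof.
rewrite /mor_map (qliftE (f := fun w => qpi _ (word_map w))) //.
by move=> u v uv; apply/qpi_step/word_map_rel.
Qed.

Program Definition frakC_map : sFunctor (frakC S) (frakC S') :=
  @SFunctor (frakC S) (frakC S') (f 0)
    (fun a b => @SMap (frakC_hom a b) (frakC_hom _ _)
                  (fun l => @mor_map l a b) _) _ _.
Next Obligation.
move=> a b m n g; elim/quot_ind => w /=; rewrite mor_actE !mor_mapE mor_actE.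
by congr qpi; elim: w => //= *; congr Comp.
Qed.
Next Obligation. by move=> a n; rewrite /= mor_mapE. Qed.
Next Obligation.
move=> a b c n; elim/quot_ind => y; elim/quot_ind => x /=.
by rewrite mor_compE !mor_mapE mor_compE.
Qed.

Definition frakC_map_to a b a' b' (p : f _ a = a') (q : f _ b = b') :
    sMap (shom (s := frakC S) a b) (shom (s := frakC S') a' b') :=
  sfhom_to frakC_map p q.

Lemma frakC_map_to_id (a : frakC S) (a' : frakC S') (p q : f _ a = a') l :
  frakC_map_to p q l (sid a l) = sid a' l.
Proof.
subst a'; rewrite (Prop_irrelevance q erefl); exact: (sfhom_id frakC_map).
Qed.

Lemma frakC_map_to_comp (a b c : frakC S) (a' b' c' : frakC S')
    (p : f _ a = a') (q : f _ b = b') (r : f _ c = c') l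
    (y : shom b c l) (x : shom a b l) :
  frakC_map_to p r l (scomp y x) =
  scomp (frakC_map_to q r l y) (frakC_map_to p q l x).
Proof. by subst a' b' c'; exact: (sfhom_comp frakC_map). Qed.

End FrakCMap.
Arguments frakC_map_to {S S'} f {a b a' b'} p q.

Lemma frakC_map_to_idmap S (f : sMap S S) (a b : S 0) (p : f _ a = a) (q : f _ b = b)
    l (x : shom (s := frakC S) a b l) :
  (forall n s, f n s = s) -> frakC_map_to f p q _ x = x.
Proof.
move=> h; have e : f = sMap_id S by apply: sMap_ext.
subst f; rewrite (Prop_irrelevance p erefl) (Prop_irrelevance q erefl).
elim/quot_ind: x => w /=; rewrite mor_mapE; congr qpi.
by elim: w => //= *; [apply: Gen_eq | congr Comp].
Qed.

Lemma frakC_map_to_compmap S S' S'' (g : sMap S' S'') (f : sMap S S')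
    (h : sMap S S'') (a b : S 0) (a' b' : S' 0) (a'' b'' : S'' 0)
    (p : f _ a = a') (q : f _ b = b') (p' : g _ a' = a'') (q' : g _ b' = b'')
    (p'' : h _ a = a'') (q'' : h _ b = b'') l (x : shom (s := frakC S) a b l) :
  (forall n s, g n (f n s) = h n s) ->
  frakC_map_to g p' q' _ (frakC_map_to f p q _ x) = frakC_map_to h p'' q'' _ x.
Proof.
move=> gf; have e : h = sMap_comp g f by apply: sMap_ext => n s; rewrite -gf.
subst h a' b' a'' b''.
rewrite (Prop_irrelevance p'' erefl) (Prop_irrelevance q'' erefl).
elim/quot_ind: x => w /=; rewrite !mor_mapE; congr qpi.
by elim: w => //= *; [apply: Gen_eq | congr Comp].
Qed.

Lemma frakC_map_to_eq S S' (f g : sMap S S') (a b : S 0) (a' b' : S' 0)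
    (p : f _ a = a') (q : f _ b = b') (p' : g _ a = a') (q' : g _ b = b')
    l (x : shom (s := frakC S) a b l) :
  (forall n s, f n s = g n s) -> frakC_map_to f p q _ x = frakC_map_to g p' q' _ x.
Proof.
move=> h; have e : f = g by apply: sMap_ext.
by subst g; rewrite (Prop_irrelevance p' p) (Prop_irrelevance q' q).
Qed.

Section FrakCColim.

Program Definition sFunctor_comp (C D E : sCat) (G : sFunctor D E) (F : sFunctor C D) :
    sFunctor C E :=
  @SFunctor C E (fun a => G (F a))
    (fun a b => sMap_comp (sfhom G (F a) (F b)) (sfhom F a b)) _ _.
Next Obligation. by move=> *; rewrite !sMap_compE !sfhom_id. Qed.
Next Obligation. by move=> *; rewrite !sMap_compE !sfhom_comp. Qed.

Lemma sFunctor_ext (C D : sCat) (F G : sFunctor C D) (e : forall a, F a = G a) :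
  (forall a b n (x : shom a b n), sfhom_to F (e a) (e b) n x = sfhom G a b n x) ->
  F = G.
Proof.
case: F G e => [F Fh F1 F2] [G Gh G1 G2] /= e.
have E := funext e; subst G => h.
have {}h : Fh = Gh.
  apply: functional_extensionality_dep => a; apply: functional_extensionality_dep => b.
  apply: sMap_ext => n x; rewrite -h.
  by rewrite (Prop_irrelevance (e a) erefl) (Prop_irrelevance (e b) erefl).
by subst Gh; rewrite (Prop_irrelevance F1 G1) (Prop_irrelevance F2 G2).
Qed.

Lemma sfhom_to_sid (C D : sCat) (F : sFunctor C D) (a : C) (a' : D) (p q : F a = a') n :
  sfhom_to F p q n (sid a n) = sid a' n.
Proof. by destruct p; rewrite (Prop_irrelevance q erefl); apply: sfhom_id. Qed.

Lemma sfhom_to_scomp (C D : sCat) (F : sFunctor C D) (a b c : C) (a' b' c' : D)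
    (p : F a = a') (q : F b = b') (r : F c = c') n (y : shom b c n) (x : shom a b n) :
  sfhom_to F p r n (scomp y x) = scomp (sfhom_to F q r n y) (sfhom_to F p q n x).
Proof. by destruct p, q, r; apply: sfhom_comp. Qed.

Lemma sfhom_to_eq (C D : sCat) (F G : sFunctor C D) (a b : C) (a' b' : D)
    (p : F a = a') (q : F b = b') (p' : G a = a') (q' : G b = b') n (x : shom a b n) :
  F = G -> sfhom_to F p q n x = sfhom_to G p' q' n x.
Proof.
by move=> e; subst G; rewrite (Prop_irrelevance p' p) (Prop_irrelevance q' q).
Qed.

Lemma sfhom_to_sFunctor_comp (C D E : sCat) (G : sFunctor D E) (F : sFunctor C D)
    (a b : C) (a' b' : E) (p : G (F a) = a') (q : G (F b) = b') n (x : shom a b n) :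
  sfhom_to (sFunctor_comp G F) p q n x = sfhom_to G p q n (sfhom F a b n x).
Proof. by destruct p, q. Qed.

Lemma sfhom_to_trans (C D E : sCat) (F : sFunctor C E) (H : sFunctor D E)
    (a b : C) (c d : D) (a' b' : E) (p : F a = a') (q : F b = b')
    (p0 : H c = F a) (q0 : H d = F b) n (x : shom a b n) (z : shom c d n) :
  sfhom F a b n x = sfhom_to H p0 q0 n z ->
  sfhom_to F p q n x = sfhom_to H (etrans p0 p) (etrans q0 q) n z.
Proof. by destruct p, q. Qed.

Variable S : sSet.

Program Definition frakC_in n (s : S n) : sFunctor (frakC_Delta n) (frakC S) :=
  @SFunctor (frakC_Delta n) (frakC S) (vertex s)
    (fun i j => @SMap (shom i j) (frakC_hom _ _)
       (fun l x => qpi _ (Gen x erefl erefl)) _) _ _.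
Next Obligation. by move=> *; rewrite /= mor_actE. Qed.
Next Obligation. by move=> *; apply/qpi_step/rel_sid. Qed.
Next Obligation.
by move=> n s i j k l y x; rewrite /= mor_compE; apply/qpi_step/rel_scomp.
Qed.

Lemma frakC_in_nat m n (f : mono m n) (s : S n) :
  frakC_in (act f s) = sFunctor_comp (frakC_in s) (frakC_Delta_map f).
Proof.
have e i : frakC_in (act f s) i = sFunctor_comp (frakC_in s) (frakC_Delta_map f) i.
  exact: vertex_act.
apply: (sFunctor_ext (e := e)) => i j l x.
have H b b' (p : vertex (act f s) i = b) (q : vertex (act f s) j = b') :
    sfhom_to (frakC_in (act f s)) p q l x = qpi (@word_rel S l b b') (Gen x p q).
  by destruct p, q.
by rewrite H; apply/qpi_step/rel_nat.
Qed.

Variables (D : sCat) (G : forall n, S n -> sFunctor (frakC_Delta n) D).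
Hypothesis G_nat : forall m n (f : mono m n) (s : S n),
  G (act f s) = sFunctor_comp (G s) (frakC_Delta_map f).

Definition colim_ob (a : S 0) : D := G a ord0.

Lemma colim_obE n (s : S n) (i : frakC_Delta n) a : vertex s i = a -> G s i = colim_ob a.
Proof. by move=> <-; rewrite /colim_ob /vertex G_nat. Qed.

Fixpoint colim_word l a b (w : word l a b) : shom (colim_ob a) (colim_ob b) l :=
  match w with
  | Gen _ s _ _ x _ _ p q => sfhom_to (G s) (colim_obE p) (colim_obE q) l x
  | Id a => sid (colim_ob a) l
  | Comp _ _ _ v u => scomp (colim_word v) (colim_word u)
  end.

Lemma colim_word_rel l a b (w w' : word l a b) :
  word_rel w w' -> colim_word w = colim_word w'.
Proof.
elim=> {a b w w'} /=.
- move=> m n f s i j x a b p q p' q'.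
  rewrite -(sfhom_to_sFunctor_comp (G := G s) (F := frakC_Delta_map f)).
  exact: (sfhom_to_eq (C := frakC_Delta m) _ _ _ _ _ (G_nat f s)).
- by move=> n s i a p q; apply: (sfhom_to_sid (C := frakC_Delta n)).
- by move=> n s i j k y x a b c p q r; apply: (sfhom_to_scomp (C := frakC_Delta n)).
- by move=> *; rewrite scompA.
- by move=> *; rewrite scomp1x.
- by move=> *; rewrite scompx1.
- by move=> a b c v v' u _ ->.
- by move=> a b c v u u' _ ->.
Qed.

Definition colim_mor l a b : mor l a b -> shom (colim_ob a) (colim_ob b) l :=
  qlift (@colim_word l a b).

Lemma colim_morE l a b (w : word l a b) : colim_mor (qpi _ w) = colim_word w.
Proof. by apply: qliftE => u v; apply: colim_word_rel. Qed.

Program Definition colim_desc : sFunctor (frakC S) D :=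
  @SFunctor (frakC S) D colim_ob
    (fun a b => @SMap (frakC_hom a b) (shom _ _) (fun l => @colim_mor l a b) _) _ _.
Next Obligation.
move=> a b m n f; elim/quot_ind => w /=; rewrite mor_actE !colim_morE.
elim: w => /= [k s i j x a' b' p q|a'|a' b' c' v -> u ->].
- by rewrite -sfun_act.
- by rewrite sid_act.
- by rewrite scomp_act.
Qed.
Next Obligation. by move=> a n; rewrite /= colim_morE. Qed.
Next Obligation.
move=> a b c n; elim/quot_ind => y; elim/quot_ind => x /=.
by rewrite mor_compE !colim_morE.
Qed.

Lemma colim_desc_in n (s : S n) : sFunctor_comp colim_desc (frakC_in s) = G s.
Proof.
have e i : sFunctor_comp colim_desc (frakC_in s) i = G s i.
  by rewrite /= -(colim_obE (erefl (vertex s i))).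
apply: (sFunctor_ext (e := e)) => i j l x.
have /(sfhom_to_trans (e i) (e j)) -> : sfhom (sFunctor_comp colim_desc (frakC_in s)) i j l x =
    sfhom_to (G s) (colim_obE erefl) (colim_obE erefl) l x by exact: colim_morE.
set p := etrans _ _; set q := etrans _ _.
by rewrite (Prop_irrelevance p erefl) (Prop_irrelevance q erefl).
Qed.

Theorem frakC_colim :
  exists! F : sFunctor (frakC S) D,
    forall n (s : S n), sFunctor_comp F (frakC_in s) = G s.
Proof.
exists colim_desc; split=> [|F FG]; first exact: colim_desc_in.
have e a : colim_desc a = F a.
  by rewrite /= /colim_ob -FG /=; congr (sfob F _); apply: degen0.
apply: (sFunctor_ext (e := e)) => a b l; elim/quot_ind => w.
elim: w => {a b} [n s i j x a b p q|a|a b c v IHv u IHu].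
- have FF : sFunctor_comp colim_desc (frakC_in s) = sFunctor_comp F (frakC_in s).
    by rewrite colim_desc_in FG.
  destruct p, q.
  have H := sfhom_to_eq (F := sFunctor_comp colim_desc (frakC_in s))
    (G := sFunctor_comp F (frakC_in s)) (a := i) (b := j)
    (e (vertex s i)) (e (vertex s j)) erefl erefl x FF.
  by rewrite sfhom_to_sFunctor_comp in H.
- by rewrite (sfhom_to_sid (F := colim_desc)) -(sfhom_id F).
- rewrite -mor_compE (sfhom_to_scomp (F := colim_desc) _ (e b)).
  by rewrite IHv IHu -(sfhom_comp F).
Qed.

End FrakCColim.

(** The list [T = [:: n_0; ...; n_k]] stands for the necklace
    [Delta^{n_0} \/ ... \/ Delta^{n_k}].  The empty list is [Delta^0], and makes the
    wedge, which is the concatenation of lists, strictly unital.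
    The vertices of [T] are numbered from [0] to [sumn T]: the first bead of [n :: T]
    has vertices [0, ..., n] and the remaining necklace [T] is shifted by [n].  A
    simplex of a necklace is a monotone sequence of vertices of one of its beads. *)
Fixpoint in_neck (T : seq nat) m (x : 'I_m.+1 -> nat) : bool :=
  match T with
  | [::] => [forall i, x i == 0]
  | n :: T' => [forall i, x i <= n] ||
               [forall i, n <= x i] && in_neck T' (fun i => x i - n)
  end.

Record neck_simp (T : seq nat) (m : nat) := NeckSimp {
  nval :> 'I_m.+1 -> nat;
  nval_homo : forall i j : 'I_m.+1, i <= j -> nval i <= nval j;
  nval_in : in_neck T nval
}.

Lemma neck_simp_ext T m (x y : neck_simp T m) : x =1 y -> x = y.
Proof.
case: x y => [x x1 x2] [y y1 y2] /= /funext e; subst y.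
by rewrite (Prop_irrelevance x1 y1) (Prop_irrelevance x2 y2).
Qed.

Lemma in_neck_act T m n (f : 'I_m.+1 -> 'I_n.+1) (x : 'I_n.+1 -> nat) :
  in_neck T x -> in_neck T (fun i => x (f i)).
Proof.
elim: T x => [|k T IH] x /=; first by move=> /forallP h; apply/forallP => i.
case/orP => [/forallP h|/andP[/forallP h1 h2]]; apply/orP.
  by left; apply/forallP.
by right; apply/andP; split; [apply/forallP | apply: (IH (fun i => x i - k))].
Qed.

Lemma eq_in_neck T m (x y : 'I_m.+1 -> nat) : x =1 y -> in_neck T x = in_neck T y.
Proof. by move=> /funext ->. Qed.
Arguments eq_in_neck {T m x y}.

Lemma in_neck0 T m (x : 'I_m.+1 -> nat) : (forall i, x i = 0) -> in_neck T x.
Proof.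
by case: T => [|n T] h /=; [|apply/orP; left]; apply/forallP => i; rewrite h.
Qed.

Lemma in_neck_le T m (x : 'I_m.+1 -> nat) i : in_neck T x -> x i <= sumn T.
Proof.
elim: T x => [|n T IH] x /=; first by move=> /forallP /(_ i) /eqP ->.
case/orP => [/forallP h|/andP[/forallP h1 /IH]]; last by rewrite leq_subLR.
exact: leq_trans (h i) (leq_addr _ _).
Qed.

Lemma in_neck_cat T U m (x : 'I_m.+1 -> nat) :
  in_neck (T ++ U) x =
  in_neck T x || [forall i, sumn T <= x i] && in_neck U (fun i => x i - sumn T).
Proof.
elim: T x => [|n T IH] x /=.
  rewrite (_ : [forall i, 0 <= x i]) /=; last by apply/forallP.
  rewrite (eq_in_neck (y := x)) => [|i]; last by rewrite subn0.
  case: forallP => // h; rewrite in_neck0 // => i; exact/eqP.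
rewrite IH -orbA andb_orr; congr (_ || (_ || _)).
rewrite andbA; congr andb; last by apply: eq_in_neck => i; rewrite subnDA.
apply/andP/forallP => [[/forallP h1 /forallP h2] i|h].
  by have := h2 i; rewrite leq_subRL.
split; apply/forallP => i; first exact: leq_trans (leq_addr _ _) (h i).
by rewrite leq_subRL // (leq_trans (leq_addr _ _) (h i)).
Qed.

Lemma in_neck_catl T U m (x : 'I_m.+1 -> nat) : in_neck T x -> in_neck (T ++ U) x.
Proof. by move=> h; rewrite in_neck_cat h. Qed.

Lemma in_neck_catr T U m (x : 'I_m.+1 -> nat) :
  in_neck U x -> in_neck (T ++ U) (fun i => sumn T + x i).
Proof.
move=> h; rewrite in_neck_cat; apply/orP; right; apply/andP; split.
  by apply/forallP => i; rewrite leq_addr.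
by rewrite (eq_in_neck (y := x)) // => i; rewrite addKn.
Qed.

Definition neck_act T m n (f : mono m n) (x : neck_simp T n) : neck_simp T m :=
  @NeckSimp T m (fun i => x (f i)) (fun i j h => nval_homo x (mono_homo f h))
    (in_neck_act f (nval_in x)).

Program Definition neck (T : seq nat) : sSet :=
  @SSet (neck_simp T) (fun _ _ f => neck_act f) _ _.
Next Obligation. by move=> *; apply: neck_simp_ext. Qed.
Next Obligation. by move=> *; apply: neck_simp_ext. Qed.

Program Definition Delta_to_neck n : sMap (Delta n) (neck [:: n]) :=
  @SMap (Delta n) (neck [:: n])
    (fun m x => @NeckSimp [:: n] m (fun i => x i) (@mono_homo _ _ x) _) _.
Next Obligation.
by move=> n m x /=; apply/orP; left; apply/forallP => i; rewrite -ltnS.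
Qed.
Next Obligation. by move=> *; apply: neck_simp_ext. Qed.

Lemma Delta_to_neck_bij n m : bijective (@Delta_to_neck n m).
Proof.
have lt (x : neck [:: n] m) i : x i < n.+1.
  by have := in_neck_le i (nval_in x); rewrite /= addn0 ltnS.
exists (fun x => @Mono m n (fun i => Ordinal (lt x i)) (@nval_homo _ _ x)) => x.
- by apply: mono_ext => i; apply: val_inj.
- exact: neck_simp_ext.
Qed.

Program Definition alpha (T : seq nat) : neck T 0 :=
  @NeckSimp T 0 (fun _ => 0) (fun _ _ _ => leqnn 0) _.
Next Obligation. by move=> T; apply: in_neck0. Qed.

Lemma in_neck_omega T m : in_neck T (fun _ : 'I_m.+1 => sumn T).
Proof.
elim: T => [|n T IH] /=; first by apply/forallP.
apply/orP; right; apply/andP; split; first by apply/forallP => _; apply: leq_addr.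
by rewrite (eq_in_neck (y := fun=> sumn T)) // => i; rewrite addKn.
Qed.

Definition omega (T : seq nat) : neck T 0 :=
  @NeckSimp T 0 (fun _ => sumn T) (fun _ _ _ => leqnn _) (in_neck_omega T 0).

(** [neck (T ++ U)] is the pushout of [neck T] and [neck U] along [omega T] and
    [alpha U] ([wedgel_omega], [glue_wedgel], [glue_wedger] and [glue_uniq]). *)
Program Definition wedgel T U : sMap (neck T) (neck (T ++ U)) :=
  @SMap (neck T) (neck (T ++ U))
    (fun m x => @NeckSimp (T ++ U) m x (@nval_homo _ _ x)
                  (in_neck_catl U (nval_in x))) _.
Next Obligation. by move=> *; apply: neck_simp_ext. Qed.

Lemma wedger_homo T U m (x : neck_simp U m) (i j : 'I_m.+1) :
  i <= j -> sumn T + x i <= sumn T + x j.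
Proof. by rewrite leq_add2l; apply: nval_homo. Qed.

Program Definition wedger T U : sMap (neck U) (neck (T ++ U)) :=
  @SMap (neck U) (neck (T ++ U))
    (fun m x => @NeckSimp (T ++ U) m (fun i => sumn T + x i) (wedger_homo T x)
                  (in_neck_catr T (nval_in x))) _.
Next Obligation. by move=> *; apply: neck_simp_ext. Qed.

Lemma wedgel_alpha T U : wedgel T U _ (alpha T) = alpha (T ++ U).
Proof. exact: neck_simp_ext. Qed.

Lemma wedgel_omega T U : wedgel T U _ (omega T) = wedger T U _ (alpha U).
Proof. by apply: neck_simp_ext => i /=; rewrite addn0. Qed.

Lemma wedger_omega T U : wedger T U _ (omega U) = omega (T ++ U).
Proof. by apply: neck_simp_ext => i /=; rewrite sumn_cat. Qed.

Lemma in_neck_shift T U m (x : neck_simp (T ++ U) m) :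
  ~ in_neck T x ->
  (forall i, sumn T <= x i) /\ in_neck U (fun i => x i - sumn T).
Proof.
by have := nval_in x; rewrite in_neck_cat => /orP[//|/andP[/forallP]].
Qed.

Lemma shift_homo m (x : 'I_m.+1 -> nat) (s : nat)
  (xP : forall i j : 'I_m.+1, i <= j -> x i <= x j) (i j : 'I_m.+1) :
  i <= j -> x i - s <= x j - s.
Proof. by move=> h; apply: leq_sub2r; apply: xP. Qed.

Lemma wedgeP T U m (z : neck (T ++ U) m) :
  (exists x : neck T m, z = wedgel T U _ x) \/
  (exists y : neck U m, z = wedger T U _ y).
Proof.
case: (decP (@idP (in_neck T (nval z)))) => e.
  by left; exists (NeckSimp (@nval_homo _ _ z) e); apply: neck_simp_ext.
case: (in_neck_shift e) => h1 h2; right.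
exists (NeckSimp (shift_homo (sumn T) (@nval_homo _ _ z)) h2).
by apply: neck_simp_ext => i /=; rewrite subnKC.
Qed.

Section Glue.
Variables (T U : seq nat) (S : sSet) (f : sMap (neck T) S) (g : sMap (neck U) S).
Hypothesis fg : f _ (omega T) = g _ (alpha U).

Definition glue_fun m (z : neck_simp (T ++ U) m) : S m :=
  match decP (@idP (in_neck T z)) with
  | left e => f m (NeckSimp (@nval_homo _ _ z) e)
  | right e => g m (NeckSimp (shift_homo (sumn T) (@nval_homo _ _ z))
                         (in_neck_shift e).2)
  end.

Lemma glue_funl m (x : neck T m) : glue_fun (wedgel T U _ x) = f _ x.
Proof.
rewrite /glue_fun; case: decP => [e|[]]; last exact: nval_in.
by congr sfun; apply: neck_simp_ext.
Qed.

Lemma glue_funr m (y : neck U m) : glue_fun (wedger T U _ y) = g _ y.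
Proof.
rewrite /glue_fun; case: decP => e; last first.
  by congr sfun; apply: neck_simp_ext => i /=; rewrite addKn.
have y0 i : y i = 0.
  by have := in_neck_le i e; rewrite /= -[X in _ <= X]addn0 leq_add2l leqn0 => /eqP.
have -> : g m y = g m (degen m (alpha U)).
  by congr sfun; apply: neck_simp_ext => i; rewrite y0.
rewrite sfun_degen -fg -sfun_degen; congr sfun; apply: neck_simp_ext => i /=.
by rewrite y0 addn0.
Qed.

Program Definition glue : sMap (neck (T ++ U)) S :=
  @SMap (neck (T ++ U)) S glue_fun _.
Next Obligation.
move=> m n h z; case: (wedgeP z) => [[x ->]|[y ->]].
  by rewrite -sfun_act !glue_funl sfun_act.
by rewrite -sfun_act !glue_funr sfun_act.
Qed.

Lemma glue_wedgel m (x : neck T m) : glue m (wedgel T U m x) = f m x.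
Proof. exact: glue_funl. Qed.

Lemma glue_wedger m (y : neck U m) : glue m (wedger T U m y) = g m y.
Proof. exact: glue_funr. Qed.

Lemma glue_uniq (h : sMap (neck (T ++ U)) S) :
  (forall m x, h m (wedgel T U _ x) = f _ x) ->
  (forall m y, h m (wedger T U _ y) = g _ y) -> h = glue.
Proof.
move=> hf hg; apply: sMap_ext => m z /=; case: (wedgeP z) => [[x ->]|[y ->]].
  by rewrite hf glue_funl.
by rewrite hg glue_funr.
Qed.

End Glue.

Record nec_hom (T U : seq nat) := NecHom {
  nec_map :> sMap (neck T) (neck U);
  nec_alpha : nec_map _ (alpha T) = alpha U;
  nec_omega : nec_map _ (omega T) = omega U
}.

Lemma nec_hom_ext T U (f g : nec_hom T U) :
  (forall m x, f m x = g m x) -> f = g.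
Proof.
case: f g => [f f1 f2] [g g1 g2] /= e; have {}e : f = g by apply: sMap_ext.
subst g.
by rewrite (Prop_irrelevance f1 g1) (Prop_irrelevance f2 g2).
Qed.

Definition nec_id T : nec_hom T T := @NecHom T T (sMap_id (neck T)) erefl erefl.

Program Definition nec_comp T U V (g : nec_hom U V) (f : nec_hom T U) : nec_hom T V :=
  @NecHom T V (sMap_comp g f) _ _.
Next Obligation. by move=> T U V g f /=; rewrite !nec_alpha. Qed.
Next Obligation. by move=> T U V g f /=; rewrite !nec_omega. Qed.

Program Definition Nec : category :=
  @Category (seq nat) nec_hom nec_id nec_comp _ _ _.
Next Obligation. by move=> *; apply: nec_hom_ext. Qed.
Next Obligation. by move=> *; apply: nec_hom_ext. Qed.
Next Obligation. by move=> *; apply: nec_hom_ext. Qed.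

Section NecOver.
Variable S : sSet.

Record nec_over (a b : S 0) := NecOver {
  over_nec : Nec;
  over_map : sMap (neck over_nec) S;
  over_alpha : over_map _ (alpha over_nec) = a;
  over_omega : over_map _ (omega over_nec) = b
}.

Record nec_over_hom a b (A B : nec_over a b) := NecOverHom {
  over_hom :> nec_hom (over_nec A) (over_nec B);
  over_homP : forall m (x : neck (over_nec A) m),
    over_map B m (over_hom m x) = over_map A m x
}.

Lemma nec_over_ext a b (A B : nec_over a b) :
  over_nec A = over_nec B ->
  (forall m (x : neck (over_nec A) m) (y : neck (over_nec B) m),
     nval x =1 nval y -> over_map A _ x = over_map B _ y) ->
  A = B.
Proof.
case: A B => [T f f1 f2] [T' g g1 g2] /= e; subst T' => e.
have {}e : f = g by apply: sMap_ext => n x; apply: e.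
by subst g; rewrite (Prop_irrelevance f1 g1) (Prop_irrelevance f2 g2).
Qed.

Lemma nec_over_hom_ext a b (A B : nec_over a b) (f g : nec_over_hom A B) :
  (forall m x, nec_map f m x = nec_map g m x) -> f = g.
Proof.
case: f g => [f f1] [g g1] /= e; have {}e : f = g by apply: nec_hom_ext.
subst g.
by rewrite (Prop_irrelevance f1 g1).
Qed.

Program Definition nec_over_id a b (A : nec_over a b) : nec_over_hom A A :=
  @NecOverHom a b A A (nec_id (over_nec A)) _.
Next Obligation. by []. Qed.

Program Definition nec_over_comp a b (A B C : nec_over a b)
    (g : nec_over_hom B C) (f : nec_over_hom A B) : nec_over_hom A C :=
  @NecOverHom a b A C (nec_comp g f) _.
Next Obligation. by move=> * /=; rewrite !over_homP. Qed.

Program Definition NecOver_cat (a b : S 0) : category :=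
  @Category (nec_over a b) (@nec_over_hom a b) (@nec_over_id a b)
    (@nec_over_comp a b) _ _ _.
Next Obligation. by move=> *; apply: nec_over_hom_ext. Qed.
Next Obligation. by move=> *; apply: nec_over_hom_ext. Qed.
Next Obligation. by move=> *; apply: nec_over_hom_ext. Qed.

Lemma nec_functor_ext (I : category) a b (F G : functor I (NecOver_cat a b)) :
  (forall i, F i = G i) ->
  (forall i j (h : hom i j) m (x : neck (over_nec (F i)) m)
     (y : neck (over_nec (G i)) m), nval x =1 nval y ->
     nval (nec_map (fhom F h) m x) =1 nval (nec_map (fhom G h) m y)) ->
  F = G.
Proof.
case: F G => [F Fh F1 F2] [G Gh G1 G2] /= /funext e; subst G => e.
have {}e : Fh = Gh.
  apply: functional_extensionality_dep => i; apply: functional_extensionality_dep => j.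
  apply: funext => h; apply: nec_over_hom_ext => m x.
  by apply: neck_simp_ext; apply: e.
by subst Gh; rewrite (Prop_irrelevance F1 G1) (Prop_irrelevance F2 G2).
Qed.

Lemma over_glue a b c (A : nec_over a b) (B : nec_over b c) :
  over_map A _ (omega _) = over_map B _ (alpha _).
Proof. by rewrite over_omega over_alpha. Qed.

Program Definition wedge_over a b c (A : nec_over a b) (B : nec_over b c) :
    nec_over a c :=
  @NecOver a c (over_nec A ++ over_nec B) (glue (over_glue A B)) _ _.
Next Obligation.
by move=> a b c A B; rewrite -wedgel_alpha glue_wedgel over_alpha.
Qed.
Next Obligation.
by move=> a b c A B; rewrite -wedger_omega glue_wedger over_omega.
Qed.

End NecOver.

Section WedgeHom.
Variables (T T' U U' : seq nat) (f : nec_hom T T') (g : nec_hom U U').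

Lemma wedge_hom_glue :
  sMap_comp (wedgel T' U') f _ (omega T) = sMap_comp (wedger T' U') g _ (alpha U).
Proof. by rewrite !sMap_compE nec_omega nec_alpha wedgel_omega. Qed.

Program Definition wedge_hom : nec_hom (T ++ U) (T' ++ U') :=
  @NecHom (T ++ U) (T' ++ U') (glue wedge_hom_glue) _ _.
Next Obligation. by rewrite -wedgel_alpha glue_wedgel sMap_compE nec_alpha wedgel_alpha. Qed.
Next Obligation.
by rewrite -wedger_omega glue_wedger sMap_compE nec_omega wedger_omega.
Qed.

Lemma wedge_homl m x : wedge_hom m (wedgel T U m x) = wedgel T' U' m (f m x).
Proof. exact: glue_wedgel. Qed.

Lemma wedge_homr m x : wedge_hom m (wedger T U m x) = wedger T' U' m (g m x).
Proof. exact: glue_wedger. Qed.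

End WedgeHom.

Section WedgeFunctor.
Variables (S : sSet).

Lemma over_mapl (a b c : S 0) (A : nec_over a b) (B : nec_over b c) m x :
  over_map (wedge_over A B) m (wedgel _ _ m x) = over_map A m x.
Proof. exact: glue_wedgel. Qed.

Lemma over_mapr (a b c : S 0) (A : nec_over a b) (B : nec_over b c) m x :
  over_map (wedge_over A B) m (wedger _ _ m x) = over_map B m x.
Proof. exact: glue_wedger. Qed.

Program Definition wedge_over_hom (a b c : S 0) (A A' : nec_over a b)
    (B B' : nec_over b c) (f : nec_over_hom A A') (g : nec_over_hom B B') :
    nec_over_hom (wedge_over A B) (wedge_over A' B') :=
  @NecOverHom S a c _ _ (wedge_hom f g) _.
Next Obligation.
move=> a b c A A' B B' f g m z; case: (wedgeP z) => [[x ->]|[y ->]].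
  by rewrite wedge_homl !over_mapl over_homP.
by rewrite wedge_homr !over_mapr over_homP.
Qed.

Lemma nec_over_idE (a b : S 0) (A : NecOver_cat a b) m x :
  nec_map (over_hom (idc A)) m x = x.
Proof. by []. Qed.

Lemma nec_over_compE (a b : S 0) (A B C : NecOver_cat a b) (g : hom B C)
    (f : hom A B) m x :
  nec_map (over_hom (compc g f)) m x = nec_map (over_hom g) m (nec_map (over_hom f) m x).
Proof. by []. Qed.

Lemma wedge_over_homl (a b c : S 0) (A A' : nec_over a b)
    (B B' : nec_over b c) (f : nec_over_hom A A') (g : nec_over_hom B B') m x :
  wedge_over_hom f g m (wedgel _ _ m x) = wedgel _ _ m (nec_map f m x).
Proof. exact: wedge_homl. Qed.

Lemma wedge_over_homr (a b c : S 0) (A A' : nec_over a b)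
    (B B' : nec_over b c) (f : nec_over_hom A A') (g : nec_over_hom B B') m x :
  wedge_over_hom f g m (wedger _ _ m x) = wedger _ _ m (nec_map g m x).
Proof. exact: wedge_homr. Qed.

Program Definition wedge_functor (I : category) (a b c : S 0)
    (F : functor I (NecOver_cat a b)) (G : functor I (NecOver_cat b c)) :
    functor I (NecOver_cat a c) :=
  @Functor I (NecOver_cat a c) (fun i => wedge_over (F i) (G i))
    (fun i j h => wedge_over_hom (fhom F h) (fhom G h)) _ _.
Next Obligation.
move=> I a b c F G i; apply: nec_over_hom_ext => m z.
rewrite !fhom_id nec_over_idE; case: (wedgeP z) => [[x ->]|[y ->]].
  by rewrite wedge_over_homl.
by rewrite wedge_over_homr.
Qed.
Next Obligation.
move=> I a b c F G i j k h h'; apply: nec_over_hom_ext => m z.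
rewrite !fhom_comp nec_over_compE; case: (wedgeP z) => [[x ->]|[y ->]].
  by rewrite !wedge_over_homl nec_over_compE.
by rewrite !wedge_over_homr nec_over_compE.
Qed.

Lemma wedge_functorE (I : category) (a b c : S 0)
    (F : functor I (NecOver_cat a b)) (G : functor I (NecOver_cat b c)) i j (h : hom i j) :
  fhom (wedge_functor F G) h = wedge_over_hom (fhom F h) (fhom G h).
Proof. by []. Qed.

Program Definition unit_over (a : S 0) : nec_over a a :=
  @NecOver S a a [::] (@SMap (neck [::]) S (fun m _ => degen m a) _) _ _.
Next Obligation. by move=> a m n f x; rewrite act_degen. Qed.
Next Obligation. by move=> a /=; rewrite degen0. Qed.
Next Obligation. by move=> a /=; rewrite degen0. Qed.

Program Definition unit_functor (I : category) (a : S 0) :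
    functor I (NecOver_cat a a) :=
  @Functor I (NecOver_cat a a) (fun _ => unit_over a)
    (fun _ _ _ => @idc (NecOver_cat a a) (unit_over a)) _ _.
Next Obligation. by []. Qed.
Next Obligation. by move=> *; rewrite comp1c. Qed.

Lemma wedge_overA (a b c d : S 0) (A : nec_over a b) (B : nec_over b c)
    (C : nec_over c d) :
  wedge_over (wedge_over A B) C = wedge_over A (wedge_over B C).
Proof.
apply: nec_over_ext => [|m x y xy]; first by rewrite /= catA.
case: (wedgeP x) => [[x1 e]|[x2 e]]; subst x.
  rewrite over_mapl; case: (wedgeP x1) => [[x3 e]|[x4 e]]; subst x1.
    rewrite over_mapl (_ : y = wedgel _ _ m x3) ?over_mapl //.
    by apply: neck_simp_ext => i; rewrite -xy.
  rewrite over_mapr (_ : y = wedger _ _ m (wedgel _ _ m x4)) ?over_mapr ?over_mapl //.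
  by apply: neck_simp_ext => i; rewrite -xy.
rewrite over_mapr (_ : y = wedger _ _ m (wedger _ _ m x2)) ?over_mapr //.
by apply: neck_simp_ext => i; rewrite -xy /= sumn_cat addnA.
Qed.

Lemma wedge_overx1 (a b : S 0) (A : nec_over a b) : wedge_over A (unit_over b) = A.
Proof.
apply: nec_over_ext => [|m x y xy]; first by rewrite /= cats0.
have -> : x = wedgel _ _ m y by apply: neck_simp_ext.
by rewrite over_mapl.
Qed.

Lemma wedge_over1x (a b : S 0) (A : nec_over a b) : wedge_over (unit_over a) A = A.
Proof.
apply: nec_over_ext => [|m x y xy]; first by [].
have -> : x = wedger _ _ m y by apply: neck_simp_ext.
by rewrite over_mapr.
Qed.

Section Laws.
Variable I : category.

Lemma wedge_functorA (a b c d : S 0) (F : functor I (NecOver_cat a b))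
    (G : functor I (NecOver_cat b c)) (H : functor I (NecOver_cat c d)) :
  wedge_functor (wedge_functor F G) H = wedge_functor F (wedge_functor G H).
Proof.
apply: nec_functor_ext => [i|i j h m x y xy]; first exact: wedge_overA.
rewrite !wedge_functorE; case: (wedgeP x) => [[x1 e]|[x2 e]]; subst x.
  rewrite wedge_over_homl; case: (wedgeP x1) => [[x3 e]|[x4 e]]; subst x1.
    rewrite (_ : y = wedgel _ _ m x3) => [k|].
      by rewrite !wedge_over_homl.
    by apply: neck_simp_ext => k; rewrite -xy.
  rewrite (_ : y = wedger _ _ m (wedgel _ _ m x4)) => [k|].
    by rewrite wedge_over_homr [in RHS]wedge_over_homr wedge_over_homl.
  by apply: neck_simp_ext => k; rewrite -xy.
rewrite (_ : y = wedger _ _ m (wedger _ _ m x2)) => [k|].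
  by rewrite !wedge_over_homr /= sumn_cat addnA.
by apply: neck_simp_ext => k; rewrite -xy /= sumn_cat addnA.
Qed.

Lemma wedge_functorx1 (a b : S 0) (F : functor I (NecOver_cat a b)) :
  wedge_functor F (unit_functor I b) = F.
Proof.
apply: nec_functor_ext => [i|i j h m x y xy]; first exact: wedge_overx1.
have -> : x = wedgel _ _ m y by apply: neck_simp_ext.
by rewrite wedge_functorE wedge_over_homl.
Qed.

Lemma wedge_functor1x (a b : S 0) (F : functor I (NecOver_cat a b)) :
  wedge_functor (unit_functor I a) F = F.
Proof.
apply: nec_functor_ext => [i|i j h m x y xy]; first exact: wedge_over1x.
have -> : x = wedger _ _ m y by apply: neck_simp_ext.
by rewrite wedge_functorE wedge_over_homr.
Qed.

End Laws.

Lemma wedge_functor_mono (a b c : S 0) m n (f : mono m n)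
    (F : functor (ordc n) (NecOver_cat a b)) (G : functor (ordc n) (NecOver_cat b c)) :
  functor_mono (wedge_functor F G) f =
  wedge_functor (functor_mono F f) (functor_mono G f).
Proof.
apply: nec_functor_ext => // i j h k x y xy.
by have -> : x = y by apply: neck_simp_ext.
Qed.

Lemma unit_functor_mono (a : S 0) m n (f : mono m n) :
  functor_mono (unit_functor (ordc n) a) f = unit_functor (ordc m) a.
Proof. exact: nec_functor_ext. Qed.

Program Definition frakC_nec : sCat :=
  @SCat (S 0) (fun a b => nerve (NecOver_cat a b))
    (fun a n => unit_functor (ordc n) a)
    (fun a b c n G F => wedge_functor F G) _ _ _ _ _.
Next Obligation. by move=> *; apply: unit_functor_mono. Qed.
Next Obligation. by move=> *; apply: wedge_functor_mono. Qed.
Next Obligation. by move=> *; apply: wedge_functorA. Qed.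
Next Obligation. by move=> *; apply: wedge_functorx1. Qed.
Next Obligation. by move=> *; apply: wedge_functor1x. Qed.

End WedgeFunctor.

Program Definition nec_diagram (S : sSet) (a b : S 0) : diagram (NecOver_cat a b) :=
  @Diagram (NecOver_cat a b)
    (fun A => shom (s := frakC (neck (over_nec A))) (alpha _) (omega _))
    (fun A B h => frakC_map_to h (nec_alpha h) (nec_omega h)) _ _.
Next Obligation. by move=> *; apply: frakC_map_to_idmap. Qed.
Next Obligation.
by move=> *; symmetry; apply: frakC_map_to_compmap.
Qed.

Section FrakCHoc.
Variable S : sSet.

Definition frakC_hoc_hom (a b : S 0) : sSet := hocolim (nec_diagram a b).

Lemma hoc_ext (a b : S 0) n (F G : functor (ordc n) (NecOver_cat a b))
    (x : nec_diagram a b (F ord0) n) (y : nec_diagram a b (G ord0) n) :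
  F = G ->
  (forall (r : sMap (neck (over_nec (F ord0))) (neck (over_nec (G ord0)))) p q,
     (forall m z, nval (r m z) =1 nval z) -> frakC_map_to r p q n x = y) ->
  existT _ F x = existT _ G y :> frakC_hoc_hom a b n.
Proof.
move=> e; subst G => /(_ (sMap_id _) erefl erefl (fun _ _ _ => erefl)) <-.
by rewrite frakC_map_to_idmap.
Qed.

(** [frakC(U)(alpha, omega) * frakC(T)(alpha, omega) -> frakC(T \/ U)(alpha, omega)] *)
Definition wedge_scomp (T U : seq nat) n
    (y : shom (s := frakC (neck U)) (alpha U) (omega U) n)
    (x : shom (s := frakC (neck T)) (alpha T) (omega T) n) :
    shom (s := frakC (neck (T ++ U))) (alpha (T ++ U)) (omega (T ++ U)) n :=
  scomp (frakC_map_to (wedger T U) (esym (wedgel_omega T U)) (wedger_omega T U) _ y)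
        (frakC_map_to (wedgel T U) (wedgel_alpha T U) erefl _ x).

Lemma wedge_scomp_act T U m n (f : mono m n) y x :
  act f (@wedge_scomp T U n y x) = wedge_scomp (act f y) (act f x).
Proof. by rewrite /wedge_scomp scomp_act -!sfun_act. Qed.

Lemma wedge_scomp_nat T T' U U' (f : nec_hom T T') (g : nec_hom U U') n y x :
  frakC_map_to (wedge_hom f g) (nec_alpha _) (nec_omega _) n (wedge_scomp y x) =
  wedge_scomp (frakC_map_to g (nec_alpha _) (nec_omega _) n y)
    (frakC_map_to f (nec_alpha _) (nec_omega _) n x).
Proof.
have q : wedge_hom f g _ (wedgel T U _ (omega T)) = wedgel T' U' _ (omega T').
  by rewrite wedge_homl nec_omega.
rewrite /wedge_scomp (frakC_map_to_comp _ q); congr scomp.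
- set h := sMap_comp (wedge_hom f g) (wedger T U).
  have p1 : h _ (alpha U) = wedgel T' U' _ (omega T').
    by rewrite sMap_compE wedge_homr nec_alpha wedgel_omega.
  have q1 : h _ (omega U) = omega (T' ++ U').
    by rewrite sMap_compE wedge_homr nec_omega wedger_omega.
  rewrite (frakC_map_to_compmap _ _ _ _ p1 q1) //.
  rewrite (frakC_map_to_compmap _ _ _ _ p1 q1) // => k s.
  by rewrite sMap_compE wedge_homr.
- set h := sMap_comp (wedge_hom f g) (wedgel T U).
  have p1 : h _ (alpha T) = alpha (T' ++ U').
    by rewrite sMap_compE wedge_homl nec_alpha wedgel_alpha.
  have q1 : h _ (omega T) = wedgel T' U' _ (omega T') by [].
  rewrite (frakC_map_to_compmap _ _ _ _ p1 q1) //.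
  rewrite (frakC_map_to_compmap _ _ _ _ p1 q1) // => k s.
  by rewrite sMap_compE wedge_homl.
Qed.

Definition hoc_comp (a b c : S 0) n (v : frakC_hoc_hom b c n)
    (u : frakC_hoc_hom a b n) : frakC_hoc_hom a c n :=
  existT (fun F : functor (ordc n) (NecOver_cat a c) => nec_diagram a c (F ord0) n)
    (wedge_functor (projT1 u) (projT1 v))
    (wedge_scomp (projT2 v) (projT2 u)).

(** The identity of [a], as a morphism from [a] to an equal object. *)
Definition sid_to (C : sCat) (a b : C) (e : a = b) n : shom a b n :=
  match e in _ = b return shom a b n with erefl => sid a n end.

Lemma sid_to_act (C : sCat) (a b : C) (e : a = b) m n (f : mono m n) :
  act f (sid_to e n) = sid_to e m.
Proof. by case: _ / e; exact: sid_act. Qed.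

Lemma scomp_sid_tol (C : sCat) (a b : C) (e : b = b) n (x : shom a b n) :
  scomp (sid_to e n) x = x.
Proof. by rewrite (Prop_irrelevance e erefl) scomp1x. Qed.

Lemma scomp_sid_tor (C : sCat) (a b : C) (e : a = a) n (x : shom a b n) :
  scomp x (sid_to e n) = x.
Proof. by rewrite (Prop_irrelevance e erefl) scompx1. Qed.

Lemma frakC_map_to_sid_to (X Y : sSet) (f : sMap X Y) (a b : frakC X)
    (a' b' : frakC Y) (e : a = b) (e' : a' = b') (p : f _ a = a') (q : f _ b = b') n :
  frakC_map_to f p q n (sid_to e n) = sid_to e' n.
Proof. by destruct e, e'; exact: frakC_map_to_id. Qed.

Lemma frakC_map_to_cancel (X Y : sSet) (f : sMap X Y) (g : sMap Y X) (a b : X 0)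
    (a' b' : Y 0) (p : f _ a = a') (q : f _ b = b') (p' : g _ a' = a) (q' : g _ b' = b)
    n (x : shom (s := frakC X) a b n) :
  (forall m s, g m (f m s) = s) ->
  frakC_map_to g p' q' n (frakC_map_to f p q n x) = x.
Proof.
move=> gf; have e c : sMap_comp g f 0 c = c by apply: gf.
by rewrite (frakC_map_to_compmap _ _ _ _ (e a) (e b)) // frakC_map_to_idmap.
Qed.

Lemma alpha_omega0 : alpha [::] = omega [::] :> frakC (neck [::]).
Proof. exact: neck_simp_ext. Qed.

Lemma wedge_scompx1 T n x (r : sMap (neck (T ++ [::])) (neck T)) p q :
  (forall m z, nval (r m z) =1 nval z) ->
  frakC_map_to r p q n (wedge_scomp (sid_to alpha_omega0 n) x) = x.
Proof.
move=> h; have e : r _ (wedgel T [::] _ (omega T)) = omega T.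
  by apply: neck_simp_ext => i; rewrite h.
rewrite /wedge_scomp (frakC_map_to_comp p e q).
rewrite (frakC_map_to_cancel (f := wedgel T [::])); last first.
  by move=> m s; apply: neck_simp_ext => i; rewrite h.
have e1 : wedgel T [::] _ (omega T) = omega (T ++ [::])
  :> frakC (neck (T ++ [::])) by rewrite wedgel_omega -wedger_omega -alpha_omega0.
rewrite (frakC_map_to_sid_to _ e1).
by rewrite (frakC_map_to_sid_to (a := wedgel T [::] _ (omega T)) _ erefl) scomp1x.
Qed.

Lemma wedge_scomp1x T n x (r : sMap (neck ([::] ++ T)) (neck T)) p q :
  (forall m z, nval (r m z) =1 nval z) ->
  frakC_map_to r p q n (wedge_scomp x (sid_to alpha_omega0 n)) = x.
Proof.
move=> h; have e : r _ (wedger [::] T _ (alpha T)) = alpha T.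
  by apply: neck_simp_ext => i; rewrite h.
have e0 : r _ (wedgel [::] T _ (omega [::])) = alpha T by rewrite wedgel_omega.
rewrite /wedge_scomp (frakC_map_to_comp p e0 q).
rewrite (frakC_map_to_cancel (f := wedger [::] T)); last first.
  by move=> m s; apply: neck_simp_ext => i; rewrite h.
have e1 : alpha ([::] ++ T) = wedgel [::] T _ (omega [::]) :> frakC (neck ([::] ++ T)).
  by rewrite -wedgel_alpha alpha_omega0.
rewrite (frakC_map_to_sid_to _ e1).
by rewrite (frakC_map_to_sid_to (b := wedgel [::] T _ (omega [::])) _ erefl) scompx1.
Qed.

Lemma wedge_scompA T U V n z y x
    (r : sMap (neck ((T ++ U) ++ V)) (neck (T ++ (U ++ V)))) p q :
  (forall m s, nval (r m s) =1 nval s) ->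
  frakC_map_to r p q n (wedge_scomp z (wedge_scomp y x)) =
  wedge_scomp (wedge_scomp z y) x.
Proof.
move=> h; rewrite /wedge_scomp.
pose b := wedgel T (U ++ V) _ (omega T).
pose c := wedger T (U ++ V) _ (wedgel U V _ (omega U)).
have ec : r _ (wedgel (T ++ U) V _ (omega (T ++ U))) = c.
  by apply: neck_simp_ext => i; rewrite h /= sumn_cat.
have eb : r _ (wedgel (T ++ U) V _ (wedgel T U _ (omega T))) = b.
  by apply: neck_simp_ext => i; rewrite h.
rewrite (frakC_map_to_comp p ec q).
rewrite (frakC_map_to_comp (f := wedgel (T ++ U) V) _
           (erefl (wedgel (T ++ U) V _ (wedgel T U _ (omega T))))).
rewrite (frakC_map_to_comp _ eb) (frakC_map_to_comp (f := wedger T (U ++ V)) _ (erefl c)).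
rewrite scompA; congr (scomp (scomp _ _) _).
- set g := sMap_comp r (wedger (T ++ U) V).
  have gE k s : nval (g k s) =1 nval (wedger T (U ++ V) k (wedger U V k s)).
    by move=> i; rewrite h /= sumn_cat addnA.
  have p1 : g _ (alpha V) = c.
    by rewrite /c wedgel_omega; apply: neck_simp_ext; apply: gE.
  have q1 : g _ (omega V) = omega (T ++ (U ++ V)).
    by rewrite -wedger_omega -wedger_omega; apply: neck_simp_ext; apply: gE.
  rewrite (frakC_map_to_compmap _ _ _ _ p1 q1) //.
  rewrite (frakC_map_to_compmap _ _ _ _ p1 q1) // => k s.
  by apply: neck_simp_ext => i; rewrite gE.
- set g1 := sMap_comp (wedgel (T ++ U) V) (wedger T U).
  set g := sMap_comp r g1.
  have gE k s : nval (g k s) =1 nval (wedger T (U ++ V) k (wedgel U V k s)).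
    by move=> i; rewrite h.
  have p1 : g _ (alpha U) = b.
    by rewrite /b wedgel_omega -wedgel_alpha; apply: neck_simp_ext; apply: gE.
  have q1 : g _ (omega U) = c by apply: neck_simp_ext; apply: gE.
  have p2 : g1 _ (alpha U) = wedgel (T ++ U) V _ (wedgel T U _ (omega T)).
    by rewrite wedgel_omega.
  have q2 : g1 _ (omega U) = wedgel (T ++ U) V _ (omega (T ++ U)).
    by rewrite sMap_compE wedger_omega.
  rewrite (frakC_map_to_compmap _ _ _ _ p2 q2) //.
  rewrite (frakC_map_to_compmap _ _ _ _ p1 q1) //.
  rewrite (frakC_map_to_compmap _ _ _ _ p1 q1) // => k s.
  by apply: neck_simp_ext => i; rewrite gE.
- set g1 := sMap_comp (wedgel (T ++ U) V) (wedgel T U).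
  set g := sMap_comp r g1.
  have gE k s : nval (g k s) =1 nval (wedgel T (U ++ V) k s).
    by move=> i; rewrite h.
  have p1 : g _ (alpha T) = alpha (T ++ (U ++ V)).
    by rewrite -wedgel_alpha; apply: neck_simp_ext; apply: gE.
  have q1 : g _ (omega T) = b by apply: neck_simp_ext; apply: gE.
  have p2 : g1 _ (alpha T) = alpha ((T ++ U) ++ V).
    by rewrite sMap_compE !wedgel_alpha.
  rewrite (frakC_map_to_compmap _ _ _ _ p2 erefl) //.
  rewrite (frakC_map_to_compmap _ _ _ _ p1 q1) //.
  by apply: frakC_map_to_eq => k s; apply: neck_simp_ext; apply: gE.
Qed.

Definition hoc_id (a : S 0) n : frakC_hoc_hom a a n :=
  existT (fun F : functor (ordc n) (NecOver_cat a a) => nec_diagram a a (F ord0) n)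
    (unit_functor (ordc n) a) (sid_to alpha_omega0 n).

Program Definition frakC_hoc : sCat :=
  @SCat (S 0) frakC_hoc_hom hoc_id hoc_comp _ _ _ _ _.
Next Obligation.
move=> a m n f; apply: hoc_ext => [|r p q h]; first exact: unit_functor_mono.
rewrite sid_to_act.
apply: (etrans (congr1 (frakC_map_to r p q m) (_ : _ = sid_to alpha_omega0 m))).
  exact: frakC_map_to_sid_to.
exact: frakC_map_to_sid_to.
Qed.
Next Obligation.
move=> a b c m n f [G y] [F x]; apply: hoc_ext => [|r p q h].
  exact: wedge_functor_mono.
rewrite frakC_map_to_idmap => [|k s]; last by apply: neck_simp_ext; apply: h.
rewrite wedge_scomp_act; exact: wedge_scomp_nat.
Qed.
Next Obligation.
move=> a b c d n [H z] [G y] [F x]; apply: hoc_ext => [|r p q h].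
  exact: wedge_functorA.
exact: wedge_scompA.
Qed.
Next Obligation.
move=> a b n [F x]; apply: hoc_ext => [|r p q h]; first exact: wedge_functorx1.
exact: wedge_scompx1.
Qed.
Next Obligation.
move=> a b n [F x]; apply: hoc_ext => [|r p q h]; first exact: wedge_functor1x.
exact: wedge_scomp1x.
Qed.

End FrakCHoc.

Section CanonicalMaps.
Variable S : sSet.

Program Definition hoc_to_nec : sFunctor (frakC_hoc S) (frakC_nec S) :=
  @SFunctor (frakC_hoc S) (frakC_nec S) (fun a => a)
    (fun a b => hocolim_to_nerve (nec_diagram a b)) _ _.
Next Obligation. by []. Qed.
Next Obligation. by []. Qed.

Lemma over_map_cocone (a b : S 0) (A B : NecOver_cat a b) (f : hom A B) n
    (x : nec_diagram a b A n) :
  frakC_map_to (over_map B) (over_alpha B) (over_omega B) n (dmap (nec_diagram a b) f n x) =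
  frakC_map_to (over_map A) (over_alpha A) (over_omega A) n x.
Proof. by apply: frakC_map_to_compmap => m s; apply: over_homP. Qed.

Lemma over_map_wedge_scomp (a b c : S 0) (A : nec_over a b) (B : nec_over b c) n y x :
  frakC_map_to (over_map (wedge_over A B)) (over_alpha _) (over_omega _) n
    (wedge_scomp y x) =
  scomp (frakC_map_to (over_map B) (over_alpha B) (over_omega B) n y)
        (frakC_map_to (over_map A) (over_alpha A) (over_omega A) n x).
Proof.
have q : over_map (wedge_over A B) _ (wedgel _ _ _ (omega (over_nec A))) = b.
  by rewrite over_mapl over_omega.
rewrite /wedge_scomp (frakC_map_to_comp _ q).
congr scomp; apply: frakC_map_to_compmap => m s; [exact: over_mapr|exact: over_mapl].
Qed.

Program Definition hoc_to_frakC : sFunctor (frakC_hoc S) (frakC S) :=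
  @SFunctor (frakC_hoc S) (frakC S) (fun a => a)
    (fun a b => @hocolim_desc _ (nec_diagram a b) (shom (s := frakC S) a b)
       (fun A => frakC_map_to (over_map A) (over_alpha A) (over_omega A))
       (@over_map_cocone a b)) _ _.
Next Obligation.
move=> a n; exact: (frakC_map_to_sid_to _ (erefl : a = a :> frakC S)).
Qed.
Next Obligation. by move=> a b c n [G y] [F x]; apply: over_map_wedge_scomp. Qed.

End CanonicalMaps.

(* Main.v *)
From mathcomp Require Import all_boot.
From mathcomp Require Import boolp zify.
Require Import Defs.

(** Both maps leave the diagonal of a bisimplicial set, and each of them is a
    contraction of that bisimplicial set in one of its two directions.  The criterion is
    [kan_equivalence_diag]: if every level [X l] of a simplicial space contracts onto the
    discrete set [Y l], by projections [X l -> Y l] that commute with the maps of [l],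
    then [diag X -> Y] is a Kan equivalence.

    Criterion.  A Kan equivalence is defined by maps into Kan complexes [K], so the proof
    stays inside extension properties for a fixed [K].  An inclusion is [anodyne] for [K]
    when maps to [K] extend along all its pushout products.  Such inclusions compose, are
    stable under pushout, and can be cancelled on the right ([anodyne_cancel]); the last
    fact rests on the homotopy extension property [ext_cylinder], which is obtained from
    horn fillers through the prisms [ext_prism].  Each [X l] is anodyne in the mapping
    cylinder of its projection ([anodyne_mcyl]); cancellation propagates this to the
    latching inclusions ([anodyne_latching]) and an assembly along skeleta ([ext_diag]) to
    the diagonals ([anodyne_diag]).  The diagonal of the cylinders retracts onto [Y].

    The map to the nerve.  Fix the chain [F] of necklaces and let the simplices of the
    coefficients vary.  A simplex of [frakC(T)(alpha, omega)] is the same as an increasing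
    sequence of sets of vertices of [T] that contain all the joints ([vs_inj],
    [vs_exists]).  So this simplicial set is the nerve of a poset with a greatest element,
    and contracts to it; [kan_equivalence_hocolim] applies.

    The map to [frakC S].  Fix the dimension [l] of the coefficients and let the chain of
    necklaces vary.  The level [l] is the nerve of the category of pairs of a necklace
    [T -> S] and an [l]-simplex [x] of [frakC(T)(alpha, omega)], and it has to be
    contracted onto the set of the [l]-simplices [y] of [frakC S].  The Eilenberg-Zilber
    lemma gives a normal form: [y] is in exactly one way a composite of nondegenerate
    simplices of [S] of positive dimension, each with a flag of vertex sets growing from
    the two end points to all the vertices ([nf_word_rel], [composes_nf]).  The beads of
    the normal form assemble to a necklace [T_y -> S] with an element over [y]
    ([nf_eval]).  Call a pair flanked when the beads of [T] have positive dimension,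
    the lowest vertex set of [x] is the set of joints of [T], and the highest one contains
    all the vertices.  A flanked pair over [y] has exactly one map to the pair of [y]
    ([lift_exists], [lift_uniq]).  The same statement for simplices of [frakC T] shows that
    the normal form of [x] coreflects the pair [(T, x)] into the flanked ones.  A
    coreflection followed by terminal objects contracts the nerve ([nerve_contraction]). *)

Set Implicit Arguments.
Unset Strict Implicit.
Unset Printing Implicit Defensive.

#[local] Obligation Tactic := idtac.

(** * Monotone maps *)

Lemma mcompE k m n (g : mono m n) (f : mono k m) i : mcomp g f i = g (f i).
Proof. by []. Qed.

Definition mono_nat m n (F : nat -> nat) (F_le : forall i, i <= m -> F i <= n)
    (F_homo : forall i j, i <= j -> F i <= F j) : mono m n :=
  @Mono m n (fun i => Ordinal (F_le i (leq_ord i) : F i < n.+1))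
    (fun i j h => F_homo i j h).

Program Definition sdeg n (i : 'I_n.+1) : mono n.+1 n :=
  @mono_nat n.+1 n (fun k => k - (i < k)) _ _.
Next Obligation. by move=> n i k; have := ltn_ord i; lia. Qed.
Next Obligation. by move=> n i k l; lia. Qed.

Program Definition dface n (i : nat) : mono n n.+1 :=
  @mono_nat n n.+1 (bump i) _ _.
Next Obligation. by move=> n i k; rewrite /bump; lia. Qed.
Next Obligation. by move=> n i k l; rewrite /bump; lia. Qed.

(** The idempotent with image the face opposite to [i.+1]: a simplex is a degeneracy
    along [sdeg i] exactly when [eidem n.+1 i] fixes it ([degenerateP]). *)
Program Definition eidem n (i : nat) : mono n n :=
  @mono_nat n n (fun k => k - (k == i.+1)) _ _.
Next Obligation. by move=> n i k; lia. Qed.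
Next Obligation. by move=> n i k l; lia. Qed.

Lemma mono_eqP m n (f g : mono m n) : (forall i, f i = g i :> nat) -> f = g.
Proof. by move=> h; apply: mono_ext => i; apply: val_inj (h i). Qed.

Lemma eidemE n i (k : 'I_n.+1) : eidem n i k = k - (nat_of_ord k == i.+1) :> nat.
Proof. by []. Qed.

Lemma sdeg_dface n (i : 'I_n.+1) : mcomp (sdeg i) (dface n i.+1) = mid n.
Proof. by apply: mono_eqP => k /=; rewrite /bump; lia. Qed.

Lemma dface_sdeg n (i : 'I_n.+1) : mcomp (dface n i.+1) (sdeg i) = eidem n.+1 i.
Proof. by apply: mono_eqP => k /=; rewrite /bump; lia. Qed.

Lemma eidem_sdeg_eidem n (j : 'I_n.+1) i : i < j ->
  mcomp (eidem n i) (mcomp (sdeg j) (eidem n.+1 i)) = mcomp (eidem n i) (sdeg j).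
Proof. by move=> h; apply: mono_eqP => k /=; lia. Qed.

Lemma sdeg_eidem_dface n (j : 'I_n.+1) i : i < j ->
  mcomp (sdeg j) (mcomp (eidem n.+1 i) (dface n j.+1)) = eidem n i.
Proof. by move=> h; apply: mono_eqP => k /=; rewrite /bump; lia. Qed.

Definition surj m n (f : mono m n) : Prop := forall j, exists i, f i = j.

(** The section can be chosen through any given point; this is what makes a surjection
    the only map with its set of sections, as used in [ez_map_uniq] and
    [latch_box_inj]. *)
Lemma mono_section m n (f : mono m n) (a : 'I_m.+1) : surj f ->
  exists2 g : mono n m, mcomp f g = mid n & g (f a) = a.
Proof.
move=> sf; pose g j := if j == f a then a else sval (cid (sf j)).
have fg j : f (g j) = j.
  by rewrite /g; case: eqP => [->//|_]; exact: svalP (cid (sf j)).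
have g_homo (i j : 'I_n.+1) : i <= j -> g i <= g j.
  move=> ij; rewrite leqNgt; apply/negP => h.
  have := mono_homo f (ltnW h); rewrite !fg => ji.
  have e : i = j by apply/val_inj/eqP; rewrite eqn_leq ij ji.
  by move: h; rewrite e ltnn.
exists (Mono g_homo); first by apply: mono_ext => j; apply: fg.
by rewrite /= /g eqxx.
Qed.

Lemma surj_comp_l k m n (g : mono m n) (f : mono k m) : surj (mcomp g f) -> surj g.
Proof. by move=> sgf j; have [i <-] := sgf j; exists (f i). Qed.

Lemma surj_le m n (f : mono m n) i : surj f -> f i <= i.
Proof.
move=> sf; case: i => i; elim: i => [|i IH] hi.
  have [j hj] := sf ord0; have := mono_homo f (leq0n j : Ordinal hi <= j).
  by rewrite hj.
have hi' : i < m.+1 by lia.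
rewrite leqNgt; apply/negP => h; have h0 := IH hi'.
have [j hj] := sf (Ordinal (ltn_trans h (ltn_ord _) : i.+1 < n.+1)).
have [h1|h1] := leqP j i.
  have := mono_homo f (h1 : j <= Ordinal hi'); rewrite hj /= => h2; move: (leq_trans h2 h0).
  by rewrite ltnn.
by have := mono_homo f (h1 : Ordinal hi <= j); rewrite hj /= leqNgt h.
Qed.

Lemma surj_endo n (f : mono n n) : surj f -> f = mid n.
Proof.
move=> sf; apply: mono_eqP => i /=; apply/eqP; rewrite eqn_leq surj_le //=.
have [g fg _] := mono_section ord0 sf.
have gK : cancel g f by move=> j; rewrite -[RHS](_ : mcomp f g j = j) // fg.
have /(bij_can_sym (injF_bij (can_inj gK))) fK := gK.
have sg : surj g by move=> j; exists (f j).
by have := surj_le (f i) sg; rewrite fK.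
Qed.

Lemma not_surj_factor m n (f : mono m n) : ~ surj f ->
  exists (n' : nat) (d : mono n' n) (f' : mono m n'), n' < n /\ f = mcomp d f'.
Proof.
move=> /existsNP [j /forallNP hj].
case: n f j hj => [|n] f j hj; first by case: (hj ord0); rewrite !ord1.
have ne i : (f i != j :> nat) by apply/eqP => /val_inj; apply: hj.
have lt i : unbump j (f i) <= n.
  by rewrite /unbump; have := ltn_ord (f i); have := ltn_ord j; have := ne i; lia.
have homo (i i' : 'I_m.+1) : i <= i' -> unbump j (f i) <= unbump j (f i').
  by move=> /(mono_homo f); have := ne i; have := ne i'; rewrite /unbump; lia.
exists n, (dface n j), (@Mono m n (fun i => Ordinal (lt i : _ < n.+1)) homo); split=> //.
apply: mono_eqP => i /=; rewrite unbumpK //; exact: ne.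
Qed.

(** Two consecutive vertices must have the same image. *)
Lemma low_dim_eidem m n (f : mono m n) : n < m ->
  exists2 i, i < m & mcomp f (eidem m i) = f.
Proof.
move=> lt.
have [/forallP h|] := boolP [forall i : 'I_m, f (lift ord0 i) != f (widen_ord (leqnSn m) i)].
  suff: m <= n by rewrite leqNgt lt.
  have {}h i (hi : i < m.+1) : i <= f (Ordinal hi).
    elim: i hi => // i IH hi; have hi' : i < m by [].
    have hi2 : i < m.+1 by lia.
    have := h (Ordinal hi'); have := IH hi2.
    rewrite (_ : lift ord0 (Ordinal hi') = Ordinal hi); last by apply: val_inj.
    rewrite (_ : widen_ord _ (Ordinal hi') = Ordinal hi2); last by apply: val_inj.
    have le : Ordinal hi2 <= Ordinal hi by rewrite /= leqnSn.
    by have := mono_homo f le; rewrite -val_eqE /=; lia.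
  by have := h m (ltnSn m); have := ltn_ord (f (Ordinal (ltnSn m))); lia.
rewrite negb_forall => /existsP [i]; rewrite negbK => /eqP hi.
exists i => //; apply: mono_ext => k; rewrite mcompE.
have [e|ne] := eqVneq (k : nat) i.+1; last first.
  have e : eidem m i k = k :> nat by rewrite eidemE (negPf ne) subn0.
  by rewrite (val_inj e).
have e1 : eidem m i k = widen_ord (leqnSn m) i :> nat by rewrite eidemE e eqxx subn1.
have e2 : k = lift ord0 i :> nat by rewrite e.
by rewrite (val_inj e1) (val_inj e2) hi.
Qed.

(** * Subcomplexes and partial maps *)

Record sub (B : sSet) := Sub {
  insub_ :> forall n, B n -> Prop;
  sub_act : forall m n (f : mono m n) (b : B n), insub_ b -> insub_ (act f b)
}.

Program Definition subU B (P Q : sub B) : sub B := @Sub B (fun n b => P n b \/ Q n b) _.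
Next Obligation. by move=> B P Q m n f b [h|h]; [left|right]; apply: sub_act. Qed.

Program Definition subI B (P Q : sub B) : sub B := @Sub B (fun n b => P n b /\ Q n b) _.
Next Obligation. by move=> B P Q m n f b [h h']; split; apply: sub_act. Qed.

Program Definition subT B : sub B := @Sub B (fun n b => True) _.
Next Obligation. by []. Qed.

Program Definition sub_pre A B (f : sMap A B) (P : sub B) : sub A :=
  @Sub A (fun n a => P n (f n a)) _.
Next Obligation. by move=> A B f P m n g a h /=; rewrite sfun_act; apply: sub_act. Qed.

Program Definition sfst A B : sMap (sProd A B) A := @SMap (sProd A B) A (fun n x => x.1) _.
Next Obligation. by []. Qed.

Program Definition ssnd A B : sMap (sProd A B) B := @SMap (sProd A B) B (fun n x => x.2) _.
Next Obligation. by []. Qed.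

Definition box B Z (P Q : sub B) (Z' : sub Z) : sub (sProd B Z) :=
  subU (sub_pre (sfst B Z) P) (subI (sub_pre (sfst B Z) Q) (sub_pre (ssnd B Z) Z')).

Section Ext.
Variable K : sSet.

(** Partial maps are total functions with arbitrary values outside of the subcomplex on
    which they are natural: extending a map then never changes its type. *)
Definition nat_on B (P : sub B) (u : forall n, B n -> K n) : Prop :=
  forall m n (f : mono m n) (b : B n), P n b -> u m (act f b) = act f (u n b).

Definition ext B (P Q : sub B) : Prop :=
  forall u, nat_on P u -> exists2 w, nat_on Q w & forall n b, P n b -> w n b = u n b.

(** The pushout product with an arbitrary inclusion is part of the definition, so that
    homotopies can be extended relatively to a subcomplex. *)
Definition anodyne B (P Q : sub B) : Prop :=
  forall Z (Z' : sub Z), ext (box P Q Z') (sub_pre (sfst B Z) Q).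

Lemma nat_on_sub B (P Q : sub B) u :
  (forall n b, P n b -> Q n b) -> nat_on Q u -> nat_on P u.
Proof. by move=> h hu m n f b /h; apply: hu. Qed.

Lemma nat_on_glue B (P Q : sub B) u v : nat_on P u -> nat_on Q v ->
  (forall n b, P n b -> Q n b -> u n b = v n b) ->
  exists w, [/\ nat_on (subU P Q) w, forall n b, P n b -> w n b = u n b &
                forall n b, Q n b -> w n b = v n b].
Proof.
move=> hu hv uv; pose w n b := if pselect (P n b) then u n b else v n b.
have wu n b : P n b -> w n b = u n b by rewrite /w; case: pselect.
have wv n b : Q n b -> w n b = v n b by rewrite /w; case: pselect => // *; apply: uv.
exists w; split=> // m n f b [h|h].
- by rewrite !wu ?hu //; apply: sub_act.
- by rewrite !wv ?hv //; apply: sub_act.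
Qed.

Lemma nat_on_comp A B (f : sMap A B) (P : sub A) (Q : sub B) u :
  (forall n a, P n a -> Q n (f n a)) -> nat_on Q u -> nat_on P (fun n a => u n (f n a)).
Proof. by move=> h hu m n g a Pa; rewrite sfun_act hu //; apply: h. Qed.

Lemma ext_trans B (P Q R : sub B) : (forall n b, P n b -> Q n b) ->
  ext P Q -> ext Q R -> ext P R.
Proof.
move=> PQ h1 h2 u /h1 [v /h2 [w hw wv] vu]; exists w => // n b Pb.
by rewrite wv ?vu //; apply: PQ.
Qed.

Lemma ext_eq B (P P' Q Q' : sub B) :
  (forall n b, P n b <-> P' n b) -> (forall n b, Q n b <-> Q' n b) ->
  ext P Q -> ext P' Q'.
Proof.
move=> hP hQ h u hu.
have [w hw wu] : exists2 w, nat_on Q w & forall n b, P n b -> w n b = u n b.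
  by apply: h; apply: nat_on_sub hu => n b /hP.
exists w => [|n b /hP]; last exact: wu.
by apply: nat_on_sub hw => n b /hQ.
Qed.

End Ext.

(** * Extension along horns and prisms *)

Program Definition sub_gen (B : sSet) n (b : B n) : sub B :=
  @Sub B (fun m c => exists f : mono m n, c = act f b) _.
Next Obligation.
by move=> B n b k m f _ [g ->]; exists (mcomp g f); rewrite act_comp.
Qed.

(** Attaching one simplex [b], injective and meeting [P] in a horn. *)
Lemma ext_horn K (B : sSet) (P : sub B) n (k : 'I_n.+2) (b : B n.+1) : kan_complex K ->
  (forall m (f : mono m n.+1), P m (act f b) <-> in_horn k f) ->
  (forall m (f g : mono m n.+1), act f b = act g b -> f = g) ->
  ext K P (subU P (sub_gen b)).
Proof.
move=> hK Pb b_inj u hu.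
have h_act p m (f : mono p m) (x : horn k m) :
    u p (act (sval (act f x)) b) = act f (u m (act (sval x) b)).
  by rewrite act_comp hu // Pb; apply: svalP.
have [s sE] := hK n k (@SMap (horn k) K (fun m x => u m (act (sval x) b)) h_act).
pose v m c := if pselect (exists f : mono m n.+1, c = act f b) is left e
  then s m (sval (cid e)) else u m c.
have vE m (f : mono m n.+1) : v m (act f b) = s m f.
  rewrite /v; case: pselect => [e|[]]; last by exists f.
  by congr (s m _); apply: b_inj; rewrite -(svalP (cid e)).
have [||w [hw wu _]] := nat_on_glue (P := P) (Q := sub_gen b) (v := v) hu.
- by move=> p m f _ [g ->]; rewrite -act_comp !vE sfun_act.
- by move=> m c Pc [f e]; rewrite e in Pc *; rewrite vE; symmetry; exact: (sE _ (exist _ f (proj1 (Pb _ f) Pc))).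
by exists w.
Qed.

Lemma mono_val m n (f g : mono m n) (a : 'I_m.+1) : f = g -> f a = g a :> nat.
Proof. by move=> ->. Qed.

Section Prism.
Variable n : nat.

Program Definition bdry : sub (Delta n) := @Sub (Delta n) (fun m f => ~ surj f) _.
Next Obligation. by move=> k m f x h /surj_comp_l. Qed.

Program Definition sub_end (e : 'I_2) : sub (Delta 1) :=
  @Sub (Delta 1) (fun m f => f = mconst m e) _.
Next Obligation. by move=> e k m f _ ->; apply: mono_ext. Qed.

Program Definition prism_chi (i : 'I_n.+1) : mono n.+1 1 :=
  @mono_nat n.+1 1 (fun k => i < k) _ _.
Next Obligation. by move=> i k _; lia. Qed.
Next Obligation. by move=> i k l; lia. Qed.

Definition prism_simp (i : 'I_n.+1) : sProd (Delta n) (Delta 1) n.+1 :=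
  (sdeg i, prism_chi i).

Lemma prism_val (i j : 'I_n.+1) m (f g : mono m n.+1) a :
  act f (prism_simp i) = act g (prism_simp j) ->
  f a - (i < f a) = g a - (j < g a) /\ (i < f a) = (j < g a) :> nat.
Proof.
move=> e; have e1 : mcomp (sdeg i) f = mcomp (sdeg j) g := congr1 fst e.
have e2 : mcomp (prism_chi i) f = mcomp (prism_chi j) g := congr1 snd e.
by split; [have := mono_val a e1 | have := mono_val a e2].
Qed.

Lemma prism_inj (i : 'I_n.+1) m (f g : mono m n.+1) :
  act f (prism_simp i) = act g (prism_simp i) -> f = g.
Proof.
by move=> e; apply: mono_eqP => a; have := prism_val a e; lia.
Qed.

(** Any [i] works that separates the values of [f] where [p] is 0 from those where it is 1. *)
Lemma prism_cover m (x : sProd (Delta n) (Delta 1) m) :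
  exists i, sub_gen (prism_simp i) m x.
Proof.
case: x => f p.
have [i h0 h1] : exists2 i : 'I_n.+1, forall a, p a = 0 :> nat -> f a <= i
    & forall a, p a <> 0 :> nat -> i <= f a.
  have [/existsP [a0 ha0]|] := boolP [exists a, p a != 0 :> nat]; last first.
    rewrite negb_exists => /forallP h; exists ord_max => a; first by rewrite leq_ord.
    by have := h a; rewrite negbK => /eqP.
  case: (@arg_minnP _ a0 (fun a => p a != 0 :> nat) (@nat_of_ord _) ha0) => b hb bmin; exists (f b) => a ha.
    apply: mono_homo; rewrite leqNgt; apply/negP => /ltnW /(mono_homo p).
    by rewrite ha; move: hb; case: (nat_of_ord (p b)).
  by apply: mono_homo; apply: bmin; apply/eqP.
have lt a : f a + p a < n.+2 by have := ltn_ord (f a); have := ltn_ord (p a); lia.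
have homo (a b : 'I_m.+1) : a <= b -> f a + p a <= f b + p b.
  by move=> ab; have := mono_homo f ab; have := mono_homo p ab; lia.
exists i, (@Mono m n.+1 (fun a => Ordinal (lt a)) homo).
congr pair; apply: mono_eqP => a /=.
  have := h0 a; have := h1 a; have := ltn_ord (p a); move: (nat_of_ord (p a)) => [|[|]] //=; lia.
by have := h0 a; have := h1 a; have := ltn_ord (p a); move: (nat_of_ord (p a)) => [|[|]] //=; lia.
Qed.

Lemma prism_miss (i : 'I_n.+1) m (f : mono m n.+1) (j : 'I_n.+2) :
  j <> i :> nat -> j <> i.+1 :> nat -> (forall a, f a <> j) ->
  ~ surj (mcomp (sdeg i) f).
Proof.
move=> ji ji1 fj.
have lt : j - (i < j) < n.+1 by have := ltn_ord j; have := ltn_ord i; lia.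
move=> /(_ (Ordinal lt)) [a /(congr1 val) /= e]; apply: (fj a); apply: val_inj => /=.
by move: e; lia.
Qed.

Lemma not_surj_prism (i : 'I_n.+1) m (f : mono m n.+1) (k : 'I_n.+2) :
  (k = i :> nat \/ k = i.+1 :> nat) -> ~ surj (mcomp (sdeg i) f) -> in_horn k f.
Proof.
move=> hk /existsNP [v /forallNP hv].
have lt : (if v < i then v : nat else if v == i then (i + i.+1) - k else v.+1) < n.+2.
  by have := ltn_ord v; case: ifP => _; [lia|]; case: eqP => _; have := ltn_ord i; lia.
exists (Ordinal lt) => [/(congr1 val) /=|a fa].
  by case: ifP => h; [lia|]; case: eqP; [lia|] => /eqP; rewrite -val_eqE /=; lia.
apply: (hv a); apply: val_inj; rewrite /= fa /=.
by case: ifP => h; [lia|]; case: eqP => [->|/eqP]; rewrite -?val_eqE /=; lia.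
Qed.

Lemma prism_miss_chi (i j : 'I_n.+1) m (f : mono m n.+1) :
  j = i.+1 :> nat -> (forall a, f a <> i.+1 :> nat) ->
  act f (prism_simp i) = act f (prism_simp j).
Proof. by move=> ji fi; congr pair; apply: mono_eqP => a /=; have := fi a; lia. Qed.

Definition prism_base (e : 'I_2) : sub (sProd (Delta n) (Delta 1)) :=
  box bdry (subT _) (sub_end e).

Program Definition prism_filt (e : 'I_2) (S : nat -> Prop) : sub (sProd (Delta n) (Delta 1)) :=
  @Sub _ (fun m x => prism_base e m x \/ exists2 i : 'I_n.+1, S i & sub_gen (prism_simp i) m x) _.
Next Obligation.
move=> e S k m f x [h|[i Si h]]; [left|right; exists i => //]; exact: sub_act.
Qed.

Variables (K : sSet) (hK : kan_complex K).

Lemma prism_step (e : 'I_2) (S : nat -> Prop) (i : 'I_n.+1) (k : 'I_n.+2) :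
  (forall m (f : mono m n.+1), prism_filt e S m (act f (prism_simp i)) <-> in_horn k f) ->
  ext K (prism_filt e S) (prism_filt e (fun j => S j \/ j = i)).
Proof.
move=> h; have := ext_horn hK h (@prism_inj i).
apply: ext_eq => // m x; split=> [[[hb|[j Sj hj]]|hi]|[hb|[j [Sj|ji] hj]]].
- by left.
- by right; exists j => //; left.
- by right; exists i => //; right.
- by left; left.
- by left; right; exists j.
- by right; rewrite -(val_inj ji).
Qed.

(** The shuffles are attached in decreasing order when the bottom is given, the [i]-th one
    along its horn at the vertex [i]; in increasing order, and along the horn at [i.+1],
    when the top is given ([prism_horn1]). *)
Lemma prism_horn0 (i : 'I_n.+1) m (f : mono m n.+1) :
  prism_filt ord0 (fun j => i < j) m (act f (prism_simp i)) <->
  in_horn (widen_ord (leqnSn _) i) f.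
Proof.
split=> [[[h|[_ h]]|[j ij [g e]]]|[j /eqP ji fj]].
- by apply: not_surj_prism h; left.
- exists (lift ord0 i) => [/(congr1 val) /=|a fa]; first by rewrite /bump; lia.
  by have := mono_val a h; rewrite /= fa /= /bump; lia.
- exists (lift ord0 i) => [/(congr1 val) /=|a fa]; first by rewrite /bump; lia.
  by have := prism_val a e; rewrite fa /= /bump; lia.
- have [e|ne] := eqVneq (j : nat) i.+1; last first.
    left; left; apply: (prism_miss _ _ fj); last by apply/eqP.
    by apply/eqP; apply: contra ji => /eqP h; apply/eqP/val_inj.
  have {}fj a : f a <> i.+1 :> nat by rewrite -e => /val_inj; apply: fj.
  have [hi|hi] := ltnP i.+1 n.+1.
    by right; exists (Ordinal hi) => //; exists f; apply: prism_miss_chi.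
  left; right; split=> //; apply: mono_eqP => a /=.
  by have := fj a; have := ltn_ord (f a); lia.
Qed.

Lemma prism_horn1 (i : 'I_n.+1) m (f : mono m n.+1) :
  prism_filt ord_max (fun j => j < i) m (act f (prism_simp i)) <->
  in_horn (lift ord0 i) f.
Proof.
split=> [[[h|[_ h]]|[j ij [g e]]]|[j /eqP ji fj]].
- by apply: not_surj_prism h; right.
- exists (widen_ord (leqnSn _) i) => [/(congr1 val) /=|a fa]; first by rewrite /bump; lia.
  by have := mono_val a h; rewrite /= fa /=; lia.
- exists (widen_ord (leqnSn _) i) => [/(congr1 val) /=|a fa]; first by rewrite /bump; lia.
  by have := prism_val a e; rewrite fa /=; lia.
- have [e|ne] := eqVneq (j : nat) i; last first.
    left; left; apply: (prism_miss _ _ fj); first by apply/eqP.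
    by apply/eqP; apply: contra ji => /eqP h; apply/eqP/val_inj; exact: h.
  have {}fj a : f a <> i :> nat by rewrite -e => /val_inj; apply: fj.
  have [hi|hi] := posnP i.
    left; right; split=> //; apply: mono_eqP => a /=.
    by have := fj a; rewrite hi; lia.
  have lt : i.-1 < n.+1 by have := ltn_ord i; lia.
  right; exists (Ordinal lt); first by rewrite /=; lia.
  exists f; symmetry; apply: prism_miss_chi => [|a] /=; rewrite prednK //.
Qed.

Lemma ext_refl (B : sSet) (P : sub B) : ext K P P.
Proof. by move=> u hu; exists u. Qed.

(** The homotopy extension property of the boundary of a simplex. *)
Lemma ext_prism (e : 'I_2) : ext K (prism_base e) (subT _).
Proof.
have [-> | ->] : e = ord0 \/ e = ord_max.
  by case: e => [[|[|]]] // h; [left|right]; apply: val_inj.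
- suff h d : d <= n.+1 -> ext K (prism_base ord0) (prism_filt ord0 (fun j => n < j + d)).
    apply: ext_eq (h n.+1 (leqnn _)) => // m x; split=> // _; right.
    by have [i hi] := prism_cover x; exists i => //; lia.
  elim: d => [_|d IH hd].
    apply: ext_eq (ext_refl (P := prism_base ord0)) => // m x.
    by split=> [|[//|[j hj]]]; [left|have := ltn_ord j; lia].
  apply: (ext_trans _ (IH (ltnW hd))) => [m b hb|]; first by left.
  have lt : n - d < n.+1 by lia.
  apply: ext_eq (prism_step (@prism_horn0 (Ordinal lt))) => m x.
    by split=> [] [hb|[j hj hx]]; try (by left); right; exists j => //; move: hj => /=; lia.
  split=> [] [hb|[j hj hx]]; try (by left); right; exists j => //; move: hj => /=.
    by case=> [|->] /=; lia.
  move=> h; have [->|ne] := eqVneq (j : nat) (n - d); [by right|left].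
  by have := ltn_ord j; lia.
- suff h d : d <= n.+1 -> ext K (prism_base ord_max) (prism_filt ord_max (fun j => j < d)).
    apply: ext_eq (h n.+1 (leqnn _)) => // m x; split=> // _; right.
    by have [i hi] := prism_cover x; exists i.
  elim: d => [_|d IH hd].
    apply: ext_eq (ext_refl (P := prism_base ord_max)) => // m x.
    by split=> [|[//|[j hj]]]; [left|].
  apply: (ext_trans _ (IH (ltnW hd))) => [m b hb|]; first by left.
  apply: ext_eq (prism_step (@prism_horn1 (Ordinal hd))) => m x //.
  split=> [] [hb|[j hj hx]]; try (by left); right; exists j => //; move: hj => /=.
    by case=> [|->] /=; lia.
  by rewrite ltnS leq_eqVlt => /orP[/eqP|]; [right|left].
Qed.

End Prism.

(** * Simplicial spaces and their diagonals *)

(** Bisimplicial sets with their two directions kept apart: [lev l] is a simplicial set,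
    and [bact] acts on [l]. *)
Record sspace := SSpace {
  lev :> nat -> sSet;
  bact : forall m n, mono m n -> sMap (lev n) (lev m);
  bact_id : forall n k (x : lev n k), bact (mid n) k x = x;
  bact_comp : forall p m n (f : mono p m) (g : mono m n) k (x : lev n k),
    bact (mcomp g f) k x = bact f k (bact g k x)
}.
Arguments bact X {m n} f : rename.

Program Definition diag (X : sspace) : sSet :=
  @SSet (fun n => X n n) (fun m n f x => bact X f m (act f x)) _ _.
Next Obligation. by move=> X n x /=; rewrite act_id bact_id. Qed.
Next Obligation. by move=> X k m n f g x /=; rewrite act_comp bact_comp !sfun_act. Qed.

Record ssub (X : sspace) := SSub {
  ssub_lev :> forall l, sub (X l);
  ssub_act : forall m n (f : mono m n) k (x : X n k),
    ssub_lev n k x -> ssub_lev m k (bact X f k x)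
}.

Program Definition diag_sub X (N : ssub X) : sub (diag X) :=
  @Sub (diag X) (fun n x => N n n x) _.
Next Obligation. by move=> X N m n f x h; apply/ssub_act/sub_act. Qed.

Program Definition degenerate (X : sspace) l : sub (X l) :=
  @Sub (X l) (fun k x => exists l' (f : mono l l') (y : X l' k),
                l' < l /\ x = bact X f k y) _.
Next Obligation.
by move=> X l m n f _ [l' [g [y [lt ->]]]]; exists l', g, (act f y); rewrite sfun_act.
Qed.

Lemma diag_act_bact (X : sspace) l m n (g : mono m n) (f : mono n l) (x : X l n) :
  act (s := diag X) g (bact X f n x) = bact X (mcomp f g) m (act g x).
Proof. by rewrite /= bact_comp -!sfun_act. Qed.

Section Assembly.
Variables (K : sSet) (X : sspace) (N : ssub X).

(** The part of [X l * Delta l] which is glued to [N] and to lower skeleta when the diagonal is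
    written as the coend of the [X l * Delta l]. *)
Definition latch_box l : sub (sProd (X l) (Delta l)) :=
  box (subU (N l) (@degenerate X l)) (subT _) (@bdry l).

Program Definition skel d : sub (diag X) :=
  @Sub (diag X) (fun n b => N n n b \/
    exists l (f : mono n l) (x : X l n), l < d /\ b = bact X f n x) _.
Next Obligation.
move=> d m n g b [h|[l [f [x [lt ->]]]]]; [left; exact: (sub_act (s := diag_sub N))|right].
by exists l, (mcomp f g), (act g x); rewrite diag_act_bact.
Qed.

Program Definition skel_new d : sub (diag X) :=
  @Sub (diag X) (fun n b => exists (f : mono n d) (x : X d n), b = bact X f n x) _.
Next Obligation.
by move=> d m n g b [f [x ->]]; exists (mcomp f g), (act g x); rewrite diag_act_bact.
Qed.

Lemma latch_box_skel d n (x : X d n) (f : mono n d) :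
  latch_box d n (x, f) -> skel d n (bact X f n x).
Proof.
case=> [[/= h|/= [l' [g [y [lt ->]]]]]|[_ /= h]].
- by left; apply: ssub_act.
- by right; exists l', (mcomp g f), y; rewrite bact_comp.
- have [l' [g [f' [lt ->]]]] := not_surj_factor h.
  by right; exists l', f', (bact X g n x); rewrite bact_comp.
Qed.

Lemma skel_latch_box d n (x : X d n) (f : mono n d) :
  skel d n (bact X f n x) -> latch_box d n (x, f).
Proof.
have [sf|] := pselect (surj f); last by right.
have [s fs _] := mono_section ord0 sf.
have xE : x = bact X s n (bact X f n x) by rewrite -bact_comp fs bact_id.
left; case: H => [h|[l [g [y [lt e]]]]]; first by left; rewrite /= xE; apply: ssub_act.
by right; exists l, (mcomp g s), y; rewrite bact_comp -e -xE.
Qed.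

(** Outside of the latching box the point of the coend determines its representative: two
    surjections with the same sections are equal. *)
Lemma latch_box_inj d n (x x' : X d n) (f f' : mono n d) :
  ~ latch_box d n (x, f) -> ~ latch_box d n (x', f') ->
  bact X f n x = bact X f' n x' -> (x, f) = (x', f').
Proof.
move=> h h' e.
have sf : surj f by apply: contrapT => sf; apply: h; right.
have sec s : mcomp f s = mid d -> mcomp f' s = mid d /\ x = x'.
  move=> fs; have xE : x = bact X (mcomp f' s) n x'.
    by rewrite bact_comp -e -bact_comp fs bact_id.
  have [ss|ns] := pselect (surj (mcomp f' s)).
    by move: xE; rewrite (surj_endo ss) bact_id.
  case: h; left; right; have [l' [g [f0 [lt gf]]]] := not_surj_factor ns.
  by exists l', f0, (bact X g n x'); rewrite -bact_comp -gf.
have [s fs _] := mono_section ord0 sf; have [_ ->] := sec s fs.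
congr pair; apply: mono_ext => a; have [{fs}s fs sa] := mono_section a sf.
have [f's _] := sec s fs.
by rewrite -{2}sa -[RHS](_ : mcomp f' s (f a) = _) // f's.
Qed.

(** The next skeleton is the pushout of [X d * Delta d] along its latching box. *)
Lemma skel_step d : ext K (latch_box d) (subT _) -> ext K (skel d) (skel d.+1).
Proof.
move=> hd u hu.
have [m n g [x f] h|w hw wu] := hd (fun n y => u n (bact X y.2 n y.1)).
  by rewrite -hu ?diag_act_bact //; apply: latch_box_skel.
pose v n (b : diag X n) := if pselect (exists y : sProd (X d) (Delta d) n,
  b = bact X y.2 n y.1) is left e then w n (sval (cid e)) else u n b.
have vE n (f : mono n d) (x : X d n) : v n (bact X f n x) = w n (x, f).
  rewrite /v; case: pselect => [e|[]]; last by exists (x, f).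
  move: (svalP (cid e)); case: (sval _) => x' f' /= e'.
  have [h|h] := pselect (skel d n (bact X f n x)).
    by rewrite !wu /= ?e' //; apply: skel_latch_box; rewrite -?e'.
  congr (w n _); apply: latch_box_inj => // /latch_box_skel; first by rewrite -e'.
  by move/h.
have [||w' [hw' w'u _]] := nat_on_glue (P := skel d) (Q := skel_new d) (v := v) hu.
- move=> m n g _ [f [x ->]]; rewrite diag_act_bact !vE.
  exact: (hw m n g (x, f)).
- move=> n b h [f [x e]]; rewrite e in h *; rewrite vE wu //.
  exact: skel_latch_box.
exists w' => //; apply: nat_on_sub hw' => n b [h|[l [f [x [lt e]]]]].
  by left; left.
move: lt; rewrite ltnS leq_eqVlt => /orP[/eqP ld|lt].
  by right; subst l; exists f, x.
by left; right; exists l, f, x.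
Qed.

(** One skeleton after the other; every simplex of the diagonal lies in one of them. *)
Lemma ext_diag : (forall d, ext K (latch_box d) (subT _)) ->
  ext K (diag_sub N) (subT _).
Proof.
move=> h u hu.
(* A chosen extension to the next skeleton; by [hs] it exists at every stage. *)
pose step d v := if pselect (nat_on (skel d) v) is left hv
  then s2val (cid2 (skel_step (h d) hv)) else v.
pose s := fix s d := if d is d'.+1 then step d' (s d') else u.
have hs d : nat_on (skel d) (s d).
  elim: d => [|d IH].
    by apply: nat_on_sub hu => n b [//|[l [f [x []]]]].
  by rewrite /= /step; case: pselect => // hv; apply: s2valP.
have sS d n b : skel d n b -> s d.+1 n b = s d n b.
  by move=> hb; rewrite /= {1}/step; case: pselect => // hv; exact: (s2valP' (cid2 (skel_step (h d) hv))).
have skelS d d' n b : d <= d' -> skel d n b -> skel d' n b.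
  move=> le [hb|[l [f [x [lt e]]]]]; first by left.
  by right; exists l, f, x; rewrite (leq_trans lt le).
have sD d d' n b : d <= d' -> skel d n b -> s d' n b = s d n b.
  move=> le hb; rewrite -(subnKC le); elim: (d' - d) => [|k IH]; first by rewrite addn0.
  by rewrite addnS sS //; apply: skelS hb; apply: leq_addr.
have sk n b : skel n.+1 n b by right; exists n, (mid n), b; rewrite bact_id.
(* The [n]-simplices of the diagonal lie in its skeleton [n.+1]. *)
exists (fun n b => s n.+1 n b) => [m n f b _|n b hb].
  have -> : s m.+1 m (act f b) = s (maxn m.+1 n.+1) m (act f b).
    by symmetry; apply: sD (sk _ _); apply: leq_maxl.
  rewrite hs; last by apply: skelS (sk _ _); apply: leq_maxr.
  by congr act; apply: sD (sk _ _); apply: leq_maxr.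
by rewrite (sD 0) //; left.
Qed.

End Assembly.

(** * The homotopy extension property *)

Section HEP.
Variables (K : sSet) (hK : kan_complex K) (C : sSet) (A : sub C) (e : 'I_2).

Program Definition cyl_lev l : sSet :=
  @SSet (fun k => (C l * mono k 1)%type) (fun _ _ f x => (x.1, mcomp x.2 f)) _ _.
Next Obligation. by move=> l n [c p]; congr pair; apply: mono_ext. Qed.
Next Obligation. by move=> *; congr pair; apply: mono_ext. Qed.

Program Definition cyl_sspace : sspace :=
  @SSpace cyl_lev (fun m n f => @SMap (cyl_lev n) (cyl_lev m)
    (fun k x => (act f x.1, x.2)) _) _ _.
Next Obligation. by []. Qed.
Next Obligation. by move=> n k [c p]; rewrite /= act_id. Qed.
Next Obligation. by move=> * /=; rewrite act_comp. Qed.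

Program Definition cyl_ssub : ssub cyl_sspace :=
  @SSub cyl_sspace (fun l => @Sub (cyl_lev l) (fun k x => A l x.1 \/ x.2 = mconst k e) _) _.
Next Obligation. by move=> l m n f x [h|/= ->]; [left|right; apply: mono_ext]. Qed.
Next Obligation. by move=> m n f k x [h|h]; [left; apply: sub_act|right]. Qed.

(** [C * Delta 1] is the diagonal of the simplicial space [l |-> C l * Delta 1], with [C l]
    discrete.  There the latching box over a nondegenerate simplex of [C] outside of [A]
    is an open prism, and over any other simplex it is everything. *)
Lemma ext_cylinder : ext K (box A (subT C) (sub_end e)) (subT (sProd C (Delta 1))).
Proof.
move=> u hu.
have [||w hw wu] := @ext_diag K cyl_sspace cyl_ssub _ u.
- move=> l v hv.
  pose deg c := exists l' (f : mono l l') (c' : C l'), l' < l /\ c = act f c'.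
  have full c k (x : sProd (Delta l) (Delta 1) k) : A l c \/ deg c ->
      latch_box cyl_ssub l k ((c, x.2), x.1).
    case=> [h|[l' [f [c' [lt ->]]]]]; left; [by left; left|right].
    by exists l', f, (c', x.2).
  have /choice [w hw] c : exists w : forall k, sProd (Delta l) (Delta 1) k -> K k,
      nat_on (subT _) w /\ forall k x, latch_box cyl_ssub l k ((c, x.2), x.1) ->
                             w k x = v k ((c, x.2), x.1).
    have [hc|hc] := pselect (A l c \/ deg c).
      exists (fun k x => v k ((c, x.2), x.1)); split=> // m n f x _.
      exact: (hv m n f ((c, x.2), x.1)) (full _ _ _ hc).
    have [|w hw wu] := @ext_prism l K hK e (fun k x => v k ((c, x.2), x.1)).
      move=> m n f x hx; apply: (hv m n f ((c, x.2), x.1)).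
      by case: hx => [h|[_ h]]; [right|left; left; right].
    exists w; split=> // k x [[[h|h]|h]|[_ h]]; last by apply: wu; left.
    - by case: hc; left.
    - by apply: wu; right.
    - by case: hc; right; case: h => l' [f [[c' q] [lt [-> _]]]]; exists l', f, c'.
  exists (fun k x => w x.1.1 k (x.2, x.1.2)) => [m n f x _|k [[c p] f] h].
    by rewrite -(proj1 (hw _)).
  by rewrite (proj2 (hw c) k (f, p)).
- move=> m n f x h; apply: hu; case: h => h; [by left|by right].
exists w => // n b h; apply: wu; case: h => [h|[_ h]]; [by left|by right].
Qed.

End HEP.

(** * Anodyne inclusions *)

Program Definition sub_im A B (i : sMap A B) : sub B :=
  @Sub B (fun n b => exists a, b = i n a) _.
Next Obligation. by move=> A B i m n f b [a ->]; exists (act f a); rewrite sfun_act. Qed.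

Section Anodyne.
Variable K : sSet.

Lemma anodyne_eq B (P P' Q Q' : sub B) :
  (forall n b, P n b <-> P' n b) -> (forall n b, Q n b <-> Q' n b) ->
  anodyne K P Q -> anodyne K P' Q'.
Proof.
move=> hP hQ h Z Z'; apply: ext_eq (h Z Z') => n [b z] /=; last exact: hQ.
by have := hP n b; have := hQ n b; tauto.
Qed.

Lemma anodyne_refl B (P : sub B) : anodyne K P P.
Proof.
move=> Z Z' u hu; exists u => //; apply: nat_on_sub hu => n b h; exact: or_introl.
Qed.

Lemma anodyne_trans B (P Q R : sub B) :
  (forall n b, P n b -> Q n b) -> (forall n b, Q n b -> R n b) ->
  anodyne K P Q -> anodyne K Q R -> anodyne K P R.
Proof.
move=> PQ QR h1 h2 Z Z' u hu.
have [|v hv vu] := h1 Z Z' u.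
  by apply: nat_on_sub hu => n b [h|[h h']]; [left|right; split=> //; apply: QR].
have hu' : nat_on (subI (sub_pre (sfst B Z) R) (sub_pre (ssnd B Z) Z')) u.
  by apply: nat_on_sub hu; right.
have [|v' [hv' v'v v'u]] := nat_on_glue hv hu'.
  by move=> n b hQ [_ hZ]; apply: vu; right.
have [w hw wv'] := h2 Z Z' v' hv'; exists w => // n b hb.
have hb' : box Q R Z' n b by case: hb => [/PQ|]; [left|right].
rewrite wv' //; case: hb => [h|h]; last by rewrite v'u.
by rewrite v'v ?vu //; [left|apply: PQ].
Qed.

Lemma anodyne_pushout A B (i : sMap A B) (P : sub B) :
  (forall n, injective (i n)) -> anodyne K (sub_pre i P) (subT A) ->
  anodyne K P (subU P (sub_im i)).
Proof.
move=> i_inj h Z Z' u hu.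
pose iZ := sProd_map i (sMap_id Z).
have [|w hw wu] := h Z Z' (fun n a => u n (iZ n a)).
  apply: nat_on_comp hu => n a [ha|[_ ha]]; [by left|right; split=> //].
  by right; exists a.1.
pose v n (b : sProd B Z n) := if pselect (exists a, b.1 = i n a) is left e
  then w n (sval (cid e), b.2) else u n b.
have vE n a z : v n (i n a, z) = w n (a, z).
  rewrite /v; case: pselect => [e|[]]; last by exists a.
  by congr (w n (_, z)); apply: i_inj; rewrite -(svalP (cid e)).
have hu' : nat_on (sub_pre (sfst B Z) P) u by apply: nat_on_sub hu; left.
have [||w' [hw' w'u w'v]] := nat_on_glue (Q := sub_pre (sfst B Z) (sub_im i)) (v := v) hu'.
- move=> m n f [_ z] [/= a ->]; rewrite -sfun_act !vE.
  exact: (hw m n f (a, z)).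
- move=> n [b z] /= hb [a e]; rewrite e in hb *; rewrite vE wu //; by left.
exists w'; first exact: nat_on_sub hw'.
move=> n b [hb|[[hb|hb] hz]]; [exact: w'u|exact: w'u|].
rewrite w'v //; case: b hb hz => _ z [/= a ->] hz; rewrite vE wu //; by right.
Qed.

Hypothesis hK : kan_complex K.

(** Extend the restriction of [u] to [P] over [B].  On [Q] the result is homotopic to [u]
    relatively to [P], because [P] is anodyne in [Q]; the homotopy extension property of
    [Q] in [B] then corrects it to an extension of [u]. *)
Lemma anodyne_cancel B (P Q : sub B) : (forall n b, P n b -> Q n b) ->
  anodyne K P Q -> anodyne K P (subT B) -> anodyne K Q (subT B).
Proof.
move=> PQ h1 h2 Z Z' u hu.
have [|w' hw' w'u] := h2 Z Z' u.
  by apply: nat_on_sub hu => n b [h|[_ h]]; [left; apply: PQ|right].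
(* [h] is a homotopy on [Q * Z] from [w'] to [u], relatively to [P * Z] and [Q * Z'] *)
pose IZ := sProd Z (Delta 1).
pose bd : sub IZ := subU (sub_pre (ssnd Z (Delta 1)) (sub_end ord0))
  (subU (sub_pre (ssnd Z (Delta 1)) (sub_end ord_max)) (sub_pre (sfst Z (Delta 1)) Z')).
pose r : sMap (sProd B IZ) (sProd B Z) :=
  sProd_map (sMap_id B) (sfst Z (Delta 1)).
have nw' : nat_on (subU (sub_pre (sfst B IZ) P)
    (subU (sub_pre (ssnd B IZ) (sub_pre (ssnd Z (Delta 1)) (sub_end ord0)))
          (sub_pre (ssnd B IZ) (sub_pre (sfst Z (Delta 1)) Z'))))
    (fun n b => w' n (r n b)).
  by apply: nat_on_comp hw'.
have nu : nat_on (subI (sub_pre (sfst B IZ) Q)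
    (sub_pre (ssnd B IZ) (sub_pre (ssnd Z (Delta 1)) (sub_end ord_max))))
    (fun n b => u n (r n b)).
  by apply: nat_on_comp hu => n [b z] [hQ _]; left.
have [|h0 [nh0 h0w h0u]] := nat_on_glue nw' nu.
  move=> n [b [z p]] /= [hP|[e0|hz]] [hQ e1].
  - by apply: w'u; left.
  - by move: e1; rewrite e0 => /(mono_val ord0).
  - by apply: w'u; right.
have [|h nh hh0] := h1 IZ bd h0.
  apply: nat_on_sub nh0 => n b [hP|[hQ [h0'|[h1'|hz]]]].
  - by left; left.
  - by left; right; left.
  - by right.
  - by left; right; right.
(* [g] extends [h] to [B * Z], starting from [w'] *)
pose ZB := sProd B Z.
pose QZ : sub ZB := subU (sub_pre (sfst B Z) Q) (sub_pre (ssnd B Z) Z').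
pose as_ : sMap (sProd ZB (Delta 1)) (sProd B IZ) :=
  @SMap (sProd ZB (Delta 1)) (sProd B IZ) (fun n x => (x.1.1, (x.1.2, x.2)))
    (fun _ _ _ _ => erefl).
have n1 : nat_on (sub_pre (sfst ZB (Delta 1)) (sub_pre (sfst B Z) Q))
    (fun n x => h n (as_ n x)).
  by apply: nat_on_comp nh.
have n2 : nat_on (subU (sub_pre (sfst ZB (Delta 1)) (sub_pre (ssnd B Z) Z'))
    (sub_pre (ssnd ZB (Delta 1)) (sub_end ord0))) (fun n x => w' n x.1).
  by move=> m n f x _; apply: hw'.
have [|g0 [ng0 g0h g0w]] := nat_on_glue n1 n2.
  move=> n [[b z] p] /= hQ hz; rewrite hh0; last first.
    right; split=> //; case: hz => hz; [by right; right|by left].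
  rewrite h0w //=; right; case: hz => hz; [by right|by left].
have [|g ng gg0] := @ext_cylinder K hK _ QZ ord0 g0.
  apply: nat_on_sub ng0 => n x [[hQ|hZ]|[_ h0']]; [by left|by right; left|by right; right].
exists (fun n x => g n (x, mconst n ord_max)).
  move=> m n f x _; rewrite -ng //; congr (g m (_, _)); exact: mono_ext.
move=> n [b z] hb; rewrite gg0; last by left; case: hb => [h2'|[_ h2']]; [left|right].
case: hb => [hQ|[_ hz]].
  rewrite g0h //= hh0; last by right; split=> //; right; left.
  by rewrite h0u.
rewrite g0w; last by left.
by apply: w'u; right.
Qed.

End Anodyne.

(** * Contractions and mapping cylinders *)

Notation pt0 n := (mconst n (@ord0 1)).
Notation pt1 n := (mconst n (@ord_max 1)).

Lemma mcomp_mconst m n k (i : 'I_k.+1) (f : mono m n) : mcomp (mconst n i) f = mconst m i.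
Proof. exact: mono_ext. Qed.

(** [Y] is regarded as a discrete simplicial set, with copy [ctr_base] in [X].  The
    contraction is a zigzag: [ctr_H1] and [ctr_H2] start from the same map and end at the
    identity and in the base, as a coreflection followed by terminal objects provides no
    more.  The homotopies preserve the base as a subcomplex, not pointwise. *)
Record contraction (X : sSet) (Y : Type) := Contraction {
  ctr_p : forall k, X k -> Y;
  ctr_p_act : forall m n (f : mono m n) x, ctr_p (act f x) = ctr_p x;
  ctr_t : Y -> X 0;
  ctr_tK : forall y, ctr_p (ctr_t y) = y;
  ctr_base : forall k, X k -> Prop := fun k x => x = degen k (ctr_t (ctr_p x));
  ctr_H1 : sMap (sProd X (Delta 1)) X;
  ctr_H2 : sMap (sProd X (Delta 1)) X;
  ctr_H1_base : forall k x (f : Delta 1 k), ctr_base x -> ctr_base (ctr_H1 k (x, f));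
  ctr_H2_base : forall k x (f : Delta 1 k), ctr_base x -> ctr_base (ctr_H2 k (x, f));
  ctr_H12 : forall k x, ctr_H1 k (x, pt0 k) = ctr_H2 k (x, pt0 k);
  ctr_H1_end : forall k x, ctr_H1 k (x, pt1 k) = x;
  ctr_H2_end : forall k x, ctr_base (ctr_H2 k (x, pt1 k))
}.

Section Cylinder.
Variables (X : sSet) (Y : Type) (c : contraction X Y).
Notation p := (ctr_p c).
Notation t := (ctr_t c).

Program Definition ctr_sub : sub X := @Sub X (ctr_base c) _.
Next Obligation.
by move=> m n f x h; rewrite /ctr_base ctr_p_act -(act_degen f) -h.
Qed.

Program Definition shuffle_htpy (H : sMap (sProd X (Delta 1)) X) Z :
    sMap (sProd (sProd X Z) (Delta 1)) (sProd X Z) :=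
  @SMap (sProd (sProd X Z) (Delta 1)) (sProd X Z)
    (fun n x => (H n (x.1.1, x.2), x.1.2)) _.
Next Obligation. by move=> H Z m n f x; congr pair; rewrite /= -sfun_act. Qed.

(** The mapping cylinder of [X -> Y], without quotients: a simplex which is not in [Y] is
    a simplex of [X * Delta 1] which is not in the end [pt1]. *)
Definition mcyl_ok k (z : (X k * mono k 1) + Y) : Prop :=
  if z is inl a then a.2 <> pt1 k else True.

Definition mcyl_simp k := {z : (X k * mono k 1) + Y | mcyl_ok z}.

Definition mcyl_q k (a : X k * mono k 1) : mcyl_simp k :=
  match pselect (a.2 = pt1 k) with
  | left _ => exist (@mcyl_ok k) (inr (p a.1)) I
  | right h => exist (@mcyl_ok k) (inl a) h
  end.

Definition mcyl_r k (y : Y) : mcyl_simp k := exist (@mcyl_ok k) (inr y) I.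

Lemma mcyl_q1 k x : mcyl_q (x, pt1 k) = mcyl_r k (p x).
Proof. by rewrite /mcyl_q; case: pselect. Qed.

Lemma mcyl_ind k (P : mcyl_simp k -> Prop) :
  (forall a, P (mcyl_q a)) -> (forall y, P (mcyl_r k y)) -> forall z, P z.
Proof.
move=> h1 h2 [[a|y] h]; last by have := h2 y; rewrite /mcyl_r (Prop_irrelevance I h).
have := h1 a; rewrite /mcyl_q; case: pselect => // h'.
by rewrite (Prop_irrelevance h' h).
Qed.

Definition mcyl_act m n (f : mono m n) (z : mcyl_simp n) : mcyl_simp m :=
  match sval z with
  | inl a => mcyl_q (act f a.1, mcomp a.2 f)
  | inr y => mcyl_r m y
  end.

Lemma mcyl_act_q m n (f : mono m n) a :
  mcyl_act f (mcyl_q a) = mcyl_q (act f a.1, mcomp a.2 f).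
Proof.
rewrite {1}/mcyl_q; case: pselect => [e|//].
by rewrite e mcomp_mconst mcyl_q1 ctr_p_act.
Qed.

Program Definition mcyl : sSet := @SSet mcyl_simp mcyl_act _ _.
Next Obligation.
move=> n z; elim/mcyl_ind: z => [[x f]|//]; rewrite mcyl_act_q act_id.
by congr (mcyl_q (_, _)); apply: mono_ext.
Qed.
Next Obligation.
move=> k m n f g z; elim/mcyl_ind: z => [[x h]|//].
rewrite !mcyl_act_q /= act_comp; congr (mcyl_q (_, _)); exact: mono_ext.
Qed.

Program Definition mcyl_in : sMap X mcyl :=
  @SMap X mcyl (fun k x => mcyl_q (x, pt0 k)) _.
Next Obligation. by move=> m n f x; rewrite /= mcyl_act_q /= mcomp_mconst. Qed.

Definition disc : sSet := @SSet (fun _ => Y) (fun _ _ _ y => y)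
  (fun _ _ => erefl) (fun _ _ _ _ _ _ => erefl).

Program Definition disc_mcyl Z :
    sMap (sProd (sProd disc Z) (Delta 1)) (sProd mcyl Z) :=
  @SMap (sProd (sProd disc Z) (Delta 1)) (sProd mcyl Z)
    (fun n x => (mcyl_q (degen n (t x.1.1), x.2), x.1.2)) _.
Next Obligation.
by move=> Z m n f [[y z] g]; rewrite /= mcyl_act_q /= act_degen.
Qed.

Program Definition prod_disc Z :
    sMap (sProd X (sProd Z (Delta 1))) (sProd (sProd disc Z) (Delta 1)) :=
  @SMap (sProd X (sProd Z (Delta 1))) (sProd (sProd disc Z) (Delta 1))
    (fun n x => ((p x.1, x.2.1), x.2.2)) _.
Next Obligation. by move=> Z m n f [x [z g]]; rewrite /= ctr_p_act. Qed.

Program Definition prod_mcyl Z :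
    sMap (sProd X (sProd Z (Delta 1))) (sProd mcyl Z) :=
  @SMap (sProd X (sProd Z (Delta 1))) (sProd mcyl Z)
    (fun n x => (mcyl_q (x.1, x.2.2), x.2.1)) _.
Next Obligation. by move=> Z m n f [x [z g]]; rewrite /= mcyl_act_q. Qed.

Variables (K : sSet) (hK : kan_complex K).

(** Pulled back along [ctr_H2], the partial map is defined at the end [pt1], hence extends
    along the cylinder to the end [pt0]; there [ctr_H1] starts, and its other end is the
    identity. *)
Lemma anodyne_ctr_sub : anodyne K ctr_sub (subT X).
Proof.
move=> Z Z' u hu; pose A := box ctr_sub (subT X) Z'.
have [|g1 ng1 g1E] := @ext_cylinder K hK _ A ord_max
    (fun n x => u n (shuffle_htpy (ctr_H2 c) Z n x)).
  apply: nat_on_comp hu => n [[x z] f] [[h|[_ h]]|[_ h]].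
  - by left; apply: ctr_H2_base.
  - by right.
  - by left; rewrite /= [f]h; apply: ctr_H2_end.
pose w1 n x := g1 n (x, pt0 n).
have nw1 : nat_on (subT (sProd X Z)) w1.
  by move=> m n f x _; rewrite /w1 -ng1 //=; congr (g1 m (_, _)); rewrite mcomp_mconst.
have w1E n x : A n x -> w1 n x = u n (ctr_H2 c n (x.1, pt0 n), x.2).
  by move=> h; rewrite /w1 g1E //; left.
have n1 : nat_on (sub_pre (sfst _ _) A) (fun n x => u n (shuffle_htpy (ctr_H1 c) Z n x)).
  apply: nat_on_comp hu => n [[x z] f] [h|[_ h]]; last by right.
  by left; apply: ctr_H1_base.
have n2 : nat_on (sub_pre (ssnd (sProd X Z) (Delta 1)) (sub_end ord0)) (fun n x => w1 n x.1).
  by apply: (nat_on_comp (f := sfst _ _)) nw1.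
have [|g0 [ng0 g0H g0w]] := nat_on_glue n1 n2.
  by move=> n [[x z] f] h /= ->; rewrite w1E // ctr_H12.
have [|g ng gE] := @ext_cylinder K hK _ A ord0 g0.
  by apply: nat_on_sub ng0 => n x [h|[_ h]]; [left|right].
exists (fun n x => g n (x, pt1 n)).
  by move=> m n f x _; rewrite -ng //=; congr (g m (_, _)); rewrite mcomp_mconst.
move=> n [x z] h; rewrite gE; last by left.
by rewrite g0H //= ctr_H1_end.
Qed.

(** First extend along the cylinder on the points [ctr_t y], which gives the values on [Y].
    What remains is to extend from [ctr_sub] to [X] relatively to both ends of the
    cylinder, which is [anodyne_ctr_sub] times [Delta 1]. *)
Lemma anodyne_mcyl : anodyne K (sub_im mcyl_in) (subT mcyl).
Proof.
move=> Z Z' u hu.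
have [|a na aE] := @ext_cylinder K hK (sProd disc Z)
    (sub_pre (ssnd disc Z) Z') ord0 (fun n x => u n (disc_mcyl Z n x)).
  apply: nat_on_comp hu => n [[y z] f] [h|[_ /= ->]]; first by right.
  by left; exists (degen n (t y)).
pose D1 := Delta 1.
pose bd : sub (sProd Z D1) :=
  subU (sub_pre (ssnd Z D1) (sub_end ord_max))
    (subU (sub_pre (ssnd Z D1) (sub_end ord0)) (sub_pre (sfst Z D1) Z')).
have na' : nat_on (subU (sub_pre (sfst X (sProd Z D1)) ctr_sub)
      (sub_pre (ssnd X (sProd Z D1)) (sub_pre (ssnd Z D1) (sub_end ord_max))))
    (fun n x => a n (prod_disc Z n x)) by apply: nat_on_comp na.
have nu' : nat_on (sub_pre (ssnd X (sProd Z D1))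
       (subU (sub_pre (ssnd Z D1) (sub_end ord0)) (sub_pre (sfst Z D1) Z')))
    (fun n x => u n (prod_mcyl Z n x)).
  apply: nat_on_comp hu => n [x [z f]] [/= ->|h]; last by right.
  by left; exists x.
have [|b0 [nb0 b0a b0u]] := nat_on_glue na' nu'.
  move=> n [x [z f]] /= h h'; rewrite aE; last first.
    by case: h' => [->|h']; [right|left].
  congr (u n (_, _)); case: h => [h|->]; first by congr (mcyl_q (_, _)); symmetry; exact: h.
  by rewrite !mcyl_q1 /degen ctr_p_act ctr_tK.
have [|b nf_piece bE] := anodyne_ctr_sub (Z' := bd) (u := b0).
  by apply: nat_on_sub nb0 => n x [h|[_ [h|h]]]; [left; left|left; right|right].
pose w n (x : sProd mcyl Z n) := match sval x.1 with
  | inl q => b n (q.1, (x.2, q.2)) | inr y => a n ((y, x.2), pt1 n) end.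
have wq n q z : w n (mcyl_q q, z) = b n (q.1, (z, q.2)).
  case: q => x f; rewrite /w {1}/mcyl_q /=; case: pselect => //= ->.
  rewrite bE; last by right; split=> //; left.
  by rewrite b0a //; right.
exists w.
- move=> m n f [q z] _; elim/mcyl_ind: q => [q|y].
    have -> : act (s := sProd mcyl Z) f (mcyl_q q, z) =
              (mcyl_q (act f q.1, mcomp q.2 f), act f z) by rewrite /= mcyl_act_q.
    by rewrite !wq -nf_piece.
  by rewrite /w /= -na //=; congr (a m (_, _)); rewrite mcomp_mconst.
- move=> n [q z] [[x /= ->]|[_ hz]].
    rewrite wq bE; last by right; split=> //; right; left.
    by rewrite b0u //; left.
  elim/mcyl_ind: q hz => [q|y] /= hz.
    rewrite wq bE; last by right; split=> //; right; right.
    by rewrite b0u /=; [case: q|right].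
  rewrite /w /= aE; last by left.
  by congr (u n (_, _)); rewrite /= mcyl_q1 /degen ctr_p_act ctr_tK.
Qed.

End Cylinder.

(** * Latching subcomplexes *)

Section Latching.
Variables (K : sSet) (hK : kan_complex K) (M : sspace) (N : ssub M).
Hypothesis N_anodyne : forall l, anodyne K (N l) (subT (M l)).

(** The simplices degenerate along one of the first [j] degeneracies. *)
Program Definition fixdeg l j : sub (M l) :=
  @Sub (M l) (fun k x => exists i, [/\ i < j, i < l & bact M (eidem l i) k x = x]) _.
Next Obligation.
by move=> l j m n f x [i [ij il e]]; exists i; split=> //; rewrite sfun_act e.
Qed.

Lemma degenerateP l k (x : M l k) : degenerate M l k x <-> fixdeg l l k x.
Proof.
split=> [[l' [f [y [lt ->]]]]|[i [_ lt e]]].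
  by have [i il fi] := low_dim_eidem f lt; exists i; rewrite -bact_comp fi.
case: l x lt e => // l x lt <-.
exists l, (sdeg (Ordinal lt)), (bact M (dface l i.+1) k x); split=> //.
by rewrite -bact_comp (dface_sdeg (Ordinal lt)).
Qed.

Lemma bact_sdegK l (j : 'I_l.+1) k : cancel (bact M (sdeg j) k) (bact M (dface l j.+1) k).
Proof. by move=> x; rewrite -bact_comp sdeg_dface bact_id. Qed.

Lemma fixdeg_sdeg l (j : 'I_l.+1) k (x : M l k) :
  fixdeg l.+1 j k (bact M (sdeg j) k x) <-> fixdeg l j k x.
Proof.
split=> [[i [ij il e]]|[i [ij il e]]]; exists i; split=> //.
- by have := ltn_ord j; lia.
- by rewrite -{2}(bact_sdegK j x) -e -!bact_comp sdeg_eidem_dface.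
- by have := ltn_ord j; lia.
- by rewrite -e -!bact_comp eidem_sdeg_eidem.
Qed.

Lemma ssub_sdeg l (j : 'I_l.+1) k (x : M l k) :
  N l.+1 k (bact M (sdeg j) k x) <-> N l k x.
Proof.
split=> [h|]; last exact: ssub_act.
by rewrite -(bact_sdegK j x); apply: ssub_act.
Qed.

Lemma fixdegS l (j : 'I_l.+1) k (x : M l.+1 k) :
  fixdeg l.+1 j.+1 k x <-> fixdeg l.+1 j k x \/ exists y, x = bact M (sdeg j) k y.
Proof.
split=> [[i [ij il e]]|[[i [ij il e]]|[y ->]]].
- move: ij; rewrite ltnS leq_eqVlt => /orP[/eqP ij|ij]; last by left; exists i.
  right; exists (bact M (dface l j.+1) k x).
  by rewrite -bact_comp dface_sdeg -ij e.
- by exists i; rewrite (leq_trans ij).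
- exists j; split=> //; rewrite -bact_comp.
  suff -> : mcomp (sdeg j) (eidem l.+1 j) = sdeg j by [].
  by apply: mono_eqP => i /=; lia.
Qed.

(** Induction on [l].  By cancellation it suffices that [N l] is anodyne in the latching
    subcomplex, to which the images of the degeneracies are attached one at a time; the
    [j]-th image is a copy of [M l.-1], attached along [N l.-1] and the first [j]
    degeneracies. *)
Lemma anodyne_latching l j : anodyne K (subU (N l) (fixdeg l j)) (subT (M l)).
Proof.
elim: l j => [|l IH] j.
  apply: anodyne_eq (N_anodyne (l := 0)) => // k x.
  by split=> [|[//|[i []]]]; first by left.
apply: (anodyne_cancel hK (P := N l.+1)) => //; first by left.
elim: j => [|j IHj].
  apply: anodyne_eq (anodyne_refl (P := N l.+1)) => // k x;
    by split=> [|[//|[i []]]]; first by left.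
have [lj|jl] := ltnP l j.
  apply: anodyne_eq IHj => // k x; split=> [] [h|[i [ij il e]]];
    by [left|right; exists i; split=> //; lia].
apply: anodyne_trans IHj _; first by left.
  by move=> k x [h|[i [ij il e]]]; [left|right; exists i; split=> //; lia].
pose j' : 'I_l.+1 := Ordinal (jl : j < l.+1).
have h := @anodyne_pushout K _ _ (bact M (sdeg j')) (subU (N l.+1) (fixdeg l.+1 j))
  (fun k => can_inj (bact_sdegK j' (k := k))).
apply: (anodyne_eq _ _ (h _)) => [//|k x|].
  split=> [[[hN|hf]|hi]|[hN|/(fixdegS j') [hf|hi]]].
  - by left.
  - by right; apply/(fixdegS j'); left.
  - by right; apply/(fixdegS j'); right.
  - by left; left.
  - by left; right.
  - by right.
apply: anodyne_eq (IH j) => // k x; split=> [] [hN|hf].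
- by left; apply/(ssub_sdeg j').
- by right; apply/(fixdeg_sdeg j').
- by left; apply/(ssub_sdeg j').
- by right; apply/(fixdeg_sdeg j').
Qed.

Section ProdZ.
Variables (Z : sSet) (Z' : sub Z).

Program Definition sspace_prod : sspace :=
  @SSpace (fun l => sProd (M l) Z) (fun m n f => sProd_map (bact M f) (sMap_id Z)) _ _.
Next Obligation. by move=> n k [x z]; rewrite /= bact_id. Qed.
Next Obligation. by move=> p m n f g k [x z]; rewrite /= bact_comp. Qed.

Program Definition ssub_prod : ssub sspace_prod :=
  @SSub sspace_prod (fun l => box (N l) (subT (M l)) Z') _.
Next Obligation.
by move=> m n f k [x z] [h|h]; [left; apply: ssub_act|right].
Qed.

End ProdZ.

Lemma anodyne_diag : anodyne K (diag_sub N) (subT (diag M)).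
Proof.
move=> Z Z' u hu; have [||w hw wu] := @ext_diag K (sspace_prod Z) (ssub_prod Z') _ u.
- move=> l v hv.
  pose bd : sub (sProd Z (Delta l)) :=
    subU (sub_pre (sfst Z (Delta l)) Z') (sub_pre (ssnd Z (Delta l)) (@bdry l)).
  pose as_ : sMap (sProd (M l) (sProd Z (Delta l))) (sProd (sProd (M l) Z) (Delta l)) :=
    @SMap (sProd (M l) (sProd Z (Delta l))) (sProd (sProd (M l) Z) (Delta l))
      (fun n x => ((x.1, x.2.1), x.2.2)) (fun _ _ _ _ => erefl).
  have deg n x z : degenerate M l n x -> degenerate (sspace_prod Z) l n (x, z).
    by case=> l' [f [y [lt ->]]]; exists l', f, (y, z).
  have deg' n x z : degenerate (sspace_prod Z) l n (x, z) -> degenerate M l n x.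
    by case=> l' [f [[y z'] [lt [-> _]]]]; exists l', f, y.
  have [|w hw wv] := anodyne_latching (l := l) (j := l) (Z' := bd)
      (u := fun n x => v n (as_ n x)).
    apply: nat_on_comp hv => n [x [z f]] [[h|h]|[_ [h|h]]].
    + by left; left; left.
    + by left; right; apply: deg; apply/degenerateP.
    + by left; left; right.
    + by right.
  exists (fun n x => w n (x.1.1, (x.1.2, x.2))).
    by move=> m n f [[x z] g] _; rewrite -hw.
  move=> n [[x z] f] h; rewrite wv //; case: h => [[[h|[_ h]]|h]|[_ h]].
  + by left; left.
  + by right; split=> //; left.
  + by left; right; apply/degenerateP; apply: deg' h.
  + by right; split=> //; right.
- by move=> m n f b hb; apply: hu.
exists w => [m n f b _|n b h]; [exact: hw|exact: wu].
Qed.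

End Latching.

(** * Kan equivalences *)

Notation cls u := (qpi (@edge_rel _) u).

Lemma pi0_precompE X X' (f : sMap X X') K (u : sFun X' K 0) :
  pi0_map (sFun_precomp f K) (cls u) = cls (sFun_precomp f K 0 u).
Proof. exact: pi0_mapE. Qed.

Lemma pi0_precomp_comp X Y Z (g : sMap Y Z) (f : sMap X Y) K u :
  pi0_map (sFun_precomp (sMap_comp g f) K) u =
  pi0_map (sFun_precomp f K) (pi0_map (sFun_precomp g K) u).
Proof.
elim/quot_ind: u => u; rewrite !pi0_precompE; congr qpi; exact: sMap_ext.
Qed.

Lemma pi0_precomp_id X (f : sMap X X) K u : (forall n x, f n x = x) ->
  pi0_map (sFun_precomp f K) u = u.
Proof.
move=> h; elim/quot_ind: u => u; rewrite !pi0_precompE; congr qpi; apply: sMap_ext => n x /=.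
by rewrite h; case: x.
Qed.

Lemma kan_equivalence_comp X Y Z (g : sMap Y Z) (f : sMap X Y) :
  kan_equivalence g -> kan_equivalence f -> kan_equivalence (sMap_comp g f).
Proof.
move=> hg hf K hK.
apply: (eq_bij (bij_comp (hf K hK) (hg K hK))) => u.
by rewrite pi0_precomp_comp.
Qed.

(** [p] is a retract of [q] by maps which are the identity of [Y]. *)
Lemma kan_equivalence_retract X X' Y (q : sMap X Y) (p : sMap X' Y)
    (r : sMap X X') (s : sMap X' X) :
  (forall n x, p n (r n x) = q n x) -> (forall n x, q n (s n x) = p n x) ->
  (forall n x, r n (s n x) = x) -> kan_equivalence q -> kan_equivalence p.
Proof.
move=> pr qs rs hq K hK; have [qi qK Kq] := hq K hK.
have qE : q = sMap_comp p r by apply: sMap_ext => n x; rewrite sMap_compE pr.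
have rsE u : pi0_map (sFun_precomp s K) (pi0_map (sFun_precomp r K) u) = u.
  by rewrite -pi0_precomp_comp pi0_precomp_id.
have rpE u : pi0_map (sFun_precomp r K) (pi0_map (sFun_precomp p K) u) =
    pi0_map (sFun_precomp q K) u by rewrite qE pi0_precomp_comp.
exists (fun u => qi (pi0_map (sFun_precomp r K) u)) => u; first by rewrite rpE qK.
by rewrite -[LHS]rsE rpE Kq rsE.
Qed.

Lemma pi0_precomp_htpy X X' K (F : sMap (sProd X (Delta 1)) X') (f0 f1 : sMap X X') u :
  (forall n x, F n (x, pt0 n) = f0 n x) -> (forall n x, F n (x, pt1 n) = f1 n x) ->
  pi0_map (sFun_precomp f0 K) u = pi0_map (sFun_precomp f1 K) u.
Proof.
move=> F0 F1; elim/quot_ind: u => u; rewrite !pi0_precompE; apply: qpi_step.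
pose e : sMap (sProd X (Delta 1)) (sProd X' (Delta 0)) :=
  @SMap (sProd X (Delta 1)) (sProd X' (Delta 0)) (fun n x => (F n x, mconst n ord0))
    (fun m n f x => congr2 pair (sfun_act F f x) (esym (mcomp_mconst ord0 f))).
have d0 n (x : mono n 0) : x = mconst n ord0.
  by apply: mono_ext => i; rewrite (ord1 (x i)).
exists (sMap_comp u e); split; apply: sMap_ext => n [x f] /=; congr (u n (_, _)).
- by rewrite -F0; congr (F n (_, _)); apply: mono_ext.
- by rewrite [RHS]d0.
- by rewrite -F1; congr (F n (_, _)); apply: mono_ext.
- by rewrite [RHS]d0.
Qed.

Lemma kan_equivalence_htpy M Y (q : sMap M Y) (j : sMap Y M)
    (F : sMap (sProd M (Delta 1)) M) :
  (forall n y, q n (j n y) = y) -> (forall n x, F n (x, pt0 n) = x) ->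
  (forall n x, F n (x, pt1 n) = j n (q n x)) -> kan_equivalence q.
Proof.
move=> qj F0 F1 K hK; exists (pi0_map (sFun_precomp j K)) => u.
  by rewrite -pi0_precomp_comp pi0_precomp_id.
rewrite -pi0_precomp_comp -(pi0_precomp_htpy (F := F) (f0 := sMap_id M)) //.
by rewrite pi0_precomp_id.
Qed.

(** The extension property with parameter [Delta 0] gives surjectivity on homotopy classes
    of maps to [K], and with parameter [Delta 1] and both its ends it gives injectivity.
    The function [d] supplies values for partial maps where none are prescribed. *)
Lemma kan_equivalence_anodyne A B (i : sMap A B) (d : forall n, B n -> A n) :
  (forall n, injective (i n)) ->
  (forall K, kan_complex K -> anodyne K (sub_im i) (subT B)) -> kan_equivalence i.
Proof.
move=> i_inj h K hK; have hi := h K hK.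
have extend (u : sFun A K 0) : exists v : sFun B K 0, sFun_precomp i K 0 v = u.
  pose u0 n (x : sProd B (Delta 0) n) := if pselect (exists a, x.1 = i n a) is left e
    then u n (sval (cid e), x.2) else u n (d n x.1, x.2).
  have u0E n a z : u0 n (i n a, z) = u n (a, z).
    rewrite /u0; case: pselect => [e|[]]; last by exists a.
    by congr (u n (_, z)); apply: i_inj; rewrite -(svalP (cid e)).
  have no : ~ exists n (x : Delta 0 n), False by case=> ? [].
  pose Z0 : sub (Delta 0) := @Sub (Delta 0) (fun _ _ => False) (fun _ _ _ _ h => h).
  have [|w hw wu] := hi _ Z0 u0.
    move=> m n f [_ z] [/= [a ->]|[_ []]]; rewrite -sfun_act !u0E.
    exact: (sfun_act u f (a, z)).
  exists (@SMap (sProd B (Delta 0)) K w (fun m n f x => hw m n f x I)).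
  apply: sMap_ext => n [a z] /=; rewrite wu ?u0E //.
  by left; exists a.
have extend_edge (v v' : sFun B K 0) :
    edge_rel (sFun_precomp i K 0 v) (sFun_precomp i K 0 v') -> edge_rel v v'.
  case=> e [e0 e1].
  have e0E n (a : A n) : e n (a, pt0 n) = v n (i n a, mconst n ord0).
    have /(congr1 (fun w : sMap (sProd A (Delta 0)) K => w n (a, mconst n ord0))) /= <- := e0.
    by congr (e n (_, _)); apply: mono_ext.
  have e1E n (a : A n) : e n (a, pt1 n) = v' n (i n a, mconst n ord0).
    have /(congr1 (fun w : sMap (sProd A (Delta 0)) K => w n (a, mconst n ord0))) /= <- := e1.
    by congr (e n (_, _)); apply: mono_ext.
  pose u0 n (x : sProd B (Delta 1) n) := if pselect (exists a, x.1 = i n a) is left ex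
    then e n (sval (cid ex), x.2) else
      if pselect (x.2 = pt0 n) then v n (x.1, mconst n ord0) else v' n (x.1, mconst n ord0).
  have u0E n a z : u0 n (i n a, z) = e n (a, z).
    rewrite /u0; case: pselect => [ex|[]]; last by exists a.
    by congr (e n (_, z)); apply: i_inj; rewrite -(svalP (cid ex)).
  have u00 n b : u0 n (b, pt0 n) = v n (b, mconst n ord0).
    have [[a ->]|hb] := pselect (exists a, b = i n a); first by rewrite u0E e0E.
    by rewrite /u0; case: pselect => //= _; case: pselect.
  have u01 n b : u0 n (b, pt1 n) = v' n (b, mconst n ord0).
    have [[a ->]|hb] := pselect (exists a, b = i n a); first by rewrite u0E e1E.
    rewrite /u0; case: pselect => //= _; case: pselect => // h1.
    by have := mono_val ord0 h1.
  pose Z1 := subU (sub_end ord0) (sub_end ord_max).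
  have [|w hw wu] := hi _ Z1 u0.
    move=> m n f [b z] [/= [a ->]|[_ /= [->|->]]].
    - by rewrite -sfun_act !u0E; apply: (sfun_act e f (a, z)).
    - by rewrite !mcomp_mconst !u00 -sfun_act /= mcomp_mconst.
    - by rewrite !mcomp_mconst !u01 -sfun_act /= mcomp_mconst.
  have d0 n (x : mono n 0) : x = mconst n ord0.
    by apply: mono_ext => j; rewrite (ord1 (x j)).
  exists (@SMap (sProd B (Delta 1)) K w (fun m n f x => hw m n f x I)).
  split; apply: sMap_ext => n [b z] /=; rewrite [z]d0.
  - rewrite (_ : mcomp _ _ = pt0 n); last exact: mono_ext.
    by rewrite wu ?u00 //; right; split=> //; left.
  - rewrite (_ : mcomp _ _ = pt1 n); last exact: mono_ext.
    by rewrite wu ?u01 //; right; split=> //; right.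
have /choice [E hE] := extend.
have edge_refl (X : sSet) (x : X 0) : edge_rel x x.
  by exists (degen 1 x); rewrite /vertex !act_degen !degen0.
pose g : pi0 (sFun A K) -> pi0 (sFun B K) := qlift (fun u => cls (E u)).
have gE (u : sFun A K 0) : g (cls u) = cls (E u).
  by apply: qliftE => a b ab; apply/qpi_step/extend_edge; rewrite !hE.
exists g; elim/quot_ind => u.
- by rewrite pi0_precompE gE; apply/qpi_step/extend_edge; rewrite hE; apply: edge_refl.
- by rewrite gE pi0_precompE hE.
Qed.

(** * Levelwise contractible simplicial spaces *)

Section DiagContract.
Variables (X : sspace) (Y : sSet).
Variable ctr : forall l, contraction (X l) (Y l).
Hypothesis p_bact : forall m n (f : mono m n) k (x : X n k),
  ctr_p (ctr m) (bact X f k x) = act f (ctr_p (ctr n) x).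

Program Definition diag_proj : sMap (diag X) Y :=
  @SMap (diag X) Y (fun n x => ctr_p (ctr n) x) _.
Next Obligation. by move=> m n f x; rewrite /= p_bact ctr_p_act. Qed.

Definition cyl_bact m n (f : mono m n) k (z : mcyl (ctr n) k) : mcyl (ctr m) k :=
  match sval z with
  | inl a => mcyl_q (ctr m) (bact X f k a.1, a.2)
  | inr y => mcyl_r (X m) k (act f y)
  end.

Lemma cyl_bact_q m n (f : mono m n) k a :
  cyl_bact f (mcyl_q (ctr n) a) = mcyl_q (ctr m) (bact X f k a.1, a.2).
Proof.
rewrite {1}/mcyl_q; case: pselect => [e|//].
by rewrite /cyl_bact /= e mcyl_q1 p_bact.
Qed.

Program Definition cyl_bmap m n (f : mono m n) : sMap (mcyl (ctr n)) (mcyl (ctr m)) :=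
  @SMap (mcyl (ctr n)) (mcyl (ctr m)) (fun k => @cyl_bact m n f k) _.
Next Obligation.
move=> m n f k l g z; elim/(mcyl_ind (c := ctr n)): z => [a|//] /=.
by rewrite mcyl_act_q !cyl_bact_q mcyl_act_q sfun_act.
Qed.

Program Definition cyl_space : sspace :=
  @SSpace (fun l => mcyl (ctr l)) cyl_bmap _ _.
Next Obligation.
move=> n k z; elim/(mcyl_ind (c := ctr n)): z => [[x f]|y] /=; first by rewrite cyl_bact_q bact_id.
by rewrite /cyl_bact /= act_id.
Qed.
Next Obligation.
move=> p m n f g k z; elim/(mcyl_ind (c := ctr n)): z => [[x h]|y] /=.
  by rewrite !cyl_bact_q bact_comp.
by rewrite /cyl_bact /= act_comp.
Qed.

Program Definition cyl_front : ssub cyl_space :=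
  @SSub cyl_space (fun l => sub_im (mcyl_in (ctr l))) _.
Next Obligation.
move=> m n f k _ [x ->]; exists (bact X f k x) => /=; exact: cyl_bact_q.
Qed.

Program Definition cyl_incl : sMap (diag X) (diag cyl_space) :=
  @SMap (diag X) (diag cyl_space) (fun n x => mcyl_q (ctr n) (x, pt0 n)) _.
Next Obligation.
move=> m n f x; rewrite /= mcyl_act_q; symmetry; rewrite [LHS]cyl_bact_q.
by rewrite mcomp_mconst.
Qed.

Definition cyl_ret_fun l k (z : mcyl (ctr l) k) : Y l :=
  match sval z with inl a => ctr_p (ctr l) a.1 | inr y => y end.

Lemma cyl_ret_q l k a : cyl_ret_fun (mcyl_q (ctr l) a : mcyl (ctr l) k) = ctr_p (ctr l) a.1.
Proof. by rewrite /mcyl_q; case: pselect. Qed.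

Program Definition cyl_ret : sMap (diag cyl_space) Y :=
  @SMap (diag cyl_space) Y (fun n z => cyl_ret_fun z) _.
Next Obligation.
move=> m n f z; elim/(mcyl_ind (c := ctr n)): z => [a|y] //=.
by rewrite mcyl_act_q cyl_bact_q !cyl_ret_q p_bact ctr_p_act.
Qed.

Program Definition cyl_end : sMap Y (diag cyl_space) :=
  @SMap Y (diag cyl_space) (fun n y => mcyl_r (X n) n y) _.
Next Obligation. by []. Qed.

(** The connection [(f, g) |-> max (f, g)] of [Delta 1], which slides a mapping cylinder to
    its end [Y] while [Y] stays fixed. *)
Program Definition omax n (f g : mono n 1) : mono n 1 :=
  @Mono n 1 (fun i => if f i == ord0 then g i else f i) _.
Next Obligation.
move=> n f g i j ij; have h := mono_homo f ij; have h' := mono_homo g ij.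
have [e|e] := eqVneq (f i) ord0; have [e'|e'] := eqVneq (f j) ord0 => //.
- by move: e'; rewrite -val_eqE /=; have := ltn_ord (g i); lia.
- by move: e; rewrite -val_eqE /=; rewrite e' in h; move: h => /=; lia.
Qed.

Definition cyl_push_fun l k (z : mcyl (ctr l) k) (g : mono k 1) : mcyl (ctr l) k :=
  match sval z with inl a => mcyl_q (ctr l) (a.1, omax a.2 g) | inr y => z end.

Lemma omax1 n (g : mono n 1) : omax (pt1 n) g = pt1 n.
Proof. exact: mono_ext. Qed.

Lemma cyl_push_q l k a g : cyl_push_fun (mcyl_q (ctr l) a : mcyl (ctr l) k) g =
  mcyl_q (ctr l) (a.1, omax a.2 g).
Proof.
by rewrite {1}/mcyl_q; case: pselect => // e; rewrite e omax1 mcyl_q1.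
Qed.

Program Definition cyl_push : sMap (sProd (diag cyl_space) (Delta 1)) (diag cyl_space) :=
  @SMap (sProd (diag cyl_space) (Delta 1)) (diag cyl_space)
    (fun n x => cyl_push_fun x.1 x.2) _.
Next Obligation.
move=> m n f [z g]; elim/(mcyl_ind (c := ctr n)): z => [a|y] //=.
rewrite mcyl_act_q cyl_bact_q !cyl_push_q mcyl_act_q cyl_bact_q /=.
by congr (mcyl_q _ (_, _)); apply: mono_ext.
Qed.

(** Through the diagonal of the levelwise mapping cylinders: the inclusion of [diag X] is
    anodyne, and the cylinders deform to [Y]. *)
Lemma kan_equivalence_diag : kan_equivalence diag_proj.
Proof.
have -> : diag_proj = sMap_comp cyl_ret cyl_incl.
  by apply: sMap_ext => n x; rewrite sMap_compE /= cyl_ret_q.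
apply: kan_equivalence_comp.
  apply: (kan_equivalence_htpy (j := cyl_end) (F := cyl_push)) => //.
    move=> n z; elim/(mcyl_ind (c := ctr n)): z => [[x f]|y] //=; rewrite cyl_push_q /=.
    congr (mcyl_q _ (_, _)); apply: mono_eqP => i /=; case: eqP => [->|] //.
  move=> n z; elim/(mcyl_ind (c := ctr n)): z => [[x f]|y] //=; rewrite cyl_push_q cyl_ret_q /=.
  rewrite -mcyl_q1; congr (mcyl_q _ (_, _)); apply: mono_eqP => i /=.
  by case: eqP => // /eqP; rewrite -val_eqE /=; have := ltn_ord (f i); lia.
apply: kan_equivalence_anodyne => [n z|n x y|K hK].
- case: (sval z) => [a|y]; [exact: a.1|exact: (degen n (ctr_t (ctr n) y))].
- have E (a : X n n) : sval (mcyl_q (ctr n) (a, pt0 n)) = inl (a, pt0 n).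
    by rewrite /mcyl_q; case: pselect => // /(mono_val ord0).
  by move=> /(congr1 sval); rewrite !E; case.
have h l : anodyne K (cyl_front l) (subT _).
  exact (@anodyne_mcyl (X l) (Y l) (ctr l) K hK).
exact: anodyne_eq (anodyne_diag hK h).
Qed.

End DiagContract.

(** * The Eilenberg-Zilber lemma *)

Section EZ.
Variable S : sSet.

Definition nondeg n (s : S n) : Prop :=
  forall m (f : mono n m) (y : S m), s = act f y -> n <= m.

Definition ezT n : Type := {m : nat & (mono n m * S m)%type}.

Lemma ez_exists n (s : S n) : exists z : ezT n,
  [/\ surj (tagged z).1, nondeg (tagged z).2 & s = act (tagged z).1 (tagged z).2].
Proof.
pose P m := `[< exists (f : mono n m) (y : S m), s = act f y >].
have exP : exists m, P m.
  by exists n; apply/asboolP; exists (mid n), s; rewrite act_id.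
case: (ex_minnP exP) => m /asboolP [f [y e]] mmin.
exists (existT _ m (f, y)); split=> //=.
- apply: contrapT => /not_surj_factor [m' [d [f' [lt fE]]]].
  suff /mmin : P m' by rewrite leqNgt lt.
  by apply/asboolP; exists f', (act d y); rewrite e fE act_comp.
- move=> m' g y' ye; apply: mmin; apply/asboolP.
  by exists (mcomp g f), y'; rewrite act_comp -ye.
Qed.

(** Composing a section of [f] with [g] gives an endomorphism that carries [y'] to the
    nondegenerate [y], so it is onto, hence the identity.  So every section of [f] is a
    section of [g], and there is one through every point. *)
Lemma ez_map_uniq n m (f g : mono n m) (y y' : S m) :
  surj f -> nondeg y -> act f y = act g y' -> y = y' /\ f = g.
Proof.
move=> sf ny e.
have sec s : mcomp f s = mid m -> mcomp g s = mid m /\ y = y'.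
  move=> fs; have yE : y = act (mcomp g s) y' by rewrite act_comp -e -act_comp fs act_id.
  have [ss|/not_surj_factor [m' [d [g' [lt gE]]]]] := pselect (surj (mcomp g s)).
    by move: yE; rewrite (surj_endo ss) act_id.
  by have := ny m' g' (act d y'); rewrite -act_comp -gE leqNgt lt => /(_ yE).
have [s fs _] := mono_section ord0 sf; split; first by have [] := sec s fs.
apply: mono_ext => a; have [s' fs' sa] := mono_section a sf.
have [gs' _] := sec s' fs'.
by rewrite -{2}sa -[RHS](_ : mcomp g s' (f a) = _) // gs'.
Qed.

Lemma ez_uniq n m m' (f : mono n m) (g : mono n m') (y : S m) (y' : S m') :
  surj f -> surj g -> nondeg y -> nondeg y' -> act f y = act g y' ->
  existT (fun m => (mono n m * S m)%type) m (f, y) = existT _ m' (g, y').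
Proof.
move=> sf sg ny ny' e.
have le k k' (h : mono n k) (h' : mono n k') (z : S k) (z' : S k') :
    surj h -> nondeg z -> act h z = act h' z' -> k <= k'.
  move=> sh nz ez; have [s hs _] := mono_section ord0 sh.
  by apply: (nz k' (mcomp h' s) z'); rewrite act_comp -ez -act_comp hs act_id.
have mm' : m = m'.
  by apply/eqP; rewrite eqn_leq (le _ _ _ _ _ _ sf ny e) (le _ _ _ _ _ _ sg ny' (esym e)).
by subst m'; have [-> ->] := ez_map_uniq sf ny e.
Qed.

Definition ez n (s : S n) : ezT n := sval (cid (ez_exists s)).
Definition ezd n (s : S n) : nat := tag (ez s).
Definition ezf n (s : S n) : mono n (ezd s) := (tagged (ez s)).1.
Definition ezs n (s : S n) : S (ezd s) := (tagged (ez s)).2.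

Lemma ez_surj n (s : S n) : surj (ezf s).
Proof. by have [] := svalP (cid (ez_exists s)). Qed.

Lemma ez_nondeg n (s : S n) : nondeg (ezs s).
Proof. by have [] := svalP (cid (ez_exists s)). Qed.

Lemma ezK n (s : S n) : act (ezf s) (ezs s) = s.
Proof. by have [] := svalP (cid (ez_exists s)). Qed.

Lemma ez_act n m (f : mono n m) (y : S m) : surj f -> nondeg y ->
  ez (act f y) = existT _ m (f, y).
Proof.
move=> sf ny; rewrite -[LHS](_ : existT _ (ezd (act f y)) (ezf (act f y), ezs (act f y)) = _).
  by apply: ez_uniq => //; [exact: ez_surj|exact: ez_nondeg|exact: ezK].
by rewrite /ezf /ezs /ezd; case: (ez _) => ? [].
Qed.

(** * Beads *)

Variable l : nat.

(** The conditions on the sequence of vertex sets are imposed separately, by [ok_flags] and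
    [flanked]. *)
Definition bead : Type := {m : nat & (S m * ('I_l.+1 -> {set 'I_m.+1}))%type}.
Definition Bead m (s : S m) c : bead :=
  existT (fun m => (S m * ('I_l.+1 -> {set 'I_m.+1}))%type) m (s, c).

Definition ez_bead n (z : ezT n) (c : 'I_l.+1 -> {set 'I_n.+1}) : seq bead :=
  if tag z == 0 then [::] else [:: Bead (tagged z).2 (fun t => (tagged z).1 @: c t)].

(** The simplex is replaced by the nondegenerate simplex of which it is a degeneracy, and
    disappears if this one is a vertex, since such a bead is an identity. *)
Definition renorm (b : bead) : seq bead := ez_bead (ez (tagged b).1) (tagged b).2.

Lemma renormE n (s : S n) c : renorm (Bead s c) =
  if ezd s == 0 then [::] else [:: Bead (ezs s) (fun t => ezf s @: c t)].
Proof. by []. Qed.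

(** [act g z] has the same nondegenerate part as [z] as soon as [z] can be recovered from
    it.  This compares the pieces of a normal form before and after an arbitrary map of
    simplices. *)
Lemma renorm_htpy m n (z : S m) (g : mono n m) (h : mono m n) c :
  act (mcomp g h) z = z -> renorm (Bead z c) = renorm (Bead (act g z) (fun t => h @: c t)).
Proof.
move=> zE.
have e : act (mcomp (ezf z) (mcomp g h)) (ezs z) = act (ezf z) (ezs z).
  by rewrite act_comp ezK zE.
have [_ fE] := ez_map_uniq (@ez_surj _ z) (@ez_nondeg _ z) (esym e).
have sg : surj (mcomp (ezf z) g).
  by apply: (surj_comp_l (f := h)); rewrite -[mcomp _ _]fE; apply: ez_surj.
have -> : act g z = act (mcomp (ezf z) g) (ezs z) by rewrite act_comp ezK.
rewrite /renorm /= ez_act ?/ez_bead /=; [|exact: sg|exact: ez_nondeg].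
rewrite -/(ezd z); case: ifP => // _; congr [:: Bead _ _]; apply: funext => t.
by rewrite -imset_comp; apply: eq_imset => i /=; rewrite -/(ezf z) {1}fE.
Qed.

Lemma ezd_const n (v : S 0) : ezd (degen n v) = 0.
Proof.
by rewrite /ezd ez_act // => j; exists ord0; rewrite (ord1 j) ord1.
Qed.

End EZ.

(** * Normal forms of words *)

Section RoundDown.
Variables (m n : nat) (f : mono m n) (A : {set 'I_m.+1}) (p : 'I_m.+1).

(** The predicate for rounding down along [f]: [rdn v] is the greatest element of [A] with
    image at most [v], or [p] if there is none.  As a map to [A] it is a right inverse of
    [f] over the image of [A]. *)
Definition rdn_pred (v : 'I_n.+1) (a : 'I_m.+1) := ((a \in A) && (f a <= v)) || (a == p).

Definition rdn_fun (v : 'I_n.+1) : 'I_m.+1 := [arg max_(a > p | rdn_pred v a) (a : nat)].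

Lemma rdnP v : rdn_pred v (rdn_fun v) /\ forall a, rdn_pred v a -> a <= rdn_fun v.
Proof.
rewrite /rdn_fun; case: arg_maxnP => [|i hi h]; first by rewrite /rdn_pred eqxx orbT.
by split.
Qed.

Lemma rdn_homo (v w : 'I_n.+1) : v <= w -> rdn_fun v <= rdn_fun w.
Proof.
move=> vw; apply: (rdnP w).2; case/orP: (rdnP v).1 => [/andP[h1 h2]|h].
  by rewrite /rdn_pred h1 (leq_trans h2 vw).
by rewrite /rdn_pred h orbT.
Qed.

Definition rdn : mono n m := Mono rdn_homo.

Lemma rdn_in v : p \in A -> rdn v \in A.
Proof. by move=> pA; case/orP: (rdnP v).1 => [/andP[]//|/eqP /= ->]. Qed.

Lemma rdn_ge (v : 'I_n.+1) a : a \in A -> f a <= v -> a <= rdn v.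
Proof. by move=> aA fa; apply: (rdnP v).2; rewrite /rdn_pred aA fa. Qed.

Lemma rdn_p v : p <= rdn v.
Proof. by apply: (rdnP v).2; rewrite /rdn_pred eqxx orbT. Qed.

Lemma rdn_le v : f (rdn v) <= v \/ rdn v = p.
Proof. by case/orP: (rdnP v).1 => [/andP[]|/eqP]; [left|right]. Qed.

End RoundDown.

Section Normal.
Variables (S : sSet) (l : nat).
Notation Bd := (@Bead S l).

Definition seg n (X : {set 'I_n.+1}) (p q : 'I_n.+1) := X :&: [set v : 'I_n.+1 | p <= v <= q].

Lemma segP n (X : {set 'I_n.+1}) (p q v : 'I_n.+1) :
  (v \in seg X p q) = [&& v \in X, p <= v & v <= q].
Proof. by rewrite !inE. Qed.

(** A retraction of [n] onto the vertices in [seg X p q].  Acting with this idempotent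
    stands for passing to the face spanned by those vertices, without renumbering them. *)
Definition seg_rho n (X : {set 'I_n.+1}) (p q : 'I_n.+1) : mono n n :=
  rdn (mid n) (seg X p q) p.

Lemma seg_rho_fix n (X : {set 'I_n.+1}) (p q v : 'I_n.+1) :
  v \in seg X p q -> seg_rho X p q v = v.
Proof.
move=> vA; apply: val_inj; apply/eqP; rewrite eqn_leq.
rewrite [X in _ && X](_ : v <= seg_rho X p q v) ?andbT; last exact: rdn_ge.
have [//|->] := rdn_le (mid n) (seg X p q) p v.
by move: vA; rewrite segP => /and3P[].
Qed.

(** The bead between two consecutive elements [p] and [q] of the lowest set [X ord0]: the
    face spanned by the highest set, with the part of the flag between [p] and [q]. *)
Definition nf_piece n (s : S n) (X : 'I_l.+1 -> {set 'I_n.+1}) p q : seq (bead S l) :=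
  renorm (Bd (act (seg_rho (X ord_max) p q) s) (fun t => seg (X t) p q)).

Lemma nf_piece_eq n (s : S n) X X' p q : (forall t, seg (X t) p q = seg (X' t) p q) ->
  nf_piece s X p q = nf_piece s X' p q.
Proof.
move=> h; rewrite /nf_piece /seg_rho h; congr (renorm (Bd _ _)); exact: funext.
Qed.

Lemma imset_seg m n (f : mono m n) (X : {set 'I_m.+1}) p q :
  p \in X -> q \in X -> p <= q -> f @: seg X p q = seg (f @: X) (f p) (f q).
Proof.
move=> pX qX pq; apply/setP => v; rewrite segP; apply/imsetP/and3P.
  case=> a; rewrite segP => /and3P[aX pa aq] ->.
  by split; [apply: imset_f | apply: mono_homo | apply: mono_homo].
case=> /imsetP[a aX ->] fpa faq.
have [pa|ap] := leqP p a; last first.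
  exists p; first by rewrite segP pX leqnn pq.
  by apply/val_inj/eqP; rewrite eqn_leq fpa (mono_homo f (ltnW ap)).
have [aq|qa] := leqP a q; first by exists a; rewrite // segP aX pa aq.
exists q; first by rewrite segP qX leqnn pq.
by apply/val_inj/eqP; rewrite eqn_leq faq (mono_homo f (ltnW qa)).
Qed.

(** A monotone [f] may identify vertices of the segment.  Rounding down along [f] is an
    inverse of [f] up to the retractions, so that [renorm_htpy] applies. *)
Lemma nf_piece_nat m n (f : mono m n) (s : S n) (X : 'I_l.+1 -> {set 'I_m.+1}) p q :
  (forall t, p \in X t) -> (forall t, q \in X t) -> (forall t, X t \subset X ord_max) ->
  p <= q -> nf_piece (act f s) X p q = nf_piece s (fun t => f @: X t) (f p) (f q).
Proof.
move=> pX qX Xm pq; set A := seg (X ord_max) p q.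
have pA : p \in A by rewrite segP pX leqnn pq.
pose rA := seg_rho (X ord_max) p q; pose r' := seg_rho (f @: X ord_max) (f p) (f q).
have A'E : seg (f @: X ord_max) (f p) (f q) = f @: A by rewrite imset_seg.
pose g : mono n m := rdn f A p.
have gA v : g v \in A by apply: rdn_in.
have rA_in v : rA v \in A by apply: rdn_in.
have fg : mcomp f (mcomp rA g) = r'.
  apply: mono_eqP => v /=; rewrite -[rdn_fun f A p v]/(g v).
  rewrite [rdn_fun _ _ _ _](_ : _ = rA (g v)) // [rA _]seg_rho_fix //.
  apply/eqP; rewrite eqn_leq; apply/andP; split.
    have [h|->] := rdn_le f A p v; last exact: rdn_p.
    by apply: rdn_ge => //; rewrite A'E imset_f.
  have [h|h] := rdn_le (mid n) (seg (f @: X ord_max) (f p) (f q)) (f p) v.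
    have /imsetP[a aA ra] : r' v \in f @: A by rewrite -A'E rdn_in // A'E imset_f.
    rewrite [rdn_fun _ _ _ _]ra; apply: mono_homo; apply: rdn_ge => //.
    by rewrite -ra.
  by rewrite [rdn_fun _ _ _ _]h; apply: mono_homo; apply: rdn_p.
have r'f : mcomp r' (mcomp f rA) = mcomp f rA.
  apply: mono_ext => v; rewrite !mcompE seg_rho_fix // A'E; exact: imset_f.
rewrite /nf_piece -/rA -/r' (@renorm_htpy _ _ _ _ _ g (mcomp f rA)); last first.
  rewrite -!act_comp.
  rewrite (_ : mcomp f _ = mcomp (mcomp f (mcomp rA g)) (mcomp f rA)); last exact: mono_ext.
  by rewrite fg r'f.
rewrite -!act_comp (_ : mcomp f _ = r'); last by rewrite -fg; apply: mono_ext.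
congr (renorm (Bd _ _)); apply: funext => t; rewrite -imset_seg //.
apply: eq_in_imset => v; rewrite segP => /and3P[vX pv vq].
rewrite mcompE seg_rho_fix // segP pv vq (subsetP (Xm t)) //.
Qed.

Lemma nf_piece_same n (s : S n) (X : 'I_l.+1 -> {set 'I_n.+1}) p : nf_piece s X p p = [::].
Proof.
rewrite /nf_piece (_ : seg_rho _ _ _ = mconst n p).
  rewrite (_ : mconst n p = mcomp (mconst 0 p) (mconst n ord0)); last exact: mono_ext.
  by rewrite act_comp renormE; case: eqP => // -[]; apply: ezd_const.
apply: mono_ext => v /=.
case/orP: (rdnP (mid n) (seg (X ord_max) p p) p v).1 => [/andP[+ _]|/eqP //].
rewrite segP => /and3P[_ h1 h2].
by apply/val_inj/eqP; rewrite eqn_leq h1 h2.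
Qed.

Fixpoint nf_path n (s : S n) X p (L : seq 'I_n.+1) : seq (bead S l) :=
  if L is q :: L' then nf_piece s X p q ++ nf_path s X q L' else [::].

(** A simplex of a cube is cut at the elements of its lowest set. *)
Definition nf_chain n (s : S n) (X : 'I_l.+1 -> {set 'I_n.+1}) : seq (bead S l) :=
  if enum (X ord0) is p :: L then nf_path s X p L else [::].

Lemma nf_path_cat n (s : S n) X p L q L' :
  nf_path s X p (rcons L q ++ L') = nf_path s X p (rcons L q) ++ nf_path s X q L'.
Proof. by elim: L p => [|r L IH] p /=; rewrite ?cats0 // IH catA. Qed.

Lemma nf_path_eq n (s : S n) X X' p L : path (fun x y : 'I_n.+1 => x <= y) p L ->
  (forall a b : 'I_n.+1, a \in p :: L -> b \in p :: L -> a <= b ->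
     forall t, seg (X t) a b = seg (X' t) a b) ->
  nf_path s X p L = nf_path s X' p L.
Proof.
elim: L p => [//|q L IH] p /= /andP[pq qL] h; congr (_ ++ _).
  by apply: nf_piece_eq; apply: h => //; rewrite !inE eqxx ?orbT.
by apply: IH => // a b ha hb; apply: h; rewrite inE ?ha ?hb orbT.
Qed.

Lemma sorted_enum n (A : {set 'I_n.+1}) : sorted (fun x y : 'I_n.+1 => x < y) (enum A).
Proof.
rewrite {1}/enum_mem -enumT; apply: sorted_filter.
  by move=> x y z; apply: ltn_trans.
rewrite -[sorted _ _]/(sorted (relpre (@nat_of_ord n.+1) ltn) _) -sorted_map.
by rewrite val_enum_ord iota_ltn_sorted.
Qed.

Lemma enum_eq n (A : {set 'I_n.+1}) (L : seq 'I_n.+1) :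
  sorted (fun x y : 'I_n.+1 => x < y) L -> L =i A -> enum A = L.
Proof.
move=> hL LA; apply: (irr_sorted_eq (leT := fun x y : 'I_n.+1 => x < y)) => //.
- by move=> x y z; apply: ltn_trans.
- by move=> x; apply: ltnn.
- exact: sorted_enum.
- by move=> x; rewrite mem_enum LA.
Qed.

Lemma nf_path_undup n (s : S n) X p L : path (fun x y : 'I_n.+1 => x <= y) p L ->
  exists p' L', [/\ undup (p :: L) = p' :: L', p' = p & nf_path s X p L = nf_path s X p' L'] /\
    path (fun x y : 'I_n.+1 => x < y) p' L'.
Proof.
elim: L p => [|q L IH] p; first by exists p, [::].
case/andP=> pq qL; have [q' [L' [[e1 e2 e3] h]]] := IH q qL; subst q'.
have memE x : (x \in q :: L) = (x \in q :: L') by rewrite -e1 mem_undup.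
have [e|ne] := eqVneq p q.
  exists q, L'; rewrite -e1 -e3 e; split=> //; split=> //.
    by rewrite [LHS]/= inE eqxx.
  by rewrite /= nf_piece_same.
have lt : p < q by rewrite ltn_neqAle pq andbT.
have nin : p \notin q :: L.
  rewrite memE inE negb_or ne /=; apply/negP => pL.
  have := order_path_min (fun y x z : 'I_n.+1 => @ltn_trans y x z) h.
  by move/allP => /(_ p pL); rewrite ltnNge pq.
exists p, (q :: L'); split; last by rewrite /= lt.
split=> //; last by rewrite /= e3.
by rewrite -e1 [LHS]/= (negPf nin).
Qed.

Definition sub_flags n (X : 'I_l.+1 -> {set 'I_n.+1}) :=
  forall p q : 'I_l.+1, p <= q -> X p \subset X q.

(** Consecutive elements of the lowest set which get identified contribute the empty piece
    [nf_piece_same], so the cutting points may be enumerated with repetitions. *)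
Lemma nf_chain_nat m n (f : mono m n) (s : S n) (X : 'I_l.+1 -> {set 'I_m.+1}) :
  sub_flags X -> nf_chain (act f s) X = nf_chain s (fun t => f @: X t).
Proof.
move=> hX; rewrite /nf_chain.
have [e0|] := eqVneq (enum (X ord0)) [::].
  rewrite e0; suff -> : enum (f @: X ord0) = [::] by [].
  move/eqP: e0; rewrite -size_eq0 -cardE cards_eq0 => /eqP ->.
  by rewrite imset0 enum_set0.
have mem := fun x => mem_enum (X ord0) x.
have := sorted_enum (X ord0); case: (enum _) mem => [//|p L] mem hL _.
have sL : path (fun x y : 'I_m.+1 => x <= y) p L.
  by apply: sub_path hL => x y; apply: ltnW.
have step q M : path (fun x y : 'I_m.+1 => x <= y) q M -> {subset q :: M <= X ord0} ->
    nf_path (act f s) X q M = nf_path s (fun t => f @: X t) (f q) (map f M).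
  elim: M q => [//|r M IH] q /= /andP[qr rM] sub.
  have inX x : x \in [:: q, r & M] -> forall t, x \in X t.
    by move=> /sub h t; apply: (subsetP (hX ord0 t (leq0n _))).
  rewrite nf_piece_nat //; first (congr (_ ++ _); apply: IH => // x hx; apply: sub).
  - by rewrite inE hx orbT.
  - by apply: inX; rewrite inE eqxx.
  - by apply: inX; rewrite !inE eqxx orbT.
  - by move=> t; apply: hX; apply: leq_ord.
rewrite /= step //; last by move=> x; rewrite mem.
have sfL : path (fun x y : 'I_n.+1 => x <= y) (f p) (map f L).
  by rewrite path_map; apply: sub_path sL => x y; apply: mono_homo.
have [p' [L' [[e1 e2 ->] h]]] := nf_path_undup s (fun t => f @: X t) sfL.
rewrite (@enum_eq _ _ (p' :: L')) // => x.
rewrite -e1 mem_undup -map_cons; apply/mapP/imsetP => [[a ha ->]|[a ha ->]];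
  by exists a; rewrite // ?mem // -mem.
Qed.

Lemma nf_chain_id n (s : S n) (i : 'I_n.+1) : nf_chain s (fun _ => [set i]) = [::].
Proof. by rewrite /nf_chain enum_set1. Qed.

(** The point [j] where two composable chains meet lies in both lowest sets, so the union
    is cut at [j], and on either side only one of the two chains is visible. *)
Lemma nf_chain_comp n (s : S n) i j k (y : chain j k l) (x : chain i j l) :
  nf_chain s (chain_comp y x) = nf_chain s x ++ nf_chain s y.
Proof.
have xP t := and3P (cset_between x t); have yP t := and3P (cset_between y t).
have xle t v : v \in x t -> i <= v <= j.
  by case: (xP t) => _ _ /subsetP h /h; rewrite inE.
have yle t v : v \in y t -> j <= v <= k.
  by case: (yP t) => _ _ /subsetP h /h; rewrite inE.
have jx t : j \in x t by case: (xP t).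
have jy t : j \in y t by case: (yP t).
pose ltr n := fun a b : 'I_n.+1 => a < b.
have ltr_trans n' : transitive (@ltr n') by move=> ? ? ?; apply: ltn_trans.
have [L1 e1] : exists L1, enum (x ord0) = rcons L1 j.
  have := sorted_enum (x ord0); have := fun v => mem_enum (x ord0) v.
  case/lastP: (enum _) => [/(_ j)|L1 v mem sv]; first by rewrite jx.
  exists L1; congr rcons; apply/val_inj/eqP; rewrite eqn_leq.
  have := mem v; rewrite mem_rcons inE eqxx /= => /esym /xle /andP[_ ->] /=.
  have := mem j; rewrite jx mem_rcons inE => /orP[/eqP -> //|jL].
  move: sv; rewrite -[rcons _ _]revK rev_sorted rev_rcons /= => h.
  have := order_path_min (leT := fun a b : 'I_n.+1 => b < a) _ h.
  move=> /(_ (fun b a c ba cb => ltn_trans cb ba)) /allP /(_ j).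
  by rewrite mem_rev => /(_ jL) /ltnW.
have [L2 e2] : exists L2, enum (y ord0) = j :: L2.
  have := sorted_enum (y ord0); have := fun v => mem_enum (y ord0) v.
  case: (enum _) => [/(_ j)|v L2 mem sv]; first by rewrite jy.
  exists L2; congr cons; apply/val_inj/eqP; rewrite eqn_leq.
  have := mem v; rewrite inE eqxx /= => /esym /yle /andP[-> _]; rewrite andbT.
  have := mem j; rewrite jy inE => /orP[/eqP -> //|jL].
  by have := order_path_min (@ltr_trans n) sv => /allP /(_ j jL) /ltnW.
have s1 := sorted_enum (x ord0); have s2 := sorted_enum (y ord0).
rewrite e1 in s1; rewrite e2 in s2.
have e3 : enum (chain_comp y x ord0) = rcons L1 j ++ L2.
  apply: enum_eq.
    by case: L1 s1 {e1} => [//|a L1] /= s1; rewrite cat_path s1 last_rcons.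
  move=> v; rewrite /= inE -(mem_enum (x ord0)) -(mem_enum (y ord0)) e1 e2 mem_cat.
  rewrite mem_rcons !inE; by case: (v == j); rewrite /= ?orbT // orbC.
have ltW n' (p : 'I_n'.+1) L : path (@ltr n') p L -> path (fun a b : 'I_n'.+1 => a <= b) p L.
  by apply: sub_path => a b; apply: ltnW.
have Eq1 p L : {subset p :: L <= x ord0} -> path (@ltr n) p L ->
    nf_path s (chain_comp y x) p L = nf_path s x p L.
  move=> sub pL; apply: nf_path_eq; first exact: ltW.
  move=> a b /sub ha /sub hb ab t; apply/setP => v; rewrite !segP inE.
  case: (boolP (v \in x t)) => [_|vx]; first by rewrite orbT.
  rewrite orbF /=; apply/negbTE/negP => /and3P[vy av vb].
  have /andP[jv _] := yle _ _ vy; have /andP[_ bj] := xle _ _ hb.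
  by case/negP: vx; rewrite (_ : v = j) //; apply/val_inj/eqP; rewrite eqn_leq jv (leq_trans vb).
have Eq2 : nf_path s (chain_comp y x) j L2 = nf_path s y j L2.
  apply: nf_path_eq; first exact: ltW.
  rewrite -e2 => a b; rewrite !mem_enum => ha hb ab t; apply/setP => v; rewrite !segP inE.
  case: (boolP (v \in y t)) => [//|vy] /=.
  apply/negbTE/negP => /and3P[vx av vb].
  have /andP[_ vj] := xle _ _ vx; have /andP[ja _] := yle _ _ ha.
  by case/negP: vy; rewrite (_ : v = j) //; apply/val_inj/eqP; rewrite eqn_leq vj (leq_trans ja).
rewrite /nf_chain e3 e1 e2 /= -Eq2.
have sub : {subset rcons L1 j <= x ord0} by move=> v; rewrite -e1 mem_enum.
case: L1 s1 sub {e1 e3} => [//|a L1] /= s1 sub; rewrite nf_path_cat Eq1 //.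
Qed.

Fixpoint nf_word a b (w : word l a b) : seq (bead S l) :=
  match w with
  | Gen _ s _ _ x _ _ _ _ => nf_chain s (x : chain _ _ _)
  | Id _ => [::]
  | Comp _ _ _ v u => nf_word u ++ nf_word v
  end.

(** The list of beads is an invariant of the morphism that a word denotes. *)
Lemma nf_word_rel a b (w w' : word l a b) : word_rel w w' -> nf_word w = nf_word w'.
Proof.
elim=> {a b w w'} /=.
- move=> m n f s i j x a b _ _ _ _; apply: nf_chain_nat => p q; exact: cset_mono.
- by move=> n s i a _ _; apply: nf_chain_id.
- by move=> n s i j k y x a b c _ _ _; apply: nf_chain_comp.
- by move=> *; rewrite catA.
- by move=> *; rewrite cats0.
- by [].
- by move=> a b c v v' u _ ->.
- by move=> a b c v u u' _ ->.
Qed.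

Definition nf (a b : S 0) (y : mor l a b) : seq (bead S l) := qlift (@nf_word a b) y.

Lemma nfE (a b : S 0) (w : word l a b) : nf (qpi _ w) = nf_word w.
Proof. by apply: qliftE => u v; apply: nf_word_rel. Qed.

End Normal.

(** * Morphisms as composites of beads *)

Section Composite.
Variables (S : sSet) (l : nat).
Notation flags m := ('I_l.+1 -> {set 'I_m.+1}).

Definition ok_flags m (c : flags m) : Prop :=
  sub_flags c /\ forall t, (ord0 \in c t) && (ord_max \in c t).

(** The flags that occur in normal forms: nothing is left to cut, and no vertex is
    superfluous. *)
Definition flanked m (c : flags m) : Prop :=
  [/\ sub_flags c, c ord0 = [set ord0; ord_max] & c ord_max = setT].

Lemma flanked_ok m (c : flags m) : flanked c -> ok_flags c.
Proof.
case=> h h0 _; split=> // t; have /subsetP sub := h ord0 t (leq0n _).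
by rewrite !sub // h0 !inE eqxx ?orbT.
Qed.

Lemma between_full m (A : {set 'I_m.+1}) :
  ord0 \in A -> ord_max \in A -> between ord0 ord_max A.
Proof.
move=> h0 h1; rewrite /between h0 h1 /=; apply/subsetP => v _.
by rewrite inE /= leq_ord.
Qed.

(** The flags of a bead are unchecked data; with a default value every bead denotes a
    generator, so that [composes] is a recursion without side conditions. *)
Program Definition chain_of m (c : flags m) : chain (@ord0 m) ord_max l :=
  match pselect (ok_flags c) with
  | left h => @Chain m ord0 ord_max l c h.1 _
  | right _ => @Chain m ord0 ord_max l (fun _ => setT) (fun _ _ _ => subxx _) _
  end.
Next Obligation. by move=> m c b h e p; have /andP[] := h.2 p; apply: between_full. Qed.
Next Obligation. by move=> m c b h e p; apply: between_full; rewrite inE. Qed.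

Lemma chain_ofE m (c : flags m) t : ok_flags c -> chain_of c t = c t.
Proof. by rewrite /chain_of; case: pselect. Qed.

Notation dhom n i j := (shom (s := frakC_Delta n) i j l).

Lemma Gen_ext n (s : S n) (i j i' j' : frakC_Delta n) (x : chain i j l) (x' : chain i' j' l)
    a b (p : vertex s i = a) (q : vertex s j = b) (p' : vertex s i' = a)
    (q' : vertex s j' = b) :
  i = i' -> j = j' -> x =1 x' -> Gen (x : dhom n i j) p q = Gen (x' : dhom n i' j') p' q'.
Proof.
move=> ei ej xx; subst i' j'; have {}xx : x = x' by apply: chain_ext.
by subst x'; rewrite (Prop_irrelevance p p') (Prop_irrelevance q q').
Qed.

Notation fmor a b := (shom (s := frakC S) a b l).

(** A relation and not a function, since whether consecutive beads of an untyped list have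
    matching end points is a condition. *)
Fixpoint composes (L : seq (bead S l)) (a b : frakC S) : fmor a b -> Prop :=
  match L with
  | [::] => fun y => exists e : a = b, y = sid_to e l
  | z :: L' => fun y =>
      exists (p : vertex (tagged z).1 ord0 = a)
             (y' : fmor (vertex (tagged z).1 ord_max) b),
        composes L' y' /\
        y = scomp y' (qpi (@word_rel S l _ _)
              (Gen (chain_of (tagged z).2 : dhom _ _ _) p erefl) : fmor _ _)
  end.

Lemma composes_uniq L a b (y y' : fmor a b) : composes L y -> composes L y' -> y = y'.
Proof.
elim: L a b y y' => [|z L IH] a b y y' /=.
  by case=> e -> [e' ->]; rewrite (Prop_irrelevance e e').
case=> p [v [hv ->]] [p' [v' [hv' ->]]].
by rewrite (IH _ _ _ _ hv hv') (Prop_irrelevance p p').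
Qed.

Lemma composes_nil (a : frakC S) : composes [::] (sid a l).
Proof. by exists erefl. Qed.

Lemma composes_cat L L' (a b c : frakC S) (y : fmor b c) (x : fmor a b) :
  composes L x -> composes L' y -> composes (L ++ L') (scomp y x).
Proof.
elim: L a x => [|z L IH] a x /=.
  by case=> e ->; destruct e => hy; rewrite (_ : mor_comp y _ = y) //; apply: (scompx1 y).
case=> p [x' [hx ->]] hy; exists p, (scomp y x'); split; first exact: IH.
exact: (@scompA (frakC S)).
Qed.

Lemma composes_dim0 n (s : S n) (i j : frakC_Delta n) (x : shom i j l) a b
    (p : vertex s i = a) (q : vertex s j = b) :
  n = 0 -> composes [::] (qpi _ (Gen x p q) : fmor a b).
Proof.
move=> e; subst n; have ij : i = j by rewrite [i]ord1 [j]ord1.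
subst j; destruct p, q; exists erefl; have -> : x = sid i l.
  apply: chain_ext => t /=; apply/setP => v; rewrite in_set1.
  have -> : v = i by rewrite (ord1 v) (ord1 i).
  by rewrite eqxx; have /and3P[] := cset_between (x : chain i i l) t.
exact/qpi_step/rel_sid.
Qed.

Lemma Gen_nat m n (f : mono m n) (s : S n) (i j : 'I_m.+1) (x : chain i j l) a b
    (p : vertex (act f s) i = a) (q : vertex (act f s) j = b)
    (p' : vertex s (f i) = a) (q' : vertex s (f j) = b) :
  qpi (@word_rel S l a b) (Gen (x : dhom m i j) p q) =
  qpi _ (Gen (chain_map f x : dhom n (f i) (f j)) p' q').
Proof. exact/qpi_step/(rel_nat (x : dhom m i j)). Qed.

Definition good_mark (z : {m & flags m}) : Prop := 0 < tag z /\ flanked (tagged z).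

Definition good (z : bead S l) : Prop := nondeg (tagged z).1 /\
  good_mark (existT (fun m => flags m) (tag z) (tagged z).2).

Lemma seg_between n (i j : 'I_n.+1) (x : chain i j l) t : seg (x t) i j = x t.
Proof.
apply/setP => v; rewrite segP; case: (boolP (v \in x t)) => //= h.
by have /and3P[_ _ /subsetP /(_ v h)] := cset_between x t; rewrite inE.
Qed.

Lemma rho_ends n (i j : 'I_n.+1) (x : chain i j l) :
  seg_rho (x ord_max) i j i = i /\ seg_rho (x ord_max) i j j = j.
Proof.
have /and3P[iX jX /subsetP h] := cset_between x ord_max.
have := h _ jX; rewrite inE => /andP[ij _].
by split; apply: seg_rho_fix; rewrite segP ?iX ?jX leqnn ?ij.
Qed.

(** Three presentations of one generator: on [s], on its restriction along the retraction,
    and on the nondegenerate part of this restriction. *)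
Lemma composes_piece n (s : S n) (i j : 'I_n.+1) (x : chain i j l) a b
    (p : vertex s i = a) (q : vertex s j = b) : x ord0 = [set i; j] ->
  composes (nf_piece s x i j) (qpi _ (Gen (x : dhom n i j) p q) : fmor a b) /\
  (forall z, List.In z (nf_piece s x i j) -> good z).
Proof.
move=> x0; set rho := seg_rho (x ord_max) i j; have [ri rj] := rho_ends x.
rewrite -/rho in ri rj.
have /and3P[iX jX _] := cset_between x ord_max.
have rho_in v : rho v \in x ord_max.
  have h : i \in seg (x ord_max) i j by rewrite seg_between.
  by have := rdn_in (mid n) v h; rewrite -[rdn _ _ _]/rho segP => /and3P[].
have rho_id v : v \in x ord_max -> rho v = v.
  by move=> h; apply: seg_rho_fix; rewrite seg_between.
have xm t v : v \in x t -> v \in x ord_max.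
  by apply: (subsetP (cset_mono x (leq_ord t : t <= @ord_max l))).
set z := act rho s.
have p1 : vertex z i = a by rewrite vertex_act ri.
have q1 : vertex z j = b by rewrite vertex_act rj.
have p1' : vertex s (rho i) = a by rewrite ri.
have q1' : vertex s (rho j) = b by rewrite rj.
have e1 : qpi (@word_rel S l a b) (Gen (x : dhom n i j) p q) =
    qpi _ (Gen (x : dhom n i j) p1 q1).
  rewrite (Gen_nat x p1 q1 p1' q1'); congr qpi; apply: Gen_ext => // t /=.
  rewrite -[LHS]imset_id; apply: eq_in_imset => v hv /=.
  by rewrite -[rdn_fun _ _ _ _]/(rho v) rho_id //; apply: xm hv.
set sg := ezf z.
have p2 : vertex (act sg (ezs z)) i = a by rewrite ezK.
have q2 : vertex (act sg (ezs z)) j = b by rewrite ezK.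
have p3 : vertex (ezs z) (sg i) = a by rewrite -vertex_act.
have q3 : vertex (ezs z) (sg j) = b by rewrite -vertex_act.
have e2 : qpi (@word_rel S l a b) (Gen (x : dhom n i j) p q) =
    qpi _ (Gen (chain_map sg x : dhom (ezd z) (sg i) (sg j)) p3 q3).
  by rewrite e1 (Gen_eq _ p1 q1 p2 q2 (esym (ezK z))); apply: Gen_nat.
have sgr v : sg (rho v) = sg v.
  have e : act (mcomp sg rho) (ezs z) = act sg (ezs z).
    rewrite act_comp ezK /z -act_comp; congr act; apply: mono_ext => w.
    by rewrite mcompE rho_id.
  have [_ fE] := ez_map_uniq (@ez_surj _ _ z) (@ez_nondeg _ _ z) (esym e).
  by rewrite -[LHS]/(mcomp sg rho v) -fE.
have sg0 : sg i = ord0.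
  have [v hv] := @ez_surj _ _ z ord0; apply/val_inj/eqP; rewrite -leqn0.
  by rewrite -[X in _ <= X]/(nat_of_ord (@ord0 (ezd z))) -hv -/sg -(sgr v) mono_homo // rdn_p.
have sgm : sg j = ord_max.
  have [v hv] := @ez_surj _ _ z ord_max; apply/val_inj/eqP; rewrite eqn_leq leq_ord /=.
  rewrite -[X in X <= _]/(nat_of_ord (@ord_max (ezd z))) -hv -/sg -(sgr v) mono_homo //.
  by have := rho_in v; rewrite -(seg_between x) segP => /and3P[].
rewrite /nf_piece renormE -/rho -/z -/sg e2; case: eqP => h0.
  by split=> //; apply: composes_dim0.
have fl : flanked (fun t => sg @: seg (x t) i j).
  split=> [t t' tt'||]; rewrite ?seg_between.
  - by apply: imsetS; apply: cset_mono.
  - by rewrite x0 imsetU1 imset_set1 sg0 sgm.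
  - apply/setP => v; rewrite inE; have [w <-] := @ez_surj _ _ z v.
    by rewrite -/sg -sgr imset_f.
split; last by move=> b0 [<-|[]]; split; [exact: ez_nondeg|split=> //=; lia].
have p4 : vertex (ezs z) ord0 = a by rewrite -sg0.
have q4 : vertex (ezs z) ord_max = b by rewrite -sgm.
subst b; move: q3 {q1 q1' q2 e1 e2}; rewrite -q4 => q3.
exists p4, (sid (s := frakC S) _ l); split; first exact: composes_nil.
rewrite scomp1x; congr qpi; apply: Gen_ext => // t /=.
by rewrite chain_ofE ?seg_between //; apply: flanked_ok.
Qed.

Lemma enum_min n (A : {set 'I_n.+1}) (i : 'I_n.+1) : i \in A ->
  (forall v, v \in A -> i <= v) -> exists L, enum A = i :: L.
Proof.
move=> iA h; have := sorted_enum A; have := mem_enum A.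
case: (enum A) => [/(_ i)|v L mem sv]; first by rewrite iA.
exists L; congr cons; apply/val_inj/eqP; rewrite eqn_leq.
have := mem v; rewrite inE eqxx /= => /esym /h ->; rewrite andbT.
have := mem i; rewrite iA inE => /orP[/eqP -> //|jL].
have := order_path_min (leT := fun x y : 'I_n.+1 => x < y) _ sv.
by move=> /(_ (fun b a c => @ltn_trans b a c)) /allP /(_ i jL) /ltnW.
Qed.

Lemma lt_path_min n (k v : 'I_n.+1) L :
  path (fun v w : 'I_n.+1 => v < w) k L -> v \in L -> k < v.
Proof.
move=> sk h; have := order_path_min (leT := fun v w : 'I_n.+1 => v < w) _ sk.
by move=> /(_ (fun b a c => @ltn_trans b a c)) /allP /(_ _ h).
Qed.

(** Induction on the lowest set: the generator factors at its second smallest element. *)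
Lemma composes_Gen n (s : S n) (i j : 'I_n.+1) (x : chain i j l) a b
    (p : vertex s i = a) (q : vertex s j = b) :
  composes (nf_chain s x) (qpi _ (Gen (x : dhom n i j) p q) : fmor a b) /\
  (forall z, List.In z (nf_chain s x) -> good z).
Proof.
have xle i' (x' : chain i' j l) t v : v \in x' t -> i' <= v <= j.
  by have /and3P[_ _ /subsetP h] := cset_between x' t; move/h; rewrite inE.
have [L eL] : exists L, enum (x ord0) = i :: L.
  apply: enum_min => [|v /xle /andP[]//]; by have /and3P[] := cset_between x ord0.
rewrite /nf_chain eL /=; elim: L i x a p eL => [|k L IH] i x a p eL /=.
  split=> //.
  have ij : i = j.
    have : j \in enum (x ord0) by rewrite mem_enum; have /and3P[] := cset_between x ord0.
    by rewrite eL inE => /eqP.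
  subst j; destruct p, q; exists erefl.
  have -> : (x : dhom n i i) = sid (s := frakC_Delta n) i l.
    apply: chain_ext => t /=; apply/setP => v; rewrite in_set1.
    apply/idP/eqP => [/xle|->]; last by have /and3P[] := cset_between x t.
    by case/andP=> h1 h2; apply/val_inj/eqP; rewrite eqn_leq h1 h2.
  exact/qpi_step/(@rel_sid S l n s i).
have sL : path (fun v w : 'I_n.+1 => v < w) i (k :: L).
  by have := sorted_enum (x ord0); rewrite eL.
have /andP[ik sk] := sL.
have kx t : k \in x t.
  apply: (subsetP (cset_mono x (leq0n t : @ord0 l <= t))).
  by rewrite -mem_enum eL !inE eqxx orbT.
have ix t : i \in x t by have /and3P[] := cset_between x t.
have jx t : j \in x t by have /and3P[] := cset_between x t.
have kj : k <= j by have /andP[] := xle _ x ord0 k (kx _).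
have mk (u v : 'I_n.+1) (uv : u <= v) : (forall t, u \in x t) -> (forall t, v \in x t) ->
    exists y : chain u v l, forall t, y t = seg (x t) u v.
  move=> ux vx.
  have m1 (t t' : 'I_l.+1) : t <= t' -> seg (x t) u v \subset seg (x t') u v.
    by move=> tt'; apply: setSI; apply: cset_mono.
  have m2 t : between u v (seg (x t) u v).
    rewrite /between !segP ux vx leqnn uv leqnn /=; apply/subsetP => w.
    by rewrite segP inE => /and3P[_ -> ->].
  by exists (Chain m1 m2).
have [x1 x1E] := mk i k (ltnW ik) ix kx; have [x2 x2E] := mk k j kj kx jx.
have xE : x = chain_comp x2 x1.
  apply: chain_ext => t /=; apply/setP => v; rewrite inE x1E x2E !segP.
  case: (boolP (v \in x t)) => //= /xle /andP[-> ->]; rewrite !andbT /=.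
  by case: (leqP k v) => // /ltnW.
have eL2 : enum (x2 ord0) = k :: L.
  apply: enum_eq => // v; rewrite x2E segP.
  have vE : (v \in x ord0) = (v \in i :: k :: L) by rewrite -eL mem_enum.
  rewrite vE [in RHS]inE; case: (eqVneq v i) => [->|_] /=.
    rewrite [k <= i]leqNgt ik /=; apply/negP => h.
    by have := lt_path_min sL h; rewrite ltnn.
  case: (boolP (v \in k :: L)) => //= h; symmetry.
  have /andP[_ ->] : i <= v <= j by apply: (xle i x ord0 v); rewrite vE inE h orbT.
  move: h; rewrite andbT inE => /orP[/eqP ->|h]; first exact: leqnn.
  by have /ltnW := lt_path_min sk h.
have x10 : x1 ord0 = [set i; k].
  apply/setP => v; rewrite x1E segP !inE.
  apply/and3P/orP => [[vx iv vk]|[/eqP ->|/eqP ->]]; last 2 first.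
  - by split=> //; apply: ltnW.
  - by split=> //; apply: ltnW.
  have : v \in enum (x ord0) by rewrite mem_enum.
  rewrite eL !inE => /or3P[->|->|h]; [by left|by right|].
  by have := lt_path_min sk h; rewrite ltnNge vk.
have [h1 g1] := composes_piece (x := x1) p (erefl (vertex s k)) x10.
have [h2 g2] := IH k x2 _ (erefl (vertex s k)) eL2.
have nb1 : nf_piece s x i k = nf_piece s x1 i k.
  by apply: nf_piece_eq => t; rewrite x1E; apply/setP => v; rewrite !segP; lia.
have nf2 : nf_path s x k L = nf_path s x2 k L.
  apply: nf_path_eq; first by apply: sub_path sk => v w; apply: ltnW.
  move=> u v; rewrite -eL2 !mem_enum => hu hv uv t; apply/setP => w.
  rewrite x2E !segP; have := xle _ _ _ _ hu; have := xle _ _ _ _ hv; lia.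
rewrite nb1 nf2; split; last by move=> z /List.in_app_iff [/g1|/g2].
have -> : qpi (@word_rel S l a b) (Gen (x : dhom n i j) p q) =
    scomp (s := frakC S) (qpi _ (Gen (x2 : dhom n k j) erefl q) : fmor _ _)
       (qpi _ (Gen (x1 : dhom n i k) p erefl) : fmor _ _).
  rewrite /= mor_compE xE; apply: qpi_step.
  exact: (rel_scomp (x2 : dhom n k j)).
exact: composes_cat.
Qed.

Lemma composes_word a b (w : word l a b) :
  composes (nf_word w) (qpi _ w : fmor a b) /\ (forall z, List.In z (nf_word w) -> good z).
Proof.
elim: w => {a b} [n s i j x a b p q|a|a b c v [hv gv] u [hu gu]] /=.
- exact: composes_Gen.
- by split=> //; apply: composes_nil.
- split; last by move=> z /List.in_app_iff [/gu|/gv].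
  by have := composes_cat hu hv; rewrite /= mor_compE.
Qed.

(** With [composes_uniq], a morphism is determined by its normal form. *)
Lemma composes_nf (a b : frakC S) (y : fmor a b) :
  composes (nf y) y /\ (forall z, List.In z (nf y) -> good z).
Proof. by elim/quot_ind: y => w; rewrite nfE; apply: composes_word. Qed.

Lemma nf_sid (a b : frakC S) (e : a = b) : nf (sid_to e l : fmor a b) = [::].
Proof. by destruct e; rewrite /= nfE. Qed.

Lemma nf_scomp (a b c : frakC S) (y : fmor b c) (x : fmor a b) :
  nf (scomp y x : fmor a c) = nf x ++ nf y.
Proof.
by elim/quot_ind: y => y; elim/quot_ind: x => x; rewrite /= mor_compE !nfE.
Qed.

Lemma nf_flanked m (s : S m) (c : flags m) a b (p : vertex s ord0 = a)
    (q : vertex s ord_max = b) : 0 < m -> flanked c ->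
  nf (qpi _ (Gen (chain_of c : dhom m _ _) p q)) = renorm (Bead s c).
Proof.
move=> m0 fc; rewrite nfE /= /nf_chain.
have cE : (chain_of c : _ -> _) = c by apply: funext => t; apply: chain_ofE; apply: flanked_ok.
rewrite cE; case: fc => [_ c0 cm].
rewrite (@enum_eq _ _ [:: ord0; ord_max]) /=; last first.
- by move=> v; rewrite c0 !inE.
- by rewrite m0.
rewrite cats0 /nf_piece; have segE X : seg X ord0 ord_max = X :> {set 'I_m.+1}.
  by apply/setP => v; rewrite segP /= leq_ord andbT.
congr (renorm (Bead _ _)); last by apply: funext => t; rewrite segE.
rewrite (_ : seg_rho _ _ _ = mid m) ?act_id //; apply: mono_ext => v.
by rewrite seg_rho_fix // segE cm inE.
Qed.

(** Flanked beads need no cutting, so the normal form of their composite is computed bead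
    by bead. *)
Lemma nf_composes L (a b : frakC S) (y : fmor a b) : composes L y ->
  (forall z, List.In z L -> good_mark (existT (fun m => flags m) (tag z) (tagged z).2)) ->
  nf y = flatten (map (@renorm S l) L).
Proof.
elim: L a b y => [|[m [s c]] L IH] a b y.
  by case=> e -> _; apply: nf_sid.
case=> /= p [y' [hy' ->]] h; rewrite nf_scomp (IH _ _ _ hy'); last first.
  by move=> z hz; apply: h; right.
have [m0 fc] := h _ (or_introl erefl).
by rewrite nf_flanked.
Qed.

End Composite.

(** * Necklaces of beads *)

(** The generating simplex of a necklace with one bead. *)
Definition idneck m : neck [:: m] m := Delta_to_neck m m (mid m).

Lemma neck1_lt m k (x : neck [:: m] k) i : nval x i < m.+1.
Proof. by have := in_neck_le i (nval_in x); rewrite /= addn0 ltnS. Qed.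

Definition neck1 m k (x : neck [:: m] k) : mono k m :=
  @Mono k m (fun i => Ordinal (neck1_lt x i)) (@nval_homo _ _ x).

Lemma neck1K m k (x : neck [:: m] k) : act (neck1 x) (idneck m) = x.
Proof. exact: neck_simp_ext. Qed.

Lemma neck1_id m : neck1 (idneck m) = mid m.
Proof. exact: mono_eqP. Qed.

Lemma idneck_alpha m : vertex (idneck m) ord0 = alpha [:: m].
Proof. exact: neck_simp_ext. Qed.

Lemma idneck_omega m : vertex (idneck m) ord_max = omega [:: m].
Proof. by apply: neck_simp_ext => i /=; rewrite addn0. Qed.

Program Definition bead_map (S : sSet) m (s : S m) : sMap (neck [:: m]) S :=
  @SMap (neck [:: m]) S (fun k x => act (neck1 x) s) _.
Next Obligation. by move=> S m s k n f x; rewrite /= -act_comp; congr act; apply: mono_eqP. Qed.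

Lemma bead_map_id (S : sSet) m (s : S m) : bead_map s m (idneck m) = s.
Proof. by rewrite /= neck1_id act_id. Qed.

Lemma frakC_map_to_Gen (X Y : sSet) (f : sMap X Y) l n (s : X n) (i j : frakC_Delta n)
    (x : shom i j l) (a b : X 0) (a' b' : Y 0) (pa : vertex s i = a) (qa : vertex s j = b)
    (p : f _ a = a') (q : f _ b = b') (p' : vertex (f _ s) i = a')
    (q' : vertex (f _ s) j = b') :
  frakC_map_to f p q l (qpi _ (Gen x pa qa)) = qpi _ (Gen x p' q').
Proof.
destruct p, q; rewrite /= mor_mapE /=; congr (qpi _ (Gen _ _ _)); exact: Prop_irrelevance.
Qed.

Section Marks.
Variable l : nat.

Definition mark : Type := {m : nat & 'I_l.+1 -> {set 'I_m.+1}}.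
Definition tags (r : seq mark) : seq nat := map (fun z => tag z) r.

Definition xbead m (c : 'I_l.+1 -> {set 'I_m.+1}) :
    shom (s := frakC (neck [:: m])) (alpha _) (omega _) l :=
  qpi _ (Gen (chain_of c : shom (s := frakC_Delta m) _ _ l) (idneck_alpha m) (idneck_omega m)).

(** The composite of the flags on the beads of the necklace [tags r]. *)
Fixpoint xof (r : seq mark) :
    shom (s := frakC (neck (tags r))) (alpha _) (omega _) l :=
  match r with
  | [::] => sid_to alpha_omega0 l
  | z :: r' => @wedge_scomp [:: tag z] (tags r') l (xof r') (xbead (tagged z))
  end.

Section Beads.
Variable S : sSet.

Definition headm m T (g : sMap (neck (m :: T)) S) : S m :=
  g _ (wedgel [:: m] T m (idneck m)).
Definition tailm m T (g : sMap (neck (m :: T)) S) : sMap (neck T) S :=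
  sMap_comp g (wedger [:: m] T).

Fixpoint beads (r : seq mark) : sMap (neck (tags r)) S -> seq (bead S l) :=
  match r with
  | [::] => fun _ => [::]
  | z :: r' => fun g => Bead (headm (g : sMap (neck (tag z :: tags r')) S)) (tagged z)
                        :: beads (tailm (g : sMap (neck (tag z :: tags r')) S))
  end.

Definition marks (L : seq (bead S l)) : seq mark :=
  map (fun z : bead S l => existT (fun m => 'I_l.+1 -> {set 'I_m.+1}) (tag z) (tagged z).2) L.

Lemma head_wedgel m T (g : sMap (neck (m :: T)) S) k (x : neck [:: m] k) :
  g _ (wedgel [:: m] T k x) = act (neck1 x) (headm g).
Proof. by rewrite /headm -sfun_act -[in RHS]sfun_act; congr (sfun g _); apply: neck_simp_ext. Qed.

Lemma head_alpha m T (g : sMap (neck (m :: T)) S) :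
  vertex (headm g) ord0 = g _ (alpha (m :: T)).
Proof. by rewrite /headm -sfun_vertex; congr (sfun g _); apply: neck_simp_ext. Qed.

Lemma head_omega m T (g : sMap (neck (m :: T)) S) :
  vertex (headm g) ord_max = tailm g _ (alpha T).
Proof.
rewrite /headm -sfun_vertex; congr (sfun g _); apply: neck_simp_ext => i /=.
by rewrite !addn0.
Qed.

Lemma tail_omega m T (g : sMap (neck (m :: T)) S) :
  tailm g _ (omega T) = g _ (omega (m :: T)).
Proof.
by rewrite /tailm sMap_compE; congr (sfun g _); apply: neck_simp_ext => i /=; rewrite addn0.
Qed.

Lemma composes_xof (r : seq mark) (g : sMap (neck (tags r)) S) (a b : frakC S)
    (p : g _ (alpha _) = a) (q : g _ (omega _) = b) :
  composes (beads g) (frakC_map_to g p q l (xof r)).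
Proof.
elim: r g a b p q => [|[m c] r IH] g a b p q.
  have e : a = b by rewrite -p -q alpha_omega0.
  by exists e; apply: (frakC_map_to_sid_to).
set gg := (g : sMap (neck (m :: tags r)) S).
have pw : gg _ (wedgel [:: m] (tags r) _ (omega [:: m])) = vertex (headm gg) ord_max.
  rewrite /headm -sfun_vertex; congr (sfun gg _); apply: neck_simp_ext => i /=.
  by rewrite addn0.
have p1 : vertex (headm gg) ord0 = a by rewrite head_alpha -p.
have p2 : tailm gg _ (alpha (tags r)) = vertex (headm gg) ord_max by rewrite head_omega.
have q2 : tailm gg _ (omega (tags r)) = b by rewrite tail_omega -q.
exists p1, (frakC_map_to (tailm gg) p2 q2 l (xof r)); split; first exact: IH.
have p3 : sMap_comp gg (wedgel [:: m] (tags r)) _ (alpha _) = a.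
  by rewrite sMap_compE wedgel_alpha.
apply: (etrans (frakC_map_to_comp (f := gg) p pw q _ _)); congr (mor_comp _ _).
  exact: (frakC_map_to_compmap _ _ _ _ p2 q2).
apply: (etrans (frakC_map_to_compmap (h := sMap_comp gg (wedgel [:: m] (tags r)))
  _ _ _ _ p3 pw _ _)) => //.
exact: frakC_map_to_Gen.
Qed.

(** Beads with a composite have matching end points, so they glue. *)
Lemma realize (L : seq (bead S l)) (a b : frakC S) (y : shom a b l) : composes L y ->
  exists g : sMap (neck (tags (marks L))) S,
    [/\ g _ (alpha _) = a, g _ (omega _) = b & beads g = L].
Proof.
elim: L a y => [|[m [s c]] L IH] a y.
  case=> e _; exists (@SMap (neck [::]) S (fun n _ => degen n a)
    (fun _ _ f _ => esym (act_degen f a))); split=> //=; rewrite ?degen0 //.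
case=> /= p [y' [/IH [g1 [g1a g1o g1L]] _]].
have e : bead_map s _ (omega [:: m]) = g1 _ (alpha (tags (marks L))).
  by rewrite g1a -idneck_omega sfun_vertex bead_map_id.
pose g : sMap (neck (m :: tags (marks L))) S := glue e.
have hg : headm g = s by exact: (etrans (glue_wedgel e (idneck m)) (bead_map_id s)).
have tg : tailm g = g1 by apply: sMap_ext => n x; rewrite /tailm sMap_compE /g glue_wedger.
exists g; split.
- by rewrite -head_alpha hg.
- by rewrite -tail_omega tg.
- by rewrite -[LHS]/(Bead (headm g) c :: beads (tailm g)) hg tg g1L.
Qed.

End Beads.
End Marks.

(** * Existence of maps to the normal form *)

Lemma existT_inj (A : Type) (P : A -> Type) (a : A) (x y : P a) :
  existT P a x = existT P a y -> x = y.
Proof. by move=> e; have := projT2_eq e; rewrite (Prop_irrelevance (projT1_eq e) erefl). Qed.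

Lemma ezd0_act (S : sSet) n (s : S n) : ezd s = 0 ->
  forall k (f : mono k n) i, act f s = degen k (vertex s i).
Proof.
move=> s0 k f i; rewrite -(ezK s) vertex_act /degen /vertex -!act_comp.
congr act; apply: mono_eqP => j /=.
by have := ltn_ord (ezf s (f j)); have := ltn_ord (ezf s i); lia.
Qed.

Lemma ezd0_vertex (S : sSet) n (s : S n) i j : ezd s = 0 -> vertex s i = vertex s j.
Proof. by move=> s0; rewrite {1}/vertex (ezd0_act s0 _ j) degen0. Qed.

Lemma surj_end0 m n (f : mono m n) : surj f -> f ord0 = ord0.
Proof.
move=> sf; have [v hv] := sf ord0; apply/val_inj/eqP; rewrite -leqn0.
by have := mono_homo f (leq0n v : @ord0 m <= v); rewrite hv.
Qed.

Lemma surj_end1 m n (f : mono m n) : surj f -> f ord_max = ord_max.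
Proof.
move=> sf; have [v hv] := sf ord_max; apply/val_inj/eqP; rewrite eqn_leq leq_ord /=.
by have := mono_homo f (leq_ord v : v <= @ord_max m); rewrite hv.
Qed.

(** The two building blocks for maps to a normal form: a bead of vanishing nondegenerate
    dimension goes to a point, and any other bead is stretched along its Eilenberg-Zilber
    surjection ([stretch]). *)
Program Definition collapse m : nec_hom [:: m] [::] :=
  @NecHom [:: m] [::] (@SMap (neck [:: m]) (neck [::]) (fun k _ => degen k (alpha [::])) _) _ _.
Next Obligation. by move=> m k n f x; rewrite act_degen. Qed.
Next Obligation. by move=> m; apply: neck_simp_ext. Qed.
Next Obligation. by move=> m; apply: neck_simp_ext. Qed.

Program Definition stretch m n (f : mono m n) (sf : surj f) : nec_hom [:: m] [:: n] :=
  @NecHom [:: m] [:: n] (bead_map (Delta_to_neck n m f)) _ _.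
Next Obligation.
move=> m n f sf; apply: neck_simp_ext => i /=; rewrite -[RHS]/(nat_of_ord (@ord0 n)).
by rewrite -(surj_end0 sf); congr (nat_of_ord (f _)); apply: val_inj.
Qed.
Next Obligation.
move=> m n f sf; apply: neck_simp_ext => i /=; rewrite [RHS]addn0 -[RHS]/(nat_of_ord (@ord_max n)).
by rewrite -(surj_end1 sf); congr (nat_of_ord (f _)); apply: val_inj; rewrite /= addn0.
Qed.

Lemma stretch_neck1 m n (f : mono m n) (sf : surj f) k (x : neck [:: m] k) :
  neck1 (stretch sf k x) = mcomp f (neck1 x).
Proof. exact: mono_eqP. Qed.

Section Lift.
Variable l : nat.
Notation mark := (mark l).

Lemma collapse_xbead m (c : 'I_l.+1 -> {set 'I_m.+1}) :
  frakC_map_to (collapse m) (nec_alpha _) (nec_omega _) l (xbead c) = sid_to alpha_omega0 l.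
Proof.
have va i : vertex (alpha [::]) i = alpha [::] by apply: neck_simp_ext.
have vo i : vertex (alpha [::]) i = omega [::] by rewrite va alpha_omega0.
have p1 : vertex (act (mconst m ord0) (alpha [::])) ord0 = alpha [::] by rewrite vertex_act va.
have q1 : vertex (act (mconst m ord0) (alpha [::])) ord_max = omega [::] by rewrite vertex_act vo.
apply: (etrans (frakC_map_to_Gen (f := collapse m) (s := idneck m) _ _ _ _ _ p1 q1)).
rewrite (Gen_nat (chain_of c) p1 q1 (va _) (vo _)).
have [e ->] := composes_dim0 (chain_map (mconst m ord0) (chain_of c)) (va _) (vo _) (erefl 0).
by rewrite (Prop_irrelevance e alpha_omega0).
Qed.

Lemma stretch_xbead m n (f : mono m n) (sf : surj f) (c : 'I_l.+1 -> {set 'I_m.+1}) :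
  ok_flags c ->
  frakC_map_to (stretch sf) (nec_alpha _) (nec_omega _) l (xbead c) =
  xbead (fun t => f @: c t).
Proof.
move=> okc; have okc' : ok_flags (fun t => f @: c t).
  case: okc => h h'; split=> [p q pq|t]; first by apply: imsetS; apply: h.
  have /andP[h0 h1] := h' t.
  by rewrite -(surj_end0 sf) -(surj_end1 sf) !imset_f.
have p0 : vertex (act f (idneck n)) ord0 = alpha [:: n].
  by rewrite vertex_act (surj_end0 sf) idneck_alpha.
have q0 : vertex (act f (idneck n)) ord_max = omega [:: n].
  by rewrite vertex_act (surj_end1 sf) idneck_omega.
have sE : stretch sf m (idneck m) = act f (idneck n).
  by apply: neck_simp_ext => i /=; congr (nat_of_ord (f _)); apply: val_inj.
have p1 : vertex (stretch sf m (idneck m)) ord0 = alpha [:: n] by rewrite sE.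
have q1 : vertex (stretch sf m (idneck m)) ord_max = omega [:: n] by rewrite sE.
apply: (etrans (frakC_map_to_Gen (f := stretch sf) (s := idneck m) _ _ _ _ _ p1 q1)).
rewrite (Gen_eq _ p1 q1 p0 q0 sE).
have p2 : vertex (idneck n) (f ord0) = alpha [:: n] by rewrite -vertex_act.
have q2 : vertex (idneck n) (f ord_max) = omega [:: n] by rewrite -vertex_act.
rewrite (Gen_nat (chain_of c) p0 q0 p2 q2); congr qpi; apply: Gen_ext.
- exact: surj_end0.
- exact: surj_end1.
- by move=> t; rewrite /= !chain_ofE.
Qed.

Lemma wedge_scomp_id T n x : wedge_scomp x (sid_to alpha_omega0 n) =
  (x : shom (s := frakC (neck T)) (alpha T) (omega T) n).
Proof.
have := @wedge_scomp1x T n x (sMap_id (neck T)) erefl erefl (fun _ _ _ => erefl).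
by rewrite frakC_map_to_idmap.
Qed.

(** A necklace over [S] with flags maps to the necklace of its normalized beads, bead by
    bead. *)
Lemma lift_exists (S : sSet) (r : seq mark) (g : sMap (neck (tags r)) S)
    (L : seq (bead S l)) (g' : sMap (neck (tags (marks L))) S) :
  (forall z, List.In z r -> ok_flags (tagged z)) ->
  L = flatten (map (@renorm S l) (beads g)) -> beads g' = L ->
  g' _ (alpha _) = g _ (alpha _) ->
  exists h : nec_hom (tags r) (tags (marks L)),
    (forall k z, g' k (h k z) = g k z) /\
    frakC_map_to h (nec_alpha h) (nec_omega h) l (xof r) = xof (marks L).
Proof.
elim: r g L g' => [|[m c] r IH] g L g' okr eL eg ga.
  subst L; exists (nec_id [::]); split; last exact: frakC_map_to_idmap.
  move=> k z; have -> : z = degen k (alpha [::]).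
    by apply: neck_simp_ext => i; have /forallP /(_ i) /eqP := nval_in z.
  by rewrite -[nec_id _ _ _]/(degen k (alpha [::])) !sfun_degen ga.
set gg := (g : sMap (neck (m :: tags r)) S).
have okr' z : List.In z r -> ok_flags (tagged z) by move=> h; apply: okr; right.
have okc : ok_flags c by apply: (okr _ (or_introl erefl)).
move: eL; rewrite -[beads g]/(Bead (headm gg) c :: beads (tailm gg)) map_cons.
rewrite -[flatten _]/(renorm (Bead (headm gg) c) ++ flatten (map (@renorm S l) (beads (tailm gg)))).
rewrite renormE; case: eqP => h0 eL.
  have ga1 : g' _ (alpha _) = tailm gg _ (alpha _).
    by rewrite -head_omega (ezd0_vertex ord_max ord0 h0) head_alpha.
  have [h1 [hg hx]] := IH (tailm gg) L g' okr' eL eg ga1.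
  exists (wedge_hom (collapse m) h1 : nec_hom (m :: tags r) (tags (marks L))); split.
    move=> k z; case: (@wedgeP [:: m] (tags r) k z) => [[x ->]|[x ->]].
      rewrite (wedge_homl (collapse m) h1) [RHS](head_wedgel gg).
      rewrite (ezd0_act h0 _ ord0) head_alpha -[gg _ _]ga -sfun_degen; congr (sfun g' _).
      exact: neck_simp_ext.
    rewrite (wedge_homr (collapse m) h1) -[RHS]/(tailm gg k x) -hg; congr (sfun g' _).
    exact: neck_simp_ext.
  apply: (etrans (wedge_scomp_nat (collapse m) h1 (xof r) (xbead c))).
  by rewrite hx collapse_xbead wedge_scomp_id.
set z := headm gg in h0 eL *; subst L; move: eg.
set L1 := flatten _ in g' ga *; set c1 := (fun t => _).
set gg' := (g' : sMap (neck (ezd z :: tags (marks L1))) S).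
rewrite -[beads g']/(Bead (headm gg') c1 :: beads (tailm gg')) => eg.
have eL1 : beads (tailm gg') = L1 := congr1 behead eg.
have e1 : Bead (headm gg') c1 = Bead (ezs z) c1 := congr1 (head (Bead (headm gg') c1)) eg.
have hz : headm gg' = ezs z := congr1 fst (existT_inj e1).
have ga1 : tailm gg' _ (alpha _) = tailm gg _ (alpha _).
  rewrite -!head_omega hz -(surj_end1 (@ez_surj _ _ z)) -vertex_act.
  by rewrite -[X in _ = X](congr1 (fun s => vertex s ord_max) (ezK z)).
have [h1 [hg hx]] := IH (tailm gg) L1 (tailm gg') okr' erefl eL1 ga1.
pose st := stretch (@ez_surj _ _ z).
exists (wedge_hom st h1 : nec_hom (m :: tags r) (ezd z :: tags (marks L1))); split.
  move=> k y; case: (@wedgeP [:: m] (tags r) k y) => [[x ->]|[x ->]].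
    rewrite (wedge_homl st h1) [RHS](head_wedgel gg) [LHS](head_wedgel gg').
    by rewrite stretch_neck1 act_comp hz ezK.
  by rewrite (wedge_homr st h1) -[RHS]/(tailm gg k x) -hg.
apply: (etrans (wedge_scomp_nat st h1 (xof r) (xbead c))).
by rewrite hx stretch_xbead.
Qed.

End Lift.

(** * Uniqueness of maps to the normal form *)

(** The vertices of the necklace [T] at which it is glued, the two ends included. *)
Fixpoint joint (T : seq nat) (v : nat) : Prop :=
  match T with
  | [::] => v = 0
  | n :: T' => v = 0 \/ n <= v /\ joint T' (v - n)
  end.

Lemma joint0 T : joint T 0.
Proof. by case: T => [|n T] //=; left. Qed.

Program Definition drop_bead m T : sMap (neck (m :: T)) (neck T) :=
  @SMap (neck (m :: T)) (neck T) (fun k x => @NeckSimp T k (fun i => nval x i - m)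
    (shift_homo m (@nval_homo _ _ x)) _) _.
Next Obligation.
move=> m T k x; have /= /orP[/forallP h|/andP[]//] := nval_in x.
by apply: in_neck0 => i; have := h i; lia.
Qed.
Next Obligation. by move=> *; apply: neck_simp_ext. Qed.

Section Uniq.
Variable S : sSet.

Fixpoint ndeg_beads (T : seq nat) : sMap (neck T) S -> Prop :=
  match T with
  | [::] => fun _ => True
  | m :: T' => fun g => [/\ 0 < m, nondeg (headm g) & ndeg_beads (tailm g)]
  end.

(** What a map over [S] between flanked pairs does on vertices: the lowest vertex sets are
    the sets of joints, so joints go to joints, and the highest ones contain all vertices,
    so every vertex is attained. *)
Record cover (T T' : seq nat) (g : sMap (neck T) S) (g' : sMap (neck T') S)
    (h : sMap (neck T) (neck T')) : Prop := Cover {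
  cover_over : forall k z, g' k (h k z) = g k z;
  cover_alpha : h _ (alpha T) = alpha T';
  cover_joint : forall z : neck T 0, joint T (nval z ord0) -> joint T' (nval (h _ z) ord0);
  cover_vertex : forall v, v <= sumn T' -> exists z : neck T 0, nval (h _ z) ord0 = v
}.

Lemma wedgel_act m T k (x : neck [:: m] k) :
  wedgel [:: m] T k x = act (neck1 x) (wedgel [:: m] T m (idneck m)).
Proof. exact: neck_simp_ext. Qed.

(** A map of necklaces can only go up: within a bead it is monotone, and consecutive beads
    share a vertex. *)
Lemma alpha_min T T' (h : sMap (neck T) (neck T')) (z : neck T 0) :
  nval (h _ (alpha T)) ord0 <= nval (h _ z) ord0.
Proof.
elim: T h z => [|m T IH] h z.
  have -> : z = alpha [::] by apply: neck_simp_ext => i; have /forallP /(_ i) /eqP := nval_in z.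
  by [].
pose y := h _ (wedgel [:: m] T m (idneck m)).
have hl (x : neck [:: m] 0) : nval (h _ (wedgel [:: m] T 0 x)) ord0 = nval y (neck1 x ord0).
  by rewrite wedgel_act sfun_act.
have ha : nval (h _ (alpha (m :: T))) ord0 = nval y ord0.
  have -> : alpha (m :: T) = wedgel [:: m] T 0 (alpha [:: m]) by exact: neck_simp_ext.
  by rewrite hl; congr (nval y _); apply: val_inj.
case: (@wedgeP [:: m] T 0 z) => [[x ->]|[x ->]].
  by rewrite hl ha; apply: nval_homo.
have := IH (sMap_comp h (wedger [:: m] T)) x; rewrite !sMap_compE.
apply: leq_trans; rewrite -(wedgel_omega [:: m] T) hl ha; exact: nval_homo.
Qed.

Section HeadCases.
Variables (m : nat) (T : seq nat) (g : sMap (neck (m :: T)) S).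
Variables (m' : nat) (T' : seq nat) (g' : sMap (neck (m' :: T')) S).
Hypothesis m'_gt0 : 0 < m'.
Variable h : sMap (neck (m :: T)) (neck (m' :: T')).
Hypothesis hc : cover g g' h.

Let y := h _ (wedgel [:: m] T m (idneck m)).

Lemma cover_wedgel k x : h k (wedgel [:: m] T k x) = act (neck1 x) y.
Proof. by rewrite wedgel_act sfun_act. Qed.

Lemma cover_head0 : nval y ord0 = 0.
Proof.
have := congr1 (fun z : neck (m' :: T') 0 => nval z ord0) (cover_alpha hc).
have -> : alpha (m :: T) = wedgel [:: m] T 0 (alpha [:: m]) by exact: neck_simp_ext.
by rewrite cover_wedgel /= => e; rewrite -[RHS]e; congr (nval y _); apply: val_inj.
Qed.

Lemma cover_tail_ge (x : neck T 0) :
  nval y ord_max <= nval (h _ (wedger [:: m] T 0 x)) ord0.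
Proof.
have := alpha_min (sMap_comp h (wedger [:: m] T)) x; rewrite !sMap_compE.
apply: leq_trans; rewrite -(wedgel_omega [:: m] T) cover_wedgel.
by apply: eq_leq; congr (nval y _); apply: val_inj; rewrite /= addn0.
Qed.

Lemma cover_headl : exists x : neck [:: m'] m, y = wedgel [:: m'] T' m x.
Proof.
case: (@wedgeP [:: m'] T' m y) => // -[x e].
by have := cover_head0; rewrite e /=; lia.
Qed.

Lemma cover_head_joint : joint (m' :: T') (nval y ord_max).
Proof.
pose z := wedgel [:: m] T 0 (omega [:: m]).
have -> : nval y ord_max = nval (h _ z) ord0.
  by rewrite cover_wedgel /=; congr (nval y _); apply: val_inj; rewrite /= addn0.
by apply: (cover_joint hc); right; rewrite /= addn0 subnn leqnn; split=> //; exact: joint0.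
Qed.

(** Where the first bead goes.  Its last vertex is a joint, so it goes to the first vertex
    or to the end of the first bead; in the latter case all vertices of that bead are
    attained, and only the first bead can attain them. *)
Lemma cover_cases :
  (ezd (headm g) = 0 /\ forall i, nval y i = 0) \/
  (exists x : neck [:: m'] m, [/\ y = wedgel [:: m'] T' m x, surj (neck1 x) &
     nval y ord_max = m']).
Proof.
have [x yE] := cover_headl.
have gE : headm g = act (neck1 x) (headm g').
  by rewrite /headm -(cover_over hc) -/y yE head_wedgel.
have le : nval y ord_max <= m' by rewrite yE /=; have := neck1_lt x ord_max; lia.
have [h0|[h1 _]] := cover_head_joint.
  left; have y0 i : nval y i = 0.
    by have := @nval_homo _ _ y i ord_max (leq_ord i); rewrite h0; lia.
  split=> //; rewrite gE.
  have -> : neck1 x = mcomp (mconst 0 ord0) (mconst m ord0).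
    by apply: mono_eqP => i; have := y0 i; rewrite yE.
  by rewrite act_comp ezd_const.
right; exists x; split=> //; last by lia.
move=> v; have vle : v <= sumn (m' :: T') by have := ltn_ord v; rewrite /=; lia.
have [z hz] := cover_vertex hc vle.
have yx i : nval y i = neck1 x i by rewrite yE.
case: (@wedgeP [:: m] T 0 z) => [[x0 e]|[x0 e]].
  by exists (neck1 x0 ord0); apply: val_inj; rewrite -[LHS]yx -[RHS]hz e cover_wedgel.
exists ord_max; apply: val_inj; rewrite -[LHS]yx /=.
by have := cover_tail_ge x0; rewrite -e hz; have := ltn_ord v; lia.
Qed.

End HeadCases.
End Uniq.

Lemma wedger_drop m T k (z : neck (m :: T) k) : (forall i, m <= nval z i) ->
  wedger [:: m] T k (drop_bead m T k z) = z.
Proof. by move=> h; apply: neck_simp_ext => i /=; have := h i; lia. Qed.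

Lemma nval_vertex T k (x : neck T k) i : nval x i = nval (vertex x i) ord0.
Proof. by []. Qed.

(** Induction on the beads of [T].  Whether the first bead collapses is decided by the
    dimension of its nondegenerate part; if it does not, it is mapped by a surjection
    which [ez_map_uniq] determines. *)
Lemma lift_uniq (S : sSet) (T T' : seq nat) (g : sMap (neck T) S) (g' : sMap (neck T') S)
    (h h' : sMap (neck T) (neck T')) : ndeg_beads g' -> cover g g' h -> cover g g' h' ->
  forall k x, h k x = h' k x.
Proof.
elim: T T' g g' h h' => [|m T IH] T' g g' h h' nd hc hc' k x.
  have -> : x = degen k (alpha [::]).
    by apply: neck_simp_ext => i; have /forallP /(_ i) /eqP := nval_in x.
  by rewrite !sfun_degen (cover_alpha hc) (cover_alpha hc').
case: T' g' h h' nd hc hc' => [|m' T'] g' h h' nd hc hc'.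
  apply: neck_simp_ext => i; have /forallP /(_ i) /eqP -> := nval_in (h k x).
  by have /forallP /(_ i) /eqP -> := nval_in (h' k x).
case: nd => m'_gt0 nd1 nd2.
pose y := h _ (wedgel [:: m] T m (idneck m)); pose y' := h' _ (wedgel [:: m] T m (idneck m)).
have gE (f : sMap (neck (m :: T)) (neck (m' :: T'))) (z : neck [:: m'] m) :
    cover g g' f -> f _ (wedgel [:: m] T m (idneck m)) = wedgel [:: m'] T' m z ->
    headm g = act (neck1 z) (headm g').
  by move=> fc e; rewrite /headm -(cover_over fc) e head_wedgel.
have tail_vertex (f : sMap (neck (m :: T)) (neck (m' :: T'))) :
    cover g g' f -> forall k (u : neck T k) i,
      nval (f _ (wedgel [:: m] T m (idneck m))) ord_max <= nval (f k (wedger [:: m] T k u)) i.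
  move=> fc k' u i; rewrite [X in _ <= X]nval_vertex -sfun_vertex.
  have le := cover_tail_ge f (vertex u i).
  apply: (leq_trans le); apply: eq_leq.
  by congr (nval (sfun f _) _); apply: neck_simp_ext.
have head_le (f : sMap (neck (m :: T)) (neck (m' :: T'))) (u : neck [:: m] 0) :
    cover g g' f -> nval (f _ (wedgel [:: m] T 0 u)) ord0 <=
      nval (f _ (wedgel [:: m] T m (idneck m))) ord_max.
  by move=> fc; rewrite wedgel_act sfun_act; apply: nval_homo; apply: leq_ord.
have hom f : cover g g' f -> f _ (wedger [:: m] T 0 (alpha T)) =
    vertex (f _ (wedgel [:: m] T m (idneck m))) ord_max.
  by move=> fc; rewrite -sfun_vertex; congr (sfun f _); apply: neck_simp_ext => i /=; rewrite !addn0.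
suff [ey et] : y = y' /\ forall k u, h k (wedger [:: m] T k u) = h' k (wedger [:: m] T k u).
  case: (@wedgeP [:: m] T k x) => [[u ->]|[u ->]]; last exact: et.
  by rewrite wedgel_act (sfun_act h) (sfun_act h') -/y -/y' ey.
have [[d0 y0]|[z [yE sz ym]]] := cover_cases m'_gt0 hc;
  have [[d0' y0']|[z' [yE' sz' ym']]] := cover_cases m'_gt0 hc'.
- split; first by apply: neck_simp_ext => i; rewrite y0 y0'.
  have c f : cover g g' f -> (forall i, nval (f _ (wedgel [:: m] T m (idneck m))) i = 0) ->
      cover (tailm g) g' (sMap_comp f (wedger [:: m] T)).
    move=> fc f0; split.
    + by move=> k' u; rewrite sMap_compE (cover_over fc).
    + by rewrite sMap_compE hom //; apply: neck_simp_ext => i; apply: f0.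
    + move=> u ju; rewrite sMap_compE; apply: (cover_joint fc); right => /=.
      by rewrite addn0 leq_addr addKn.
    + move=> v /(cover_vertex fc) [u]; case: (@wedgeP [:: m] T 0 u) => [[w ->]|[w ->]] e.
        exists (alpha T); rewrite sMap_compE hom // -e -nval_vertex f0.
        by apply/eqP; rewrite eq_sym -leqn0; apply: leq_trans (head_le f w fc) _; rewrite f0.
      by exists w.
  by move=> k' u; apply: (IH _ _ _ _ _ _ (c h hc y0) (c h' hc' y0')).
- have := gE _ _ hc' yE' => e; move: d0; rewrite e /ezd ez_act //=; lia.
- have := gE _ _ hc yE => e; move: d0'; rewrite e /ezd ez_act //=; lia.
- have e1 := gE _ _ hc yE; have e2 := gE _ _ hc' yE'.
  have zz : neck1 z = neck1 z'.
    by apply: (ez_map_uniq sz nd1 (etrans (esym e1) e2)).2.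
  split.
    have ez : z = z' by rewrite -(neck1K z) -(neck1K z') zz.
    by rewrite /y /y' yE yE' ez.
  have ge f : cover g g' f -> nval (f _ (wedgel [:: m] T m (idneck m))) ord_max = m' ->
      forall k u, wedger [:: m'] T' k (drop_bead m' T' k (f k (wedger [:: m] T k u))) =
                  f k (wedger [:: m] T k u).
    by move=> fc fm k' u; apply: wedger_drop => i; rewrite -{1}fm; apply: tail_vertex.
  have c f : cover g g' f -> nval (f _ (wedgel [:: m] T m (idneck m))) ord_max = m' ->
      cover (tailm g) (tailm g') (sMap_comp (drop_bead m' T') (sMap_comp f (wedger [:: m] T))).
    move=> fc fm; split.
    + move=> k' u; rewrite !sMap_compE -[LHS]/(g' _ (wedger [:: m'] T' _ _)).
      by rewrite ge // (cover_over fc).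
    + rewrite !sMap_compE hom //; apply: neck_simp_ext => i /=.
      by rewrite fm subnn.
    + move=> u ju; rewrite !sMap_compE.
      have : joint (m :: T) (nval (wedger [:: m] T 0 u) ord0).
        by right; rewrite /= addn0 leq_addr addKn.
      move=> /(cover_joint fc) [/= h0|[_ //]].
      by have := tail_vertex f fc 0 u ord0; rewrite fm h0; lia.
    + move=> v vle; have := @cover_vertex _ _ _ _ _ _ fc (m' + v).
      case=> [|u]; first by rewrite /= leq_add2l.
      case: (@wedgeP [:: m] T 0 u) => [[w ->]|[w ->]] e.
        exists (alpha T); rewrite !sMap_compE hom //= fm subnn.
        by have := leq_trans (eq_leq (esym e)) (head_le f w fc); rewrite fm; lia.
      by exists w; rewrite !sMap_compE /= e addKn.
  move=> k' u; rewrite -(ge h hc ym) -(ge h' hc' ym').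
  have e := IH _ _ _ _ _ nd2 (c h hc ym) (c h' hc' ym') k' u.
  by rewrite !sMap_compE in e; rewrite e.
Qed.

(** * Vertex sets of the morphisms of a necklace *)

Section VertexSet.
Variable T : seq nat.
Notation nmor l a b := (shom (s := frakC (neck T)) a b l).

(** An invariant of the morphisms of [frakC (neck T)] that turns out to be complete
    ([vs_inj]). *)
Fixpoint vsw l (a b : neck T 0) (w : word l a b) (t : 'I_l.+1) (v : nat) : Prop :=
  match w with
  | Gen _ s _ _ x _ _ _ _ => exists2 k, k \in (x : chain _ _ _) t & nval (s : neck_simp T _) k = v
  | Id a => nval a ord0 = v
  | Comp _ _ _ y x => vsw y t v \/ vsw x t v
  end.

Lemma vsw_rel l (a b : neck T 0) (w w' : word l a b) t v :
  word_rel w w' -> vsw w t v <-> vsw w' t v.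
Proof.
elim=> {a b w w'} /=.
- move=> m n f s i j x a b _ _ _ _; split.
    by case=> k kx kv; exists (f k) => //; apply: imset_f.
  by case=> _ /imsetP [k kx ->] kv; exists k.
- move=> n s i a p q; split.
    case=> k; rewrite inE => /eqP -> <-; rewrite -p; congr (nval s _); exact: val_inj.
  by rewrite -p => e; exists i; rewrite ?inE // -e; congr (nval s _); apply: val_inj.
- move=> n s i j k y x a b c _ _ _; split.
    case=> u; rewrite inE => /orP[hu|hu] e; [by left; exists u|by right; exists u].
  by case=> [[u hu e]|[u hu e]]; exists u; rewrite ?inE ?hu ?orbT.
- by move=> *; tauto.
- move=> a b u; split=> [[<-|//]|h]; last by right.
  elim: u => [n s i j x {}a {}b p q|//|{}a {}b c y hy x hx] /=.
    have /and3P[_ jx _] := cset_between (x : chain i j l) t.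
    by exists j => //; rewrite -q; congr (nval s _); apply: val_inj.
  by left.
- move=> a b u; split=> [[//|<-]|h]; last by left.
  elim: u => [n s i j x {}a {}b p q|//|{}a {}b c y hy x hx] /=.
    have /and3P[ix _ _] := cset_between (x : chain i j l) t.
    by exists i => //; rewrite -p; congr (nval s _); apply: val_inj.
  by right.
- by move=> a b c y y' x _; tauto.
- by move=> a b c y x x' _; tauto.
Qed.

Definition vs l (a b : frakC (neck T)) (y : nmor l a b) : 'I_l.+1 -> nat -> Prop :=
  qlift (@vsw l a b) y.

Lemma vs_qpi l (a b : neck T 0) (w : word l a b) :
  vs (qpi (@word_rel _ l a b) w : nmor l a b) = vsw w.
Proof.
apply: qliftE => u u' h; apply: funext => t; apply: funext => v; apply: propext.
exact: vsw_rel.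
Qed.

Lemma vs_scomp l (a b c : frakC (neck T)) (y : nmor l b c) (x : nmor l a b) t v :
  vs (scomp y x : nmor l a c) t v <-> vs y t v \/ vs x t v.
Proof. by elim/quot_ind: y => y; elim/quot_ind: x => x; rewrite /= mor_compE !vs_qpi. Qed.

Lemma vs_sid_to l (a b : frakC (neck T)) (e : a = b) t v :
  vs (sid_to e l : nmor l a b) t v <-> nval (a : neck T 0) ord0 = v.
Proof. by destruct e; rewrite /= vs_qpi. Qed.

Lemma vs_act l l' (f : mono l' l) (a b : frakC (neck T)) (y : nmor l a b) t :
  vs (act f y : nmor l' a b) t = vs y (f t).
Proof.
elim/quot_ind: y => w; rewrite /= mor_actE !vs_qpi.
by elim: w => //= a' b' c y -> x ->.
Qed.

Lemma vsw_le l (a b : neck T 0) (w : word l a b) t v : vsw w t v -> v <= sumn T.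
Proof.
elim: w => /= [n s i j x a' b' _ _ [k _ <-]|a' <-|a' b' c y hy x hx [/hy|/hx]] //.
- exact: in_neck_le (nval_in _).
- exact: in_neck_le (nval_in _).
Qed.

Lemma vsw_bounds l (a b : neck T 0) (w : word l a b) t :
  [/\ vsw w t (nval a ord0), vsw w t (nval b ord0) &
      forall v, vsw w t v -> nval a ord0 <= v <= nval b ord0].
Proof.
elim: w => /= [n s i j x a' b' p q|a'|a' b' c y [y1 y2 y3] x [x1 x2 x3]].
- have /and3P[ix jx /subsetP h] := cset_between (x : chain i j l) t.
  have pE : nval a' ord0 = nval s i by rewrite -p; congr (nval s _); apply: val_inj.
  have qE : nval b' ord0 = nval s j by rewrite -q; congr (nval s _); apply: val_inj.
  split; [by exists i|by exists j|move=> v [k /h]].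
  by rewrite inE => /andP[ik kj] <-; rewrite pE qE !nval_homo.
- by split=> // v <-; rewrite leqnn.
- split; [by right|by left|move=> v [/y3|/x3] /andP[h1 h2]]; apply/andP; split=> //.
    by apply: leq_trans h1; have /andP[] := x3 _ x1.
  by apply: leq_trans h2 _; have /andP[] := y3 _ y1.
Qed.

Lemma vs_bounds l (a b : frakC (neck T)) (y : nmor l a b) t :
  [/\ vs y t (nval (a : neck T 0) ord0), vs y t (nval (b : neck T 0) ord0) &
      forall v, vs y t v -> nval (a : neck T 0) ord0 <= v <= nval (b : neck T 0) ord0].
Proof. by elim/quot_ind: y => w; rewrite vs_qpi; apply: vsw_bounds. Qed.

Lemma vs_le l (a b : frakC (neck T)) (y : nmor l a b) t v : vs y t v -> v <= sumn T.
Proof. by elim/quot_ind: y => w; rewrite vs_qpi; apply: vsw_le. Qed.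

(** A simplex of a necklace that reaches both sides of a joint contains it. *)
Lemma joint_in_neck U m (x : 'I_m.+1 -> nat) i j v : in_neck U x -> joint U v ->
  x i <= v <= x j -> v = x i \/ v = x j.
Proof.
elim: U x v => [|n U IH] x v /=.
  by move=> /forallP h ->; left; rewrite (eqP (h i)).
case/orP=> [/forallP h [->|[nv _]] /andP[h1 h2]|/andP[/forallP h hx] hj /andP[h1 h2]].
- by left; lia.
- by right; have := h j; lia.
- have := IH (fun i => x i - n) (v - n) hx.
  have hj' : joint U (v - n) by case: hj => [->|[]//]; rewrite sub0n; apply: joint0.
  have le : x i - n <= v - n <= x j - n by apply/andP; split; apply: leq_sub2r.
  move=> /(_ hj' le); have := h i; have := h j; lia.
Qed.

Lemma joint_vsw l (a b : neck T 0) (w : word l a b) t v : joint T v ->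
  nval a ord0 <= v <= nval b ord0 -> vsw w t v.
Proof.
move=> jv; elim: w => /= [n s i j x a' b' p q|a'|a' b' c y hy x hx].
- have pE : nval a' ord0 = nval s i by rewrite -p; congr (nval s _); apply: val_inj.
  have qE : nval b' ord0 = nval s j by rewrite -q; congr (nval s _); apply: val_inj.
  have /and3P[ix jx _] := cset_between (x : chain i j l) t.
  rewrite pE qE => /(joint_in_neck (nval_in s) jv) [->|->]; [by exists i|by exists j].
- by case/andP => h1 h2; apply/eqP; rewrite eqn_leq h1 h2.
- case/andP=> h1 h2; have [h|h] := leqP (nval b' ord0) v.
    by left; apply: hy; rewrite h h2.
  by right; apply: hx; rewrite h1 (ltnW h).
Qed.

Lemma joint_vs l (y : nmor l (alpha T) (omega T)) t v : joint T v -> v <= sumn T -> vs y t v.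
Proof.
by elim/quot_ind: y => w jv vT; rewrite vs_qpi; apply: joint_vsw => //=; rewrite vT.
Qed.

End VertexSet.

Lemma vs_map T T' (h : sMap (neck T) (neck T')) l (a b : frakC (neck T))
    (a' b' : frakC (neck T')) (p : h _ a = a') (q : h _ b = b')
    (y : shom (s := frakC (neck T)) a b l) t v :
  vs (frakC_map_to h p q l y) t v <->
  exists2 z : neck T 0, vs y t (nval z ord0) & nval (h _ z) ord0 = v.
Proof.
destruct p, q; elim/quot_ind: y => w; rewrite /= mor_mapE !vs_qpi.
elim: w => /= {a b} [n s i j x a b p q|a|a b c y hy x hx].
- split=> [[k kx e]|[z [k kx e] e']].
    exists (vertex (s : neck T n) k).
      by exists k => //=; congr (nval s _); apply: val_inj.
    by rewrite -e sfun_vertex; congr (nval _ _); apply: val_inj.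
  exists k => //; rewrite -e' -[RHS](_ : nval (h 0 (vertex (s : neck T n) k)) ord0 = _).
    by rewrite sfun_vertex; congr (nval _ _); apply: val_inj.
  congr (nval (h 0 _) _); apply: neck_simp_ext => u; rewrite (ord1 u) -e.
  by congr (nval s _); apply: val_inj.
- split=> [<-|[z e <-]]; first by exists a.
  by congr (nval (h 0 _) _); apply: neck_simp_ext => u; rewrite (ord1 u).
- split=> [[/hy|/hx] [z h1 h2]|[z [h1|h1] h2]].
  + by exists z => //; left.
  + by exists z => //; right.
  + by left; apply/hy; exists z.
  + by right; apply/hx; exists z.
Qed.

Lemma vs_wedge T U l (y : shom (s := frakC (neck U)) (alpha U) (omega U) l)
    (x : shom (s := frakC (neck T)) (alpha T) (omega T) l) t v :
  vs (wedge_scomp y x) t v <-> (exists2 u, vs y t u & v = sumn T + u) \/ vs x t v.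
Proof.
have vert R (u : nat) : u <= sumn R -> exists z : neck R 0, nval z ord0 = u.
  elim: R u => [|m R IH] u /=.
    by rewrite leqn0 => /eqP ->; exists (alpha [::]).
  have [um _|mu h] := leqP u m.
    have in1 : in_neck (m :: R) (fun _ : 'I_1 => u).
      by apply/orP; left; apply/forallP.
    by exists (@NeckSimp (m :: R) 0 (fun _ => u) (fun _ _ _ => leqnn _) in1).
  have [|z hz] := IH (u - m); first by rewrite leq_subLR.
  by exists (wedger [:: m] R 0 z); rewrite /= hz; lia.
rewrite /wedge_scomp vs_scomp !vs_map; split=> [[[z hz <-]|[z hz <-]]|[[u hu ->]|h]].
- by left; exists (nval z ord0).
- by right.
- have [z hz] := vert U u (vs_le hu).
  by left; exists z; rewrite ?hz //= hz.
- by right; have [z hz] := vert T v (vs_le h); exists z; rewrite ?hz.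
Qed.

Lemma vs_xbead l m (c : 'I_l.+1 -> {set 'I_m.+1}) t v : ok_flags c ->
  vs (xbead c) t v <-> exists2 k, k \in c t & nat_of_ord k = v.
Proof. by move=> okc; rewrite /xbead vs_qpi /= chain_ofE. Qed.

(** Such a sequence of sets splits at the joints into sequences for the single beads. *)
Lemma vs_exists l T (C : 'I_l.+1 -> nat -> Prop) :
  (forall (t t' : 'I_l.+1) v, t <= t' -> C t v -> C t' v) -> (forall t v, C t v -> v <= sumn T) ->
  (forall t v, v <= sumn T -> joint T v -> C t v) ->
  exists y : shom (s := frakC (neck T)) (alpha T) (omega T) l, forall t v, vs y t v <-> C t v.
Proof.
elim: T C => [|m T IH] C Cm Cle Cj.
  exists (sid_to alpha_omega0 l) => t v; rewrite vs_sid_to /=; split=> [<-|]; first exact: Cj.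
  by move=> /Cle; rewrite leqn0 => /eqP.
have [|||y hy] := IH (fun t v => C t (m + v)).
- by move=> t t' v; apply: Cm.
- by move=> t v /Cle /=; rewrite leq_add2l.
- by move=> t v vT jv; apply: Cj; rewrite /= ?leq_add2l //; right; rewrite leq_addr addKn.
pose c t : {set 'I_m.+1} := [set k : 'I_m.+1 | `[< C t k >]].
have okc : ok_flags c.
  split=> [p q pq|t].
    by apply/subsetP => k; rewrite !inE => /asboolP h; apply/asboolP; apply: Cm h.
  rewrite !inE; apply/andP; split; apply/asboolP; apply: Cj => //=; first by left.
  - by rewrite leq_addr.
  - by right; rewrite subnn; split=> //; apply: joint0.
exists (@wedge_scomp [:: m] T l y (xbead c)) => t v.
apply: (iff_trans (@vs_wedge [:: m] T l y (xbead c) t v)).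
rewrite vs_xbead //=; split=> [[[u /hy hu ->]|[k + <-]]|h].
- by rewrite addn0.
- by rewrite inE => /asboolP.
- have [vm|mv] := leqP v m.
    by right; exists (Ordinal (vm : v < m.+1)); rewrite // inE; apply/asboolP.
  by left; exists (v - m); [apply/hy; rewrite subnKC // ltnW|lia].
Qed.

(** * The vertex set determines the morphism *)

(** The nondegenerate simplices of a necklace are strictly increasing, hence determined by
    their sets of vertices. *)
Lemma nondeg_neck_lt T n (s : neck T n) (i j : 'I_n.+1) : nondeg s -> i < j ->
  nval s i < nval s j.
Proof.
move=> nd ij; rewrite ltn_neqAle nval_homo ?(ltnW ij) // andbT; apply/eqP => e.
case: n s i j nd ij e => [|n] s i j nd ij e; first by move: ij; rewrite (ord1 i) (ord1 j).
have lt : i < n.+1 by have := ltn_ord j; lia.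
have := nd n (sdeg (Ordinal lt)) (act (dface n i.+1) s); rewrite ltnn => h.
suff /h : s = act (sdeg (Ordinal lt)) (act (dface n i.+1) s) by [].
rewrite -act_comp (dface_sdeg (Ordinal lt)).
apply: neck_simp_ext => k; rewrite -[RHS]/(nval s (eidem n.+1 i k)).
have [ki|ki] := eqVneq (k : nat) i.+1; last first.
  have kE : eidem n.+1 i k = k :> nat by rewrite eidemE (negPf ki) subn0.
  by rewrite (val_inj kE).
have kE : eidem n.+1 i k = i :> nat by rewrite eidemE ki eqxx subn1.
rewrite (val_inj kE); apply/eqP; rewrite eqn_leq {1}e !nval_homo //; first by rewrite ki.
by rewrite ki.
Qed.

Lemma incr_eq m n (s : 'I_m.+1 -> nat) (s' : 'I_n.+1 -> nat) :
  (forall i j : 'I_m.+1, i < j -> s i < s j) ->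
  (forall i j : 'I_n.+1, i < j -> s' i < s' j) ->
  (forall v, (exists i, s i = v) <-> (exists i, s' i = v)) ->
  [seq s i | i <- enum 'I_m.+1] = [seq s' i | i <- enum 'I_n.+1].
Proof.
have srt k (f : 'I_k.+1 -> nat) : (forall i j : 'I_k.+1, i < j -> f i < f j) ->
    sorted ltn [seq f i | i <- enum 'I_k.+1].
  move=> h; rewrite sorted_map.
  have := iota_ltn_sorted 0 k.+1; rewrite -val_enum_ord sorted_map.
  by apply: sub_sorted => i j; apply: h.
move=> hs hs' e; apply: (irr_sorted_eq (leT := ltn)).
- exact: ltn_trans.
- exact: ltnn.
- exact: srt.
- exact: srt.
- move=> v; apply/mapP/mapP => [[i _ ->]|[i _ ->]].
    have /e [j <-] : exists i', s i' = s i by exists i.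
    by exists j; rewrite ?mem_enum.
  have /e [j <-] : exists i', s' i' = s' i by exists i.
  by exists j; rewrite ?mem_enum.
Qed.

(** Normal forms can be read off from the vertex sets.  The first cutting point is the
    second smallest element of the lowest set; up to there, the highest set gives the
    simplex of the first bead, and the other sets its flag. *)
Lemma vs_inj_beads T l L L' (a b : frakC (neck T)) (y y' : shom a b l) :
  composes L y -> composes L' y' -> (forall z, List.In z L -> good z) ->
  (forall z, List.In z L' -> good z) -> (forall t v, vs y t v <-> vs y' t v) -> L = L'.
Proof.
have consE (m : nat) (s : neck T m) (c : 'I_l.+1 -> {set 'I_m.+1}) (a1 b1 : frakC (neck T)) (p : vertex s ord0 = a1)
    (x : shom (s := frakC (neck T)) (vertex s ord_max) b1 l) t v : ok_flags c ->
    vs (scomp x (qpi (@word_rel _ l _ _) (Gen (chain_of c : shom (s := frakC_Delta m) _ _ l) p erefl)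
              : shom (s := frakC (neck T)) a1 (vertex s ord_max) l)) t v <->
    vs x t v \/ exists2 k, k \in c t & nval s k = v.
  by move=> okc; rewrite vs_scomp vs_qpi /= chain_ofE.
have nil_lt (m : nat) (s : neck T m) (a1 b1 : frakC (neck T)) (p : vertex s ord0 = a1)
    (x : shom (s := frakC (neck T)) (vertex s ord_max) b1 l) : 0 < m -> nondeg s -> a1 <> b1.
  move=> m0 nd e; have [_ _ h] := vs_bounds x ord0.
  have [_ hb _] := vs_bounds x ord0; have /andP[+ _] := h _ hb.
  rewrite -e -p leqNgt => /negP []; rewrite /=; exact: (nondeg_neck_lt nd).
elim: L L' a y y' => [|[m [s c]] L IH] [|[m' [s' c']] L'] a y y' //.
- case=> e _ [/= p [x [_ _]]] _ g'.
  have [nd [m0 _]] := g' _ (or_introl erefl).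
  by case: (nil_lt _ _ _ _ p x m0 nd e).
- case=> /= p [x [_ _]] [e _] g _.
  have [nd [m0 _]] := g _ (or_introl erefl).
  by case: (nil_lt _ _ _ _ p x m0 nd e).
case=> /= p [x [hx ->]] [p' [x' [hx' ->]]] g g' hv.
have [/= nd [/= m0 fc]] := g _ (or_introl erefl).
have [/= nd' [/= m0' fc']] := g' _ (or_introl erefl).
have okc := flanked_ok fc; have okc' := flanked_ok fc'.
have {}hv t v : (vs x t v \/ exists2 k, k \in c t & nval s k = v) <->
    (vs x' t v \/ exists2 k, k \in c' t & nval s' k = v).
  by rewrite -(consE _ _ _ _ _ p) // -(consE _ _ _ _ _ p') //; apply: hv.
have a0 : nval s ord0 = nval s' ord0.
  exact: (congr1 (fun z : neck T 0 => nval z ord0) (etrans p (esym p'))).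
have [_ xm bx] := vs_bounds x ord0; have [_ xm' bx'] := vs_bounds x' ord0.
have lo t v : vs x t v -> nval s ord_max <= v.
  by move=> h; have [_ _ /(_ _ h) /andP[]] := vs_bounds x t.
have lo' t v : vs x' t v -> nval s' ord_max <= v.
  by move=> h; have [_ _ /(_ _ h) /andP[]] := vs_bounds x' t.
have st : nval s ord0 < nval s ord_max by apply: nondeg_neck_lt nd _.
have st' : nval s' ord0 < nval s' ord_max by apply: nondeg_neck_lt nd' _.
have in0 : ord_max \in c ord0 by case: fc => _ -> _; rewrite !inE eqxx orbT.
have in0' : ord_max \in c' ord0 by case: fc' => _ -> _; rewrite !inE eqxx orbT.
have eend : nval s ord_max = nval s' ord_max.
  apply/eqP; rewrite eqn_leq; apply/andP; split.
    have /hv : vs x' ord0 (nval s' ord_max) \/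
      exists2 k, k \in c' ord0 & nval s' k = nval s' ord_max by right; exists ord_max.
    case=> [/lo //|[k]]; case: fc => _ -> _; rewrite !inE => /orP[] /eqP -> e.
      by move: st'; rewrite -e a0 ltnn.
    by rewrite e.
  have /hv : vs x ord0 (nval s ord_max) \/
    exists2 k, k \in c ord0 & nval s k = nval s ord_max by right; exists ord_max.
  case=> [/lo' //|[k]]; case: fc' => _ -> _; rewrite !inE => /orP[] /eqP -> e.
    by move: st; rewrite -e a0 ltnn.
  by rewrite e.
have im v : (exists i, nval s i = v) <-> (exists i, nval s' i = v).
  split=> [[i e]|[i e]].
    have /hv : vs x ord_max v \/ exists2 k, k \in c ord_max & nval s k = v.
      by right; exists i => //; case: fc => _ _ ->; rewrite inE.
    case=> [/lo' h|[k _ ek]]; last by exists k.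
    exists ord_max; apply/eqP; rewrite eqn_leq h -eend -e nval_homo //.
    exact: leq_ord.
  have /hv : vs x' ord_max v \/ exists2 k, k \in c' ord_max & nval s' k = v.
    by right; exists i => //; case: fc' => _ _ ->; rewrite inE.
  case=> [/lo h|[k _ ek]]; last by exists k.
  exists ord_max; apply/eqP; rewrite eqn_leq h eend -e nval_homo //.
  exact: leq_ord.
have lists := incr_eq (fun i j => nondeg_neck_lt nd) (fun i j => nondeg_neck_lt nd') im.
have mm : m = m'.
  by have := congr1 size lists; rewrite (size_map (nval s)) (size_map (nval s')) !size_enum_ord => -[].
subst m'.
have ss : s = s'.
  apply: neck_simp_ext => i; have := congr1 (fun q => nth 0 q i) lists.
  rewrite (@nth_map _ ord0 _ 0 (nval s)) ?size_enum_ord // (@nth_map _ ord0 _ 0 (nval s')) ?size_enum_ord //.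
  by rewrite nth_ord_enum.
subst s'.
have inj i j : nval s i = nval s j -> i = j.
  move=> e; apply: val_inj; case: (ltngtP i j) => // /(nondeg_neck_lt nd).
    by rewrite e ltnn.
  by rewrite e ltnn.
have cc : c = c'.
  apply: funext => t; apply/setP => k; apply/idP/idP => hk.
    have /hv : vs x t (nval s k) \/ exists2 k', k' \in c t & nval s k' = nval s k.
      by right; exists k.
    case=> [/lo' h|[k' + /inj <- //]].
    have -> : k = ord_max.
      by apply: inj; apply/eqP; rewrite eqn_leq h andbT nval_homo // leq_ord.
    by case: okc' => _ /(_ t) /andP[].
  have /hv : vs x' t (nval s k) \/ exists2 k', k' \in c' t & nval s k' = nval s k.
    by right; exists k.
  case=> [/lo h|[k' + /inj <- //]].
  have -> : k = ord_max.
    by apply: inj; apply/eqP; rewrite eqn_leq h andbT nval_homo // leq_ord.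
  by case: okc => _ /(_ t) /andP[].
subst c'; congr cons; apply: (IH _ _ x x') => //.
- by move=> z hz; apply: g; right.
- by move=> z hz; apply: g'; right.
have top (k : 'I_m.+1) v : nval s k = v -> nval s ord_max <= v -> nval s ord_max = v.
  by move=> e h; apply/eqP; rewrite eqn_leq h -e nval_homo // leq_ord.
move=> t v; split=> h.
  have : vs x' t v \/ exists2 k, k \in c t & nval s k = v by apply/hv; left.
  by case=> [//|[k _ /(top k v) /(_ (lo _ _ h)) <-]]; have [] := vs_bounds x' t.
have : vs x t v \/ exists2 k, k \in c t & nval s k = v by apply/hv; left.
by case=> [//|[k _ /(top k v) /(_ (lo' _ _ h)) <-]]; have [] := vs_bounds x t.
Qed.

Lemma vs_inj T l (a b : frakC (neck T)) (y y' : shom a b l) :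
  (forall t v, vs y t v <-> vs y' t v) -> y = y'.
Proof.
move=> h; have [e g] := composes_nf y; have [e' g'] := composes_nf y'.
have LL := vs_inj_beads e e' g g' h; rewrite -LL in e'; exact: composes_uniq e e'.
Qed.

(** * Homotopy colimits of contractible diagrams *)

Lemma functor_eq (C D : category) (o : C -> D) (h h' : forall a b, hom a b -> hom (o a) (o b))
    p1 p2 q1 q2 : (forall a b (f : hom a b), h a b f = h' a b f) ->
  @Functor C D o h p1 p2 = @Functor C D o h' q1 q2.
Proof.
move=> e; have {}e : h = h'.
  apply: functional_extensionality_dep => a; apply: functional_extensionality_dep => b.
  exact: funext.
by subst h'; congr Functor; apply: Prop_irrelevance.
Qed.

Section HocolimContract.
Variables (I : category) (D : diagram I) (top : forall i, D i 0).
Variable H : forall i, sMap (sProd (D i) (Delta 1)) (D i).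
Hypothesis H0 : forall i k x, H i k (x, pt0 k) = x.
Hypothesis H1 : forall i k x, H i k (x, pt1 k) = degen k (top i).
Hypothesis Htop : forall i k f, H i k (degen k (top i), f) = degen k (top i).

Definition hoc_bisimp k l : Type := {F : functor (ordc k) I & D (F ord0) l}.
Definition hoc_pair k l (F : functor (ordc k) I) (x : D (F ord0) l) : hoc_bisimp k l :=
  existT (fun F : functor (ordc k) I => D (F ord0) l) F x.

Lemma hoc_pair_ext k l (F G : functor (ordc k) I) (e : F = G)
    (x : D (F ord0) l) (y : D (G ord0) l) :
  (forall e0 : F ord0 = G ord0, eq_rect _ (fun i => D i l) x _ e0 = y) ->
  hoc_pair x = hoc_pair y.
Proof. by case: _ / e y => y /(_ erefl) /= ->. Qed.

Program Definition hoc_lev k : sSet :=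
  @SSet (hoc_bisimp k) (fun _ _ f u => hoc_pair (act f (projT2 u))) _ _.
Next Obligation. by move=> k n [F x]; rewrite /= act_id. Qed.
Next Obligation. by move=> k n1 n2 n3 f g [F x]; rewrite /= act_comp. Qed.

Definition hoc_bact m n (f : mono m n) l (u : hoc_bisimp n l) : hoc_bisimp m l :=
  @hoc_pair m l (functor_mono (projT1 u) f)
    (dmap D (fhom (projT1 u) (leq0n (f ord0) : @hom (ordc n) ord0 (f ord0))) l (projT2 u)).

Program Definition hoc_space : sspace :=
  @SSpace hoc_lev (fun m n f => @SMap (hoc_lev n) (hoc_lev m) (fun l => @hoc_bact m n f l) _) _ _.
Next Obligation. by move=> m n f k l g [F x]; rewrite /hoc_bact /= sfun_act. Qed.
Next Obligation.
move=> n k [F x]; apply: hoc_pair_ext; first exact: functor_mono_id.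
move=> /= e; rewrite eq_rect_id (_ : fhom F _ = idc (F ord0)) ?dmap_id // -fhom_id.
by congr fhom; apply: bool_irrelevance.
Qed.
Next Obligation.
move=> p m n f g k [F x]; apply: hoc_pair_ext; first exact: functor_mono_comp.
move=> /= e; rewrite eq_rect_id -dmap_comp -fhom_comp.
set h1 := leq0n _; set h2 := compc _ _.
by rewrite (bool_irrelevance (h1 : is_true _) (h2 : is_true _)).
Qed.

Program Definition hoc_push k : sMap (sProd (hoc_lev k) (Delta 1)) (hoc_lev k) :=
  @SMap (sProd (hoc_lev k) (Delta 1)) (hoc_lev k)
    (fun n x => hoc_pair (H (projT1 x.1 ord0) n (projT2 x.1, x.2))) _.
Next Obligation. by move=> k m n f [[F x] g]; rewrite /= -sfun_act. Qed.

Program Definition hoc_contraction k : contraction (hoc_lev k) (nerve I k) :=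
  @Contraction (hoc_lev k) (nerve I k) (fun _ x => projT1 x) (fun _ _ _ _ => erefl)
    (fun F => @hoc_pair k 0 F (top (F ord0))) (fun _ => erefl)
    (sfst _ _) (hoc_push k) _ _ _ _ _.
Next Obligation. by []. Qed.
Next Obligation.
move=> k n [F x] f e; have {e} xE : x = degen n (top (F ord0)) := existT_inj e.
by rewrite /= xE Htop.
Qed.
Next Obligation. by move=> k n [F x] /=; rewrite H0. Qed.
Next Obligation. by []. Qed.
Next Obligation. by move=> k n [F x] /=; rewrite H1. Qed.

(** Levelwise in the direction [k] of the index category, the fibre over [F] is [D (F 0)],
    which [H (F 0)] contracts. *)
Lemma kan_equivalence_hocolim : kan_equivalence (hocolim_to_nerve D).
Proof.
have h : kan_equivalence (diag_proj (X := hoc_space) (Y := nerve I) (ctr := hoc_contraction)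
    (fun _ _ _ _ _ => erefl)) by apply: kan_equivalence_diag.
pose r : sMap (diag hoc_space) (hocolim D) :=
  @SMap (diag hoc_space) (hocolim D) (fun n x => x) (fun _ _ _ _ => erefl).
pose s : sMap (hocolim D) (diag hoc_space) :=
  @SMap (hocolim D) (diag hoc_space) (fun n x => x) (fun _ _ _ _ => erefl).
exact: (kan_equivalence_retract (r := r) (s := s) _ _ _ h).
Qed.

End HocolimContract.

Section NecklaceContract.
Variable T : seq nat.
Notation CT := (shom (s := frakC (neck T)) (alpha T) (omega T)).

Lemma vs_mono l (y : CT l) (t t' : 'I_l.+1) v : t <= t' -> vs y t v -> vs y t' v.
Proof.
move=> tt'; elim/quot_ind: y => w; rewrite vs_qpi.
elim: w => //= [n s i j x a b _ _ [k kx e]|a b c y hy x hx [/hy|/hx]]; [|by left|by right].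
by exists k => //; apply: (subsetP (cset_mono x tt')).
Qed.

(** All vertices are added from the moment when [f] takes the value 1: this is the homotopy
    from the identity to the greatest element. *)
Lemma fill_exists l (y : CT l) (f : mono l 1) : exists y' : CT l,
  forall t v, vs y' t v <-> vs y t v \/ (0 < f t /\ v <= sumn T).
Proof.
apply: vs_exists => [t t' v tt' [h|[ft vT]]|t v [/vs_le|[]] //|t v vT jv].
- by left; apply: vs_mono h.
- by right; split=> //; apply: leq_trans (mono_homo f tt').
- by left; apply: joint_vs.
Qed.

Definition fill l (y : CT l) (f : mono l 1) : CT l := sval (cid (fill_exists y f)).
Lemma fillP l (y : CT l) (f : mono l 1) t v :
  vs (fill y f) t v <-> vs y t v \/ (0 < f t /\ v <= sumn T).
Proof. exact: svalP (cid (fill_exists y f)) t v. Qed.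

Program Definition fill_map : sMap (sProd CT (Delta 1)) CT :=
  @SMap (sProd CT (Delta 1)) CT (fun l x => fill x.1 x.2) _.
Next Obligation.
move=> m n f [y g]; apply: vs_inj => t v.
by rewrite fillP [X in vs X](_ : _ = act f y) // !vs_act fillP.
Qed.

Lemma top_exists : exists y : CT 0, forall t v, vs y t v <-> v <= sumn T.
Proof. by apply: vs_exists. Qed.

Definition neck_top : CT 0 := sval (cid top_exists).
Lemma neck_topP l (t : 'I_l.+1) v : vs (degen l neck_top : CT l) t v <-> v <= sumn T.
Proof. by rewrite /degen vs_act; apply: svalP (cid top_exists) _ _. Qed.

Lemma fill0 l (y : CT l) : fill y (pt0 l) = y.
Proof. by apply: vs_inj => t v; rewrite fillP; split=> [[//|[]]|] //; left. Qed.

Lemma fill1 l (y : CT l) : fill y (pt1 l) = degen l neck_top.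
Proof.
apply: vs_inj => t v; rewrite fillP neck_topP /=; split=> [[/vs_le //|[]//]|vT].
by right.
Qed.

Lemma fill_top l (f : mono l 1) : fill (degen l neck_top : CT l) f = degen l neck_top.
Proof. by apply: vs_inj => t v; rewrite fillP neck_topP; tauto. Qed.

End NecklaceContract.

Lemma kan_equivalence_hoc_nec (S : sSet) (a b : S 0) :
  kan_equivalence (hocolim_to_nerve (nec_diagram a b)).
Proof.
apply: (kan_equivalence_hocolim (D := nec_diagram a b)
  (top := fun A => neck_top (over_nec A)) (H := fun A => fill_map (over_nec A))).
- by move=> A k x; apply: fill0.
- by move=> A k x; apply: fill1.
- by move=> A k f; apply: fill_top.
Qed.

(** * Contractions of nerves *)

Section NatHtpy.
Variables (C : category) (P Q : functor C C) (eta : forall c, hom (P c) (Q c)).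
Hypothesis eta_nat : forall c d (f : hom c d),
  compc (eta d) (fhom P f) = compc (fhom Q f) (eta c).

(** A natural transformation is a functor from the product with the arrow category; a
    simplex of [Delta 1] picks at each vertex the source or the target. *)
Definition pick_ob (c : C) (b : bool) : C := if b then Q c else P c.

Definition pick_hom c d (f : hom c d) (b b' : bool) :
    (b ==> b') -> hom (pick_ob c b) (pick_ob d b') :=
  match b as b0, b' as b1 return (b0 ==> b1) -> hom (pick_ob c b0) (pick_ob d b1) with
  | false, false => fun _ => fhom P f
  | false, true => fun _ => compc (fhom Q f) (eta c)
  | true, true => fun _ => fhom Q f
  | true, false => fun h => False_rect _ (Bool.diff_false_true h)
  end.

Lemma le_implb n (p : mono n 1) (i j : 'I_n.+1) : i <= j -> (0 < p i) ==> (0 < p j).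
Proof. by move=> ij; apply/implyP => h; apply: leq_trans (mono_homo p ij). Qed.

Lemma pick_id c b (h : b ==> b) : pick_hom (idc c) h = idc (pick_ob c b).
Proof. by case: b h => h; rewrite /= fhom_id. Qed.

Lemma pick_comp c d e (g : hom d e) (f : hom c d) b b' b'' (h : b ==> b') (h' : b' ==> b'')
    (h'' : b ==> b'') :
  pick_hom (compc g f) h'' = compc (pick_hom g h') (pick_hom f h).
Proof.
case: b b' b'' h h' h'' => [] [] [] h h' h'' //=; rewrite ?fhom_comp //.
- by rewrite compcA.
- by rewrite -[RHS]compcA eta_nat compcA.
Qed.

Program Definition htpy_functor n (F : functor (ordc n) C) (p : mono n 1) :
    functor (ordc n) C :=
  @Functor (ordc n) C (fun i => pick_ob (F i) (0 < p i))
    (fun i j h => pick_hom (fhom F h) (le_implb p h)) _ _.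
Next Obligation.
move=> n F p i; have e := fhom_id F i.
by apply: (etrans (congr1 (fun f => pick_hom f _) e)); apply: pick_id.
Qed.
Next Obligation.
move=> n F p i j k g f; have e := fhom_comp F g f.
by apply: (etrans (congr1 (fun f => pick_hom f _) e)); apply: pick_comp.
Qed.

Program Definition nat_htpy : sMap (sProd (nerve C) (Delta 1)) (nerve C) :=
  @SMap (sProd (nerve C) (Delta 1)) (nerve C) (fun n x => htpy_functor x.1 x.2) _.
Next Obligation.
move=> m n f [F p]; apply: functor_eq => i j h /=; congr pick_hom; exact: Prop_irrelevance.
Qed.

End NatHtpy.

Program Definition functor_compose (A B C : category) (G : functor B C) (F : functor A B) :
    functor A C := @Functor A C (fun a => G (F a)) (fun a b f => fhom G (fhom F f)) _ _.
Next Obligation. by move=> *; rewrite /= !fhom_id. Qed.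
Next Obligation. by move=> *; rewrite /= !fhom_comp. Qed.

Program Definition id_functor (C : category) : functor C C :=
  @Functor C C (fun c => c) (fun a b f => f) (fun _ => erefl) (fun _ _ _ _ _ => erefl).

Lemma nat_htpy0 C P Q eta h n (F : nerve C n) :
  @nat_htpy C P Q eta h n (F, pt0 n) = functor_compose P F.
Proof. exact: functor_eq. Qed.

Lemma nat_htpy1 C P Q eta h n (F : nerve C n) :
  @nat_htpy C P Q eta h n (F, pt1 n) = functor_compose Q F.
Proof. exact: functor_eq. Qed.

Section CatContract.
Variables (E : category) (Y : Type) (ev : E -> Y) (t : Y -> E).
Variables (flanked_ob : E -> Prop) (phi : E -> E) (eps : forall c, hom (phi c) c).
Hypothesis ev_hom : forall c d, hom c d -> ev c = ev d.
Hypothesis ev_t : forall y, ev (t y) = y.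
Hypothesis flanked_t : forall y, flanked_ob (t y).
Hypothesis flanked_phi : forall c, flanked_ob (phi c).
Hypothesis term_ex : forall o, flanked_ob o -> inhabited (hom o (t (ev o))).
Hypothesis term_uq : forall o y (f g : hom o (t y)), flanked_ob o -> f = g.
Hypothesis lift_ex : forall o c (f : hom o c), flanked_ob o -> exists f', compc (eps c) f' = f.
Hypothesis lift_uq : forall o c (f f' : hom o (phi c)), flanked_ob o ->
  compc (eps c) f = compc (eps c) f' -> f = f'.

(** The coreflection, modified to be the identity on the objects [t y], so that the
    homotopies preserve the base. *)
Definition refl_pair (c : E) : {o : E & hom o c} :=
  if pselect (c = t (ev c)) is left _
  then existT (fun o => hom o c) c (idc c) else existT (fun o => hom o c) (phi c) (eps c).
Definition rphi c : E := tag (refl_pair c).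
Definition reps c : hom (rphi c) c := tagged (refl_pair c).

Lemma rphi_t c : c = t (ev c) -> rphi c = c.
Proof. by rewrite /rphi /refl_pair; case: pselect. Qed.

Lemma flanked_rphi c : flanked_ob (rphi c).
Proof. by rewrite /rphi /refl_pair; case: pselect => [e|e] //=; rewrite e. Qed.

Lemma rlift_ex o c (f : hom o c) : flanked_ob o -> exists f', compc (reps c) f' = f.
Proof.
rewrite /reps /rphi /refl_pair; case: pselect => e Fo; last exact: lift_ex.
by exists f; rewrite comp1c.
Qed.

Lemma rlift_uq o c (f f' : hom o (rphi c)) : flanked_ob o ->
  compc (reps c) f = compc (reps c) f' -> f = f'.
Proof.
rewrite /reps; move: f f'; rewrite /rphi /refl_pair.
by case: pselect => e f f' Fo; [rewrite !comp1c|apply: lift_uq].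
Qed.

Definition rlift c d (f : hom c d) : hom (rphi c) (rphi d) :=
  sval (cid (rlift_ex (compc f (reps c)) (flanked_rphi c))).
Lemma rliftP c d (f : hom c d) : compc (reps d) (rlift f) = compc f (reps c).
Proof. exact: svalP (cid (rlift_ex _ _)). Qed.

Program Definition rphi_functor : functor E E := @Functor E E rphi rlift _ _.
Next Obligation.
by move=> c; apply: rlift_uq; rewrite ?rliftP ?comp1c ?compc1 //; apply: flanked_rphi.
Qed.
Next Obligation.
move=> a b c g f; apply: rlift_uq; first exact: flanked_rphi.
by rewrite rliftP compcA rliftP -!compcA rliftP.
Qed.

Definition tev c : E := t (ev c).

Lemma to_tev o c : flanked_ob o -> hom o c -> inhabited (hom o (tev c)).
Proof. by move=> Fo /ev_hom e; rewrite /tev -e; apply: term_ex. Qed.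

Lemma tev_hom_ex c d (f : hom c d) : inhabited (hom (tev c) (tev d)).
Proof. by rewrite /tev -(ev_hom f); exact: (inhabits (idc _)). Qed.

Definition tev_hom c d (f : hom c d) : hom (tev c) (tev d) :=
  sval (cid (let: inhabits g := tev_hom_ex f in ex_intro (fun _ => True) g I)).

Program Definition tev_functor : functor E E := @Functor E E tev tev_hom _ _.
Next Obligation. by move=> c; apply: term_uq; apply: flanked_t. Qed.
Next Obligation. by move=> *; apply: term_uq; apply: flanked_t. Qed.

Definition rtau c : hom (rphi c) (tev c) :=
  sval (cid (let: inhabits g := to_tev (flanked_rphi c) (reps c) in ex_intro (fun _ => True) g I)).

Lemma rtau_nat c d (f : hom c d) :
  compc (rtau d) (rlift f) = compc (tev_hom f) (rtau c).
Proof. by apply: term_uq; apply: flanked_rphi. Qed.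

Definition const_functor n y : functor (ordc n) E :=
  @Functor (ordc n) E (fun _ => t y) (fun _ _ _ => idc (t y)) (fun _ => erefl)
    (fun _ _ _ _ _ => esym (comp1c (idc (t y)))).

Lemma constP n (F : nerve E n) y : (forall i, F i = t y) -> F = degen n (const_functor 0 y : nerve E 0).
Proof.
case: F => o h p1 p2 /= /funext e; subst o; apply: functor_eq => i j f.
by apply: term_uq; apply: flanked_t.
Qed.

Definition nerve_ev n (F : nerve E n) : Y := ev (F ord0).

Lemma nerve_ev_eq n (F : nerve E n) i : ev (F i) = nerve_ev F.
Proof. by symmetry; apply: ev_hom; apply: (fhom F (leq0n i : @hom (ordc n) ord0 i)). Qed.

Lemma nerve_base n (F : nerve E n) :
  F = degen n (const_functor 0 (nerve_ev F) : nerve E 0) -> forall i, F i = t (nerve_ev F).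
Proof. by move=> -> i /=; rewrite /nerve_ev /= ev_t. Qed.

(** The objects in [flanked_ob] are coreflective by [phi], and among those over [y] the
    object [t y] is terminal: the zigzag is [c <- phi c -> t (ev c)]. *)
Program Definition nerve_contraction : contraction (nerve E) Y :=
  @Contraction (nerve E) Y nerve_ev _ (fun y => const_functor 0 y : nerve E 0) _
    (nat_htpy (P := rphi_functor) (Q := id_functor E) (eta := reps) _)
    (nat_htpy (P := rphi_functor) (Q := tev_functor) (eta := rtau) _) _ _ _ _ _.
Next Obligation. by move=> m n f F; exact: (nerve_ev_eq F (f ord0)). Qed.
Next Obligation. by move=> y; apply: ev_t. Qed.
Next Obligation. by move=> c d f; apply: rliftP. Qed.
Next Obligation. by move=> c d f; apply: rtau_nat. Qed.
Next Obligation.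
move=> n F p /= /nerve_base Ft.
have h i : htpy_functor (P := rphi_functor) (Q := id_functor E) rliftP F p i = t (nerve_ev F).
  rewrite /= /pick_ob; case: ifP => _; rewrite ?Ft //= rphi_t ?ev_t //.
rewrite /nerve_ev h ev_t; exact: constP.
Qed.
Next Obligation.
move=> n F p /= /nerve_base Ft.
have h i : htpy_functor (P := rphi_functor) (Q := tev_functor) rtau_nat F p i = t (nerve_ev F).
  by rewrite /= /pick_ob; case: ifP => _; rewrite Ft /= ?rphi_t /tev ?ev_t //.
rewrite /nerve_ev h ev_t; exact: constP.
Qed.
Next Obligation. by move=> n F; rewrite !nat_htpy0. Qed.
Next Obligation. by move=> n [o h p1 p2]; rewrite nat_htpy1; apply: functor_eq. Qed.
Next Obligation.
move=> n F; rewrite nat_htpy1; set G := functor_compose _ _.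
have h i : G i = t (nerve_ev F) by rewrite /= /tev nerve_ev_eq.
rewrite /nerve_ev h ev_t; exact: constP.
Qed.

End CatContract.

(** * The canonical necklace of a morphism *)

Section Universal.
Variables (S : sSet) (l : nat).

Definition good_marks (r : seq (mark l)) : Prop := forall z, List.In z r -> good_mark z.

Lemma good_marks_ok (r : seq (mark l)) : good_marks r ->
  forall z, List.In z r -> ok_flags (tagged z).
Proof. by move=> h z /h [_ /flanked_ok]. Qed.

Lemma vs_xof_joint (r : seq (mark l)) v : good_marks r ->
  vs (xof r) ord0 v <-> joint (tags r) v.
Proof.
elim: r v => [|[m c] r IH] v hr; first by rewrite vs_sid_to /=; split=> ->.
have [/= m0 fc] := hr _ (or_introl erefl).
have hr' : good_marks r by move=> z hz; apply: hr; right.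
apply: (iff_trans (@vs_wedge [:: m] (tags r) l (xof r) (xbead c) ord0 v)).
rewrite vs_xbead; last exact: flanked_ok.
case: fc => _ -> _ /=; rewrite addn0; split=> [[[u /(IH u hr') hu ->]|[k + <-]]|[->|[mv hv]]].
- by right; rewrite leq_addr addKn.
- rewrite !inE => /orP[] /eqP -> /=; first by left.
  by right; rewrite leqnn subnn; split=> //; apply: joint0.
- by right; exists ord0; rewrite // !inE eqxx.
- by left; exists (v - m); [apply/IH|lia].
Qed.

Lemma vs_xof_all (r : seq (mark l)) v : good_marks r -> v <= sumn (tags r) ->
  vs (xof r) ord_max v.
Proof.
elim: r v => [|[m c] r IH] v hr /= vr.
  by rewrite vs_sid_to /=; move: vr; rewrite leqn0 => /eqP ->.
have [/= m0 fc] := hr _ (or_introl erefl).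
have hr' : good_marks r by move=> z hz; apply: hr; right.
apply/(@vs_wedge [:: m] (tags r) l (xof r) (xbead c) ord_max v).
rewrite vs_xbead; last exact: flanked_ok.
have [vm|mv] := leqP v m.
  by right; exists (Ordinal (vm : v < m.+1)) => //; case: fc => _ _ ->; rewrite inE.
by left; exists (v - m); [apply: IH => //; lia|rewrite /=; lia].
Qed.

Lemma good_ndeg (r : seq (mark l)) (g : sMap (neck (tags r)) S) :
  (forall z, List.In z (beads g) -> good z) -> ndeg_beads g.
Proof.
elim: r g => [//|[m c] r IH] g h; have [h1 [h2 _]] := h _ (or_introl erefl).
by split=> //; apply: (IH (tailm (g : sMap (neck (m :: tags r)) S))) => z hz; apply: h; right.
Qed.

Lemma marks_beads (r : seq (mark l)) (g : sMap (neck (tags r)) S) : marks (beads g) = r.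
Proof.
elim: r g => [//|[m c] r IH] g.
by rewrite -[LHS]/(existT (fun m => 'I_l.+1 -> {set 'I_m.+1}) m c ::
  marks (beads (tailm (g : sMap (neck (m :: tags r)) S)))) IH.
Qed.

Lemma good_marks_of (L : seq (bead S l)) : (forall z, List.In z L -> good z) ->
  good_marks (marks L).
Proof.
move=> h z; elim: L h => [//|y L IH] h [<-|hz].
  by have [] := h y (or_introl erefl).
by apply: IH hz => x hx; apply: h; right.
Qed.

Variables (a b : frakC S).
Notation fmor := (shom (s := frakC S) a b l).

Section OneMor.
Variable y : fmor.

Definition nf_marks : seq (mark l) := marks (nf y).

Lemma nf_marks_good : good_marks nf_marks.
Proof. by apply: good_marks_of; have [] := composes_nf y. Qed.

Definition nf_map : sMap (neck (tags nf_marks)) S := sval (cid (realize (composes_nf y).1)).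

Lemma nf_map_alpha : nf_map _ (alpha _) = a.
Proof. by have [] := svalP (cid (realize (composes_nf y).1)). Qed.
Lemma nf_map_omega : nf_map _ (omega _) = b.
Proof. by have [] := svalP (cid (realize (composes_nf y).1)). Qed.
Lemma nf_map_beads : beads nf_map = nf y.
Proof. by have [] := svalP (cid (realize (composes_nf y).1)). Qed.

Lemma nf_eval : frakC_map_to nf_map nf_map_alpha nf_map_omega l (xof nf_marks) = y.
Proof.
have h := composes_xof nf_map_alpha nf_map_omega; rewrite nf_map_beads in h.
exact: composes_uniq h (composes_nf y).1.
Qed.

Variables (r : seq (mark l)) (g : sMap (neck (tags r)) S).
Variables (p : g _ (alpha _) = a) (q : g _ (omega _) = b).
Hypotheses (hr : good_marks r) (hy : frakC_map_to g p q l (xof r) = y).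

(** The canonical pair of [y] is terminal among the flanked pairs over [y]: existence, and
    uniqueness in [nf_terminal_uq]. *)
Lemma nf_terminal_ex : exists h : nec_hom (tags r) (tags nf_marks),
  (forall k z, nf_map k (h k z) = g k z) /\
  frakC_map_to h (nec_alpha h) (nec_omega h) l (xof r) = xof nf_marks.
Proof.
apply: lift_exists.
- exact: good_marks_ok.
- rewrite -hy; apply: nf_composes; first exact: composes_xof.
  have := marks_beads g; move: (beads g) => L eL z hz; apply: hr; rewrite -eL.
  by elim: L hz {eL} => [//|x L IH] [->|/IH]; [left|right].
- exact: nf_map_beads.
- by rewrite p nf_map_alpha.
Qed.

Lemma nf_terminal_uq (h h' : nec_hom (tags r) (tags nf_marks)) :
  (forall k z, nf_map k (h k z) = g k z) ->
  frakC_map_to h (nec_alpha h) (nec_omega h) l (xof r) = xof nf_marks ->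
  (forall k z, nf_map k (h' k z) = g k z) ->
  frakC_map_to h' (nec_alpha h') (nec_omega h') l (xof r) = xof nf_marks ->
  forall k z, h k z = h' k z.
Proof.
have c (u : nec_hom (tags r) (tags nf_marks)) : (forall k z, nf_map k (u k z) = g k z) ->
    frakC_map_to u (nec_alpha u) (nec_omega u) l (xof r) = xof nf_marks -> cover g nf_map u.
  move=> uo ux; split=> //.
  - exact: nec_alpha.
  - move=> z jz; apply/(vs_xof_joint _ nf_marks_good); rewrite -ux vs_map.
    by exists z => //; apply/vs_xof_joint.
  - move=> v vle; have := vs_xof_all nf_marks_good vle.
    by rewrite -ux vs_map => -[z _ e]; exists z.
move=> h1 h2 h1' h2'; apply: lift_uniq (c h h1 h2) (c h' h1' h2').
by apply: good_ndeg; rewrite nf_map_beads; have [] := composes_nf y.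
Qed.

End OneMor.
End Universal.

(** * Categories of elements *)

Section Elements.
Variables (I : category) (D : diagram I).

#[projections(primitive)]
Record elt (l : nat) := Elt { el_ob : I; el_val : D el_ob l }.

#[projections(primitive)]
Record elt_hom l (c d : elt l) := EltHom {
  el_hom : hom (el_ob c) (el_ob d);
  el_homP : dmap D el_hom l (el_val c) = el_val d
}.

Lemma elt_hom_ext l (c d : elt l) (f g : elt_hom c d) : el_hom f = el_hom g -> f = g.
Proof.
case: f g => [f p] [g q] /= e; subst g; congr EltHom; exact: Prop_irrelevance.
Qed.

Lemma elt_compP l (c d e : elt l) (g : elt_hom d e) (f : elt_hom c d) :
  dmap D (compc (el_hom g) (el_hom f)) l (el_val c) = el_val e.
Proof. by rewrite dmap_comp !el_homP. Qed.

Program Definition elements (l : nat) : category :=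
  @Category (elt l) (@elt_hom l)
    (fun c => @EltHom l c c (idc _) (dmap_id _))
    (fun c d e g f => @EltHom l c e _ (elt_compP g f)) _ _ _.
Next Obligation. by move=> *; apply: elt_hom_ext; apply: compcA. Qed.
Next Obligation. by move=> *; apply: elt_hom_ext; apply: comp1c. Qed.
Next Obligation. by move=> *; apply: elt_hom_ext; apply: compc1. Qed.

Section ElemFunctor.
Variables (l : nat) (J : category) (F : functor J I) (x : forall j, D (F j) l).
Hypothesis xP : forall i j (f : hom i j), dmap D (fhom F f) l (x i) = x j.

Program Definition elem_functor : functor J (elements l) :=
  @Functor J (elements l) (fun j => Elt (x j))
    (fun i j f => @EltHom l (Elt (x i)) (Elt (x j)) (fhom F f) (xP f)) _ _.
Next Obligation. by move=> j; apply: elt_hom_ext; apply: fhom_id. Qed.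
Next Obligation. by move=> *; apply: elt_hom_ext; apply: fhom_comp. Qed.

End ElemFunctor.

Lemma elem_functor_eq l J (F : functor J I) (x x' : forall j, D (F j) l) xP xP' :
  (forall j, x j = x' j) -> @elem_functor l J F x xP = @elem_functor l J F x' xP'.
Proof.
move=> e; have {}e : x = x' by apply: functional_extensionality_dep.
by subst x'; rewrite (Prop_irrelevance xP xP').
Qed.

Definition forget l : functor (elements l) I :=
  @Functor (elements l) I (fun c => el_ob c) (fun c d f => el_hom f)
    (fun _ => erefl) (fun _ _ _ _ _ => erefl).

Lemma elem_functor_eta l J (G : functor J (elements l)) xP :
  @elem_functor l J (functor_compose (forget l) G) (fun j => el_val (G j)) xP = G.
Proof. by case: G xP => o h p1 p2 xP; apply: functor_eq => i j f; apply: elt_hom_ext. Qed.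

Program Definition elt_act l l' (f : mono l' l) : functor (elements l) (elements l') :=
  @Functor (elements l) (elements l') (fun c => Elt (act f (el_val c)))
    (fun c d h => @EltHom l' (Elt (act f (el_val c))) (Elt (act f (el_val d)))
       (el_hom h) _) _ _.
Next Obligation. by move=> l l' f c d h /=; rewrite sfun_act el_homP. Qed.
Next Obligation. by move=> *; apply: elt_hom_ext. Qed.
Next Obligation. by move=> *; apply: elt_hom_ext. Qed.

Definition nerve_map (A B : category) (G : functor A B) : sMap (nerve A) (nerve B) :=
  @SMap (nerve A) (nerve B) (fun n F => functor_compose G F)
    (fun m n f F => functor_eq _ _ _ _ (fun _ _ _ => erefl)).

Lemma elem_value l J (G : functor J (elements l)) i j (f : hom i j) :
  dmap D (el_hom (fhom G f)) l (el_val (G i)) = el_val (G j).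
Proof. exact: el_homP. Qed.

Program Definition elt_space : sspace :=
  @SSpace (fun l => nerve (elements l)) (fun m n f => nerve_map (elt_act f)) _ _.
Next Obligation.
move=> l k G; rewrite -[RHS](elem_functor_eta (@elem_value _ _ G)).
rewrite [LHS](_ : _ = elem_functor (F := functor_compose (forget l) G)
  (@elem_value _ _ (functor_compose (elt_act (mid l)) G))); last by apply: functor_eq => i j h; apply: elt_hom_ext.
by apply: elem_functor_eq => j; apply: act_id.
Qed.
Next Obligation.
move=> p m n f g k G.
rewrite [LHS](_ : _ = elem_functor (F := functor_compose (forget n) G)
  (@elem_value _ _ (functor_compose (elt_act (mcomp g f)) G))); last by apply: functor_eq => i j h; apply: elt_hom_ext.
rewrite [RHS](_ : _ = elem_functor (F := functor_compose (forget n) G)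
  (@elem_value _ _ (functor_compose (elt_act f) (functor_compose (elt_act g) G))));
  last by apply: functor_eq => i j h; apply: elt_hom_ext.
by apply: elem_functor_eq => j; apply: act_comp.
Qed.

Definition elt_to_hoc_fun n (G : functor (ordc n) (elements n)) : hocolim_simp D n :=
  existT (fun F : functor (ordc n) I => D (F ord0) n)
    (functor_compose (forget n) G) (el_val (G ord0)).

Program Definition elt_to_hoc : sMap (diag elt_space) (hocolim D) :=
  @SMap (diag elt_space) (hocolim D) elt_to_hoc_fun _.
Next Obligation.
move=> m n f G; apply: hocolim_ext0; first exact: functor_eq.
move=> /= e; rewrite eq_rect_id sfun_act; congr act; symmetry.
exact: (elem_value G (leq0n (f ord0) : @hom (ordc n) ord0 (f ord0))).
Qed.

Lemma hoc_value n (F : functor (ordc n) I) (x : D (F ord0) n) i j (h : @hom (ordc n) i j) :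
  dmap D (fhom F h) n (dmap D (fhom F (leq0n i : @hom (ordc n) ord0 i)) n x) =
  dmap D (fhom F (leq0n j : @hom (ordc n) ord0 j)) n x.
Proof.
by rewrite -dmap_comp -fhom_comp; congr (dmap D (fhom F _) n x); apply: bool_irrelevance.
Qed.

(** A chain of pairs is determined by the chain of its indices and its value at 0. *)
Program Definition hoc_to_elt : sMap (hocolim D) (diag elt_space) :=
  @SMap (hocolim D) (diag elt_space) (fun n u => elem_functor (@hoc_value n (projT1 u) (projT2 u))) _.
Next Obligation.
move=> m n f [F x] /=.
set G := functor_compose _ _.
rewrite -[RHS](elem_functor_eta (@elem_value _ _ G)).
rewrite [RHS](_ : _ = elem_functor (F := functor_mono F f)
  (x := fun j => act f (dmap D (fhom F (leq0n (f j) : @hom (ordc n) ord0 (f j))) n x))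
  (@elem_value _ _ G)); last by apply: functor_eq => i j h; apply: elt_hom_ext.
apply: elem_functor_eq => j /=; rewrite -sfun_act -dmap_comp -fhom_comp.
by rewrite !sfun_act; congr act; congr (dmap D (fhom F _) n x); apply: bool_irrelevance.
Qed.

Lemma elt_to_hocK n (u : hocolim D n) : elt_to_hoc n (hoc_to_elt n u) = u.
Proof.
case: u => F x; apply: hocolim_ext0 => [|e /=].
  by case: F x => o h p1 p2 x; apply: functor_eq.
rewrite eq_rect_id (_ : fhom F _ = idc (F ord0)) ?dmap_id // -fhom_id.
by congr fhom; apply: bool_irrelevance.
Qed.

End Elements.

(** * The contraction over the morphisms of the colimit *)

Section Frak.
Variables (S : sSet) (a b : frakC S).
Notation DN := (nec_diagram (a : S 0) b).
Notation fhomC := (shom (s := frakC S) a b).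

Section Level.
Variable l : nat.
Notation El := (elements DN l).

(** The two sides of [kan_equivalence_hoc_frakC]: the level [l] is the nerve of [El], and
    [el_ev] is its projection to the [l]-simplices of [frakC S]. *)
Definition el_ev (c : El) : fhomC l :=
  frakC_map_to (over_map (el_ob c)) (over_alpha (el_ob c)) (over_omega (el_ob c)) l (el_val c).

Lemma el_ev_hom (c d : El) : hom c d -> el_ev c = el_ev d.
Proof. by move=> f; rewrite /el_ev -(el_homP f) over_map_cocone. Qed.

Definition el_mk (r : seq (mark l)) (g : sMap (neck (tags r)) S) (p : g _ (alpha _) = a)
    (q : g _ (omega _) = b) : El :=
  @Elt _ DN l (@NecOver S a b (tags r) g p q) (xof r).

(** The terminal flanked pair over [y]. *)
Definition el_t (y : fhomC l) : El := el_mk (nf_map_alpha y) (nf_map_omega y).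

Definition el_flanked (c : El) : Prop := exists (r : seq (mark l)) (g : sMap (neck (tags r)) S)
  (p : g _ (alpha _) = a) (q : g _ (omega _) = b), good_marks r /\ c = el_mk p q.

Lemma el_ev_t y : el_ev (el_t y) = y.
Proof. exact: nf_eval. Qed.

Lemma el_flanked_t y : el_flanked (el_t y).
Proof. by exists (nf_marks y), (nf_map y), (nf_map_alpha y), (nf_map_omega y); split=> //; apply: nf_marks_good. Qed.

Lemma el_term_ex o : el_flanked o -> inhabited (hom o (el_t (el_ev o))).
Proof.
case=> r [g [p [q [hr ->]]]].
have [h [ho hx]] := nf_terminal_ex (y := el_ev (el_mk p q)) (p := p) (q := q) hr erefl.
exact: (inhabits (@EltHom _ DN l (el_mk p q) (el_t (el_ev (el_mk p q)))
  (@NecOverHom S a b (el_ob (el_mk p q)) (el_ob (el_t (el_ev (el_mk p q)))) h ho) hx)).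
Qed.

Lemma el_term_uq o y (f g : hom o (el_t y)) : el_flanked o -> f = g.
Proof.
case=> r [u [p [q [hr e]]]]; move: f g; rewrite {o}e => f g.
apply: elt_hom_ext; apply: nec_over_hom_ext => m x.
apply: (nf_terminal_uq (g := u) hr (y := y)).
- exact: (over_homP (el_hom f)).
- exact: (el_homP f).
- exact: (over_homP (el_hom g)).
- exact: (el_homP g).
Qed.

Section Phi.
Variable c : El.
Let T := over_nec (el_ob c).
Let x : shom (s := frakC (neck T)) (alpha T) (omega T) l := el_val c.

Lemma phi_alpha : sMap_comp (over_map (el_ob c)) (nf_map x) _ (alpha _) = a.
Proof. by rewrite sMap_compE nf_map_alpha over_alpha. Qed.

Lemma phi_omega : sMap_comp (over_map (el_ob c)) (nf_map x) _ (omega _) = b.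
Proof. by rewrite sMap_compE nf_map_omega over_omega. Qed.

(** The coreflection of [(T, x)]: the canonical necklace of [x] over [T], followed by the
    map of [T] to [S]. *)
Definition el_phi : El := el_mk phi_alpha phi_omega.

Definition phi_nec : nec_hom (tags (nf_marks x)) T := NecHom (nf_map_alpha x) (nf_map_omega x).

Definition el_eps : hom el_phi c :=
  @EltHom _ DN l el_phi c (@NecOverHom S a b (el_ob el_phi) (el_ob c) phi_nec
    (fun m z => erefl)) (nf_eval x).

Lemma el_flanked_phi : el_flanked el_phi.
Proof.
exists (nf_marks x), (sMap_comp (over_map (el_ob c)) (nf_map x)), phi_alpha, phi_omega.
by split=> //; apply: nf_marks_good.
Qed.

Lemma el_lift_ex o (f : hom o c) : el_flanked o -> exists f', compc el_eps f' = f.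
Proof.
case=> r [u [p [q [hr e]]]]; move: f; rewrite {o}e => f.
have [h [ho hx]] := nf_terminal_ex (y := x) (g := el_hom f) (p := nec_alpha (el_hom f))
  (q := nec_omega (el_hom f)) hr (el_homP f).
have hov m (z : neck (tags r) m) : over_map (el_ob el_phi) m (h m z) = u m z.
  by rewrite -[LHS]/(over_map (el_ob c) m (nf_map x m (h m z))) ho; apply: (over_homP (el_hom f)).
exists (@EltHom _ DN l (el_mk p q) el_phi
  (@NecOverHom S a b (el_ob (el_mk p q)) (el_ob el_phi) h hov) hx).
by apply: elt_hom_ext; apply: nec_over_hom_ext => m z; apply: ho.
Qed.

Lemma el_lift_uq o (f f' : hom o el_phi) : el_flanked o ->
  compc el_eps f = compc el_eps f' -> f = f'.
Proof.
case=> r [u [p [q [hr e]]]]; move: f f'; rewrite {o}e => f f' ff.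
apply: elt_hom_ext; apply: nec_over_hom_ext => m z.
have ffE k w : nf_map x k (nec_map (el_hom f) k w) = nf_map x k (nec_map (el_hom f') k w).
  exact: (congr1 (fun g : hom (el_mk p q) c => nec_map (el_hom g) k w) ff).
apply: (nf_terminal_uq (y := x) (g := sMap_comp (nf_map x) (nec_map (el_hom f))) hr).
- by [].
- exact: (el_homP f).
- by move=> k w; rewrite sMap_compE ffE.
- exact: (el_homP f').
Qed.

End Phi.

Definition el_contraction : contraction (nerve El) (fhomC l) :=
  nerve_contraction el_ev_hom el_ev_t el_flanked_t el_flanked_phi el_term_ex el_term_uq
    (fun o c => @el_lift_ex c o) (fun o c => @el_lift_uq c o).

End Level.

Lemma el_bact m n (f : mono m n) k (G : elt_space DN n k) :
  ctr_p (el_contraction m) (bact (elt_space DN) f k G) = act f (ctr_p (el_contraction n) G).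
Proof. by rewrite /= /nerve_ev /el_ev /= sfun_act. Qed.

Lemma kan_equivalence_hoc_frakC :
  kan_equivalence (sfhom (hoc_to_frakC S) a b).
Proof.
apply: (kan_equivalence_retract (q := diag_proj el_bact) (r := elt_to_hoc DN)
  (s := hoc_to_elt DN)).
- by [].
- move=> n [F x]; rewrite /= /nerve_ev /el_ev /=.
  exact: (over_map_cocone (fhom F (leq0n ord0 : @hom (ordc n) ord0 ord0)) x).
- exact: elt_to_hocK.
- exact: kan_equivalence_diag.
Qed.

End Frak.

Lemma DK_equivalence_id_ob (C D : sCat) (F : sFunctor C D) (s : D -> C) :
  (forall d, F (s d) = d) -> (forall a b, kan_equivalence (sfhom F a b)) ->
  DK_equivalence F.
Proof.
move=> Fs h; split=> // d; exists (s d).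
rewrite [X in isomorphic X](Fs d); exists (idc d), (idc d); split; exact: comp1c.
Qed.

Theorem theorem5p2 (S : sSet) :
  DK_equivalence (hoc_to_frakC S) /\ DK_equivalence (hoc_to_nec S).
Proof.
split.
- apply: (@DK_equivalence_id_ob (frakC_hoc S) (frakC S) _ (fun a : S 0 => a)) => // a b.
  exact: kan_equivalence_hoc_frakC.
- apply: (@DK_equivalence_id_ob (frakC_hoc S) (frakC_nec S) _ (fun a : S 0 => a)) => // a b.
  exact: kan_equivalence_hoc_nec.
Qed.
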